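(* Let $N\in\{2,3\}$, $d\ge2$, let $\lambda_i>0$ and $\beta_{ii}>0$ for $i=1,\dots,d$, let $\beta_{ij}=\beta_{ji}\in\mathbb{R}$ for $i\ne j$, and let $\mathbf{a}$ be an $m$-decomposition of $d$, with $1\le m\le d$. If - $\beta_{ij}\ge0$ for all $(i,j)\in\mathcal{K}_1$, - $\beta_{ij}\le0$ for all $(i,j)\in\mathcal{K}_2$, and there exist $h_1\ne h_2$ in $\{1,\dots,m\}$ such that $\beta_{ij}<0$ for every $(i,j)\in I_{h_1}\times I_{h_2}$, then the infimum $l:=\inf_{\mathcal{M}}J$ is not achieved, where $$\mathcal{M}=\Big\{\mathbf{u}\in H^1(\mathbb{R}^N;\mathbb{R}^d):\ \sum_{i\in I_h}\|u_i\|_i\ne0\text{ and }\sum_{i\in I_h}\partial_iJ(\mathbf{u})u_i=0\text{ for every }h=1,\dots,m\Big\}.$$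
   Context: $\|u\|_i^2=\int_{\mathbb{R}^N}(|\nabla u|^2+\lambda_iu^2)$. For $\mathbf{u}=(u_1,\dots,u_d)\in H^1(\mathbb{R}^N;\mathbb{R}^d)$ (no radial symmetry imposed), $J(\mathbf{u})=\frac12\sum_{i=1}^d\|u_i\|_i^2-\frac14\sum_{i,j=1}^d\int_{\mathbb{R}^N}\beta_{ij}u_i^2u_j^2$; so $\partial_iJ(\mathbf{u})u_i=\|u_i\|_i^2-\sum_{j=1}^d\int_{\mathbb{R}^N}\beta_{ij}u_i^2u_j^2$. An $m$-decomposition of $d$ is $\mathbf{a}=(a_0,\dots,a_m)\in\mathbb{N}^{m+1}$ with $0=a_0<a_1<\dots<a_m=d$. It induces $I_h=\{i: a_{h-1}<i\le a_h\}$ for $h=1,\dots,m$, $\mathcal{K}_1=\{(i,j): i\ne j,\ (i,j)\in I_h^2\text{ for some }h\}$, $\mathcal{K}_2=\{(i,j)\in I_h\times I_k\text{ with }h\ne k\}$. *)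

(* Defs.v *)
From HB Require Import structures.
From mathcomp Require Import all_boot all_order all_algebra.
From mathcomp Require Import all_classical all_reals all_analysis.

Set Implicit Arguments.
Unset Strict Implicit.
Unset Printing Implicit Defensive.

Import Order.TTheory GRing.Theory Num.Theory.
Import numFieldNormedType.Exports.

Local Open Scope classical_set_scope.
Local Open Scope ring_scope.

Definition rV_display : measure_display -> measure_display.
Proof. exact. Qed.

(* The sigma-algebra on row vectors generated by the coordinate maps, as the
   library does for tuples; over R it is the Borel sigma-algebra of R^n. *)
Section measurable_rV.
Context {d} {T : sigmaRingType d} {n : nat}.

Let coors : 'I_n -> 'rV[T]_n -> T := fun i x => x ord0 i.

Let rV_set0 : g_sigma_preimage coors set0.
Proof. exact: sigma_algebra0. Qed.

Let rV_setC A : g_sigma_preimage coors A -> g_sigma_preimage coors (~` A).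
Proof. exact: sigma_algebraC. Qed.

Let rV_bigcup (F : _^nat) : (forall i, g_sigma_preimage coors (F i)) ->
  g_sigma_preimage coors (\bigcup_i (F i)).
Proof. exact: sigma_algebra_bigcup. Qed.

HB.instance Definition _ := @isMeasurable.Build (rV_display d)
  'rV[T]_n (g_sigma_preimage coors) rV_set0 rV_setC rV_bigcup.

End measurable_rV.

Section lebesgue_rV.
Context {R : realType}.
Implicit Type n : nat.

Lemma measurable_coord n (i : 'I_n) :
  measurable_fun [set: 'rV[R]_n] (fun x : 'rV[R]_n => x ord0 i).
Proof.
move=> _ Y mY; rewrite setTI; apply: sub_sigma_algebra => /=.
rewrite -bigcup_seq/=; exists i => /=; first by rewrite mem_index_enum.
by exists Y => //; rewrite setTI.
Qed.

Lemma measurable_fun_rV d (T : measurableType d) n (f : T -> 'rV[R]_n) :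
  (forall i, measurable_fun [set: T] (fun t => f t ord0 i)) ->
  measurable_fun [set: T] f.
Proof.
move=> mf _; apply: measurability => //= _ [B + <-].
rewrite -bigcup_seq/= => -[i _ [A mA <-]]; rewrite !setTI.
by rewrite -[X in measurable X]setTI; exact: (mf i measurableT A mA).
Qed.

Definition consrV n (p : measurableTypeR R * 'rV[R]_n) : 'rV[R]_n.+1 :=
  \row_j oapp (fun k => p.2 ord0 k) p.1 (unlift ord0 j).

Definition unconsrV n (x : 'rV[R]_n.+1) : measurableTypeR R * 'rV[R]_n :=
  (x ord0 ord0, \row_j x ord0 (lift ord0 j)).

Lemma consrVK n : cancel (@consrV n) (@unconsrV n).
Proof.
move=> [x v]; rewrite /unconsrV /consrV !mxE unlift_none/=; congr pair.
by apply/rowP => j; rewrite !mxE liftK.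
Qed.

Lemma measurable_consrV n : measurable_fun setT (@consrV n).
Proof.
apply: measurable_fun_rV => i.
under eq_fun do rewrite mxE.
case: unliftP => [k _|_] /=; last exact: measurable_fst.
exact: (measurableT_comp (measurable_coord k) measurable_snd).
Qed.

Lemma measurable_unconsrV n : measurable_fun setT (@unconsrV n).
Proof.
apply: measurable_fun_pair; first exact: measurable_coord.
apply: measurable_fun_rV => i.
by under eq_fun do rewrite mxE; exact: measurable_coord.
Qed.

Section lebesgue_rV_succ.
Local Open Scope ereal_scope.
Context n (mu : {sigma_finite_measure set 'rV[R]_n -> \bar R}).

Definition lebesgue_rV_succ : set 'rV[R]_n.+1 -> \bar R :=
  fun A => (@lebesgue_measure R \x mu) (@consrV n @^-1` A).

Let succ0 : lebesgue_rV_succ set0 = 0.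
Proof. by rewrite /lebesgue_rV_succ preimage_set0 measure0. Qed.

Let succ_ge0 A : 0 <= lebesgue_rV_succ A.
Proof. exact: measure_ge0. Qed.

Let succ_sigma_additive : semi_sigma_additive lebesgue_rV_succ.
Proof.
apply: (@measure_semi_sigma_additive _ _ _
  (pushforward (@lebesgue_measure R \x mu) (@consrV n))).
exact: measurable_consrV.
Qed.

HB.instance Definition _ := isMeasure.Build _ _ _ lebesgue_rV_succ
  succ0 succ_ge0 succ_sigma_additive.

Let succ_sigma_finite : sigma_finite setT lebesgue_rV_succ.
Proof.
have /sigma_finiteP[F [TF ndF Foo]] := sigma_finiteT (@lebesgue_measure R).
have /sigma_finiteP[G [TG ndG Goo]] := sigma_finiteT mu.
exists (fun k => @unconsrV n @^-1` (F k `*` G k)) => [|k].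
  apply/seteqP; split=> // x _.
  have [i _ Fi] : (\bigcup_k F k) (unconsrV x).1 by rewrite -TF.
  have [j _ Gj] : (\bigcup_k G k) (unconsrV x).2 by rewrite -TG.
  exists (maxn i j) => //; split.
  - by move: Fi; apply/subsetPset/ndF/leq_maxl.
  - by move: Gj; apply/subsetPset/ndG/leq_maxr.
have [mF Fk] := Foo k; have [mG Gk] := Goo k; split.
  rewrite -[X in measurable X]setTI.
  by apply: measurable_unconsrV => //; exact: measurableX.
rewrite /lebesgue_rV_succ -comp_preimage.
rewrite (_ : _ \o _ = id) ?preimage_id; last exact/funext/consrVK.
by rewrite product_measure1E// lte_mul_pinfty// ge0_fin_numE.
Qed.

HB.instance Definition _ := Measure_isSigmaFinite.Build _ _ _ lebesgue_rV_succ
  succ_sigma_finite.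

End lebesgue_rV_succ.

Fixpoint lebesgue_rV n : {sigma_finite_measure set 'rV[R]_n -> \bar R} :=
  match n with
  | 0 => [the {sigma_finite_measure set 'rV[R]_0 -> \bar R} of
           @dirac _ 'rV[R]_0 (0 : 'rV[R]_0) R]
  | n'.+1 => [the {sigma_finite_measure set 'rV[R]_n'.+1 -> \bar R} of
               lebesgue_rV_succ (lebesgue_rV n')]
  end.

Lemma lebesgue_rV_box n (A : 'I_n -> set R) :
  (forall i, measurable (A i)) ->
  lebesgue_rV n [set x | forall i, A i (x ord0 i)] =
  (\prod_(i < n) @lebesgue_measure R (A i))%E.
Proof.
elim: n A => [|n IH] A mA.
  rewrite big_ord0 /= diracE mem_set// => i; by case: i.
rewrite big_ord_recl -IH// -product_measure1E//; last first.
  rewrite (_ : (fun x => _) = \bigcap_(i in [set: 'I_n])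
     ((fun x : 'rV[R]_n => x ord0 i) @^-1` A (lift ord0 i))).
    apply: fin_bigcap_measurable => // i _.
    by rewrite -[X in measurable X]setTI; exact: measurable_coord.
  by apply/seteqP; split=> [x Ax i _|x Ax i]; [exact: Ax|exact: (Ax i)].
  exact: mA.
rewrite /= /lebesgue_rV_succ; congr (_ _).
apply/seteqP; split=> -[x v] /=.
  move=> Axv; split=> [|i].
    by have := Axv ord0; rewrite /consrV mxE unlift_none.
  by have := Axv (lift ord0 i); rewrite /consrV mxE liftK.
move=> [A0 Av] i; rewrite /consrV mxE.
by case: unliftP => [j ->|->] /=.
Qed.

End lebesgue_rV.

Section sobolev.
Context {R : realType} {N : nat}.
Implicit Types (phi f g u : 'rV[R]_N -> R) (k : 'I_N).

Local Notation mu := (@lebesgue_rV R N).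

Definition partial k phi : 'rV[R]_N -> R :=
  fun x => 'D_(delta_mx ord0 k) phi x.

Definition smooth phi : Prop :=
  forall s : seq 'I_N, let f := foldr partial phi s in
    continuous f /\ forall k x, derivable f x (delta_mx ord0 k).

Definition test_function phi : Prop :=
  smooth phi /\ compact (closure [set x | phi x != 0]).

Definition weak_partial k u g : Prop :=
  forall phi, test_function phi ->
    \int[mu]_x (u x * partial k phi x) = - \int[mu]_x (g x * phi x).

Definition L2 : set ('rV[R]_N -> R) := [set f | f \in Lfun mu 2%:E].

(* Functions rather than a.e.-classes: everything below is invariant under
   modification on null sets. *)
Definition H1 : set ('rV[R]_N -> R) :=
  [set u | L2 u /\ forall k, exists2 g, L2 g & weak_partial k u g].

(* A representative of the k-th weak partial derivative, which is unique up to
   a.e. equality when u is in H^1. *)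
Definition weak_grad u k : 'rV[R]_N -> R :=
  xget (cst 0) [set g | L2 g /\ weak_partial k u g].

Definition H1norm (lam : R) u : R :=
  Num.sqrt (\int[mu]_x ((\sum_k weak_grad u k x ^+ 2) + lam * u x ^+ 2)).

End sobolev.

Section decomposition.
Context {d m : nat}.
Implicit Type a : m.+1.-tuple nat.

Definition is_decomposition a : bool :=
  [&& nth 0%N a 0 == 0%N, nth 0%N a m == d & sorted ltn a].

(* Indices start at 0: i : 'I_d and h : 'I_m stand for i+1 and h+1, so
   a_(h-1) < i <= a_h becomes the condition below. *)
Definition block a (h : 'I_m) : {set 'I_d} :=
  [set i : 'I_d | (nth 0 a h <= i < nth 0 a h.+1)%N]%SET.

Definition K1 a : {set 'I_d * 'I_d} :=
  [set ij : 'I_d * 'I_d | (ij.1 != ij.2) &&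
    [exists h, (ij.1 \in block a h) && (ij.2 \in block a h)]]%SET.

Definition K2 a : {set 'I_d * 'I_d} :=
  [set ij : 'I_d * 'I_d | [exists h, exists k,
    [&& h != k, ij.1 \in block a h & ij.2 \in block a k]]]%SET.

End decomposition.
Arguments is_decomposition d {m} a.

Section functional.
Context {R : realType} {N d : nat}.
Variables (lam : 'I_d -> R) (beta : 'I_d -> 'I_d -> R).
Implicit Types (u : 'I_d -> 'rV[R]_N -> R) (v : 'rV[R]_N -> R).

Definition J u : R :=
  2^-1 * (\sum_i H1norm (lam i) (u i) ^+ 2) -
  4^-1 * (\sum_i \sum_j
    \int[@lebesgue_rV R N]_x (beta i j * u i x ^+ 2 * u j x ^+ 2)).

(* For v = u i in H^1, with beta symmetric, this is
   H1norm (lam i) (u i) ^+ 2 - \sum_j \int beta i j * u i ^+ 2 * u j ^+ 2. *)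
Definition partialJ (i : 'I_d) u v : R :=
  derive1 (fun t : R => J (fun j => if j == i then u i \+ t \*: v else u j)) 0.

Definition Nehari m (a : m.+1.-tuple nat) : set ('I_d -> 'rV[R]_N -> R) :=
  [set u | (forall i, H1 (u i)) /\ forall h : 'I_m,
    \sum_(i in block a h) H1norm (lam i) (u i) != 0 /\
    \sum_(i in block a h) partialJ i u (u i) = 0].

End functional.

(* Main.v *)
(* Cutting off, truncating, translating apart and rescaling the blocks of a family
   v in H^1 gives inf J <= 1/4 sum_h A_h(v)^2 / B_h(v), where A_h is the energy of
   the block h and B_h the quartic interaction inside it; no Sobolev embedding is
   needed. Let u be a minimizer, so that J(u) = 1/4 sum_h A_h(u).

   Taking v = u, the interactions between different blocks vanish, that is,
   B_h(u) = A_h(u), and u_i u_j = 0 a.e. whenever beta_ij < 0 across two blocks.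

   Replacing u_i by sqrt(u_i^2 + s w^2), with w > 0 a fixed weight in H^1, does not
   decrease B_h, hence does not decrease the energy. This says that the integral of
   w^2 |grad u_i - u_i grad w / w|^2 / (u_i^2 + s w^2) is bounded uniformly in
   s > 0. So on almost every line parallel to an axis ln (u_i^2 + s w^2) oscillates
   on segments by an amount independent of s, and letting s tend to 0 shows that
   u_i has no zero on the line or vanishes on all of it. By Fubini, u_i is a.e. zero
   or a.e. nonzero on the whole space, a substitute for the strong maximum
   principle. Two nonzero components, one in each of the blocks h_1 and h_2, then
   contradict u_i u_j = 0. *)
Require Import Defs.
From mathcomp Require Import all_boot all_order all_algebra.
From mathcomp Require Import all_classical all_reals all_analysis.
From mathcomp Require Import measurable_realfun ring lra.

Set Implicit Arguments.
Unset Strict Implicit.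
Unset Printing Implicit Defensive.

Import Order.TTheory GRing.Theory Num.Theory.
Import numFieldNormedType.Exports.

Local Open Scope classical_set_scope.
Local Open Scope ring_scope.

(** * Lebesgue measure on row vectors *)

(** The value A_h^2 / B_h comes from scaling: a block isolated from the others meets its constraint
    after multiplication by t with t^2 = A_h / B_h, and its energy becomes t^2 A_h. The obstacle is
    that the quartic integrals may diverge a priori, while real-valued integrals turn an infinite
    value into 0. The bound on the infimum is therefore stated with arbitrary positive reals below
    the extended integrals B_h, reached by bounded approximations and Fatou's lemma. For a minimizer
    the signs of [beta] give A_h <= B_h, and a strict inequality would produce a competitor below
    J(u); finiteness of the quartic integrals is thus a consequence of minimality.

    The perturbation raises u_i^2 pointwise whatever the sign of u_i, and Lagrange's identity gives
    its energy exactly: that of u_i, plus s times the energy of w, minus s times the defect.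
    Minimality then bounds the defect by the energy of w, without an Euler-Lagrange equation or
    regularity theory. Weak derivatives are treated as absolute continuity on almost every line,
    which yields the chain rule and is also the setting in which zeros are studied. *)

Section boxes.
Context {R : realType} {n : nat}.
Implicit Types (a b : 'I_n -> R).

Definition obox a b : set 'rV[R]_n :=
  [set x | forall i, `]a i, b i[%classic (x ord0 i)].

(* Rational end points, so that a null set can be discarded for all these boxes
   at once. *)
Definition robox (a b : 'I_n -> rat) : set 'rV[R]_n :=
  obox (fun i => ratr (a i)) (fun i => ratr (b i)).

Definition oboxes : set_system 'rV[R]_n :=
  [set A | exists ab : ('I_n -> rat) * ('I_n -> rat), A = robox ab.1 ab.2].

Lemma measurable_obox a b : measurable (obox a b).
Proof.
rewrite (_ : obox a b = \bigcap_(i in [set: 'I_n])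
     ((fun x : 'rV[R]_n => x ord0 i) @^-1` `]a i, b i[%classic)).
  apply: fin_bigcap_measurable => // i _.
  rewrite -[X in measurable X]setTI; exact: (measurable_coord i measurableT).
by apply/seteqP; split=> [x Ax i _|x Ax i]; [exact: Ax|exact: (Ax i)].
Qed.

Lemma setI_closed_oboxes : setI_closed oboxes.
Proof.
have maxr (p q : rat) : ratr (Num.max p q) = Num.max (ratr p) (ratr q) :> R.
  by rewrite !maxElt ltr_rat; case: ifP.
have minr (p q : rat) : ratr (Num.min p q) = Num.min (ratr p) (ratr q) :> R.
  by rewrite !minElt ltr_rat; case: ifP.
move=> _ _ [[a b] ->] [[c d] ->].
exists (fun i => Num.max (a i) (c i), fun i => Num.min (b i) (d i)).
apply/seteqP; split => x /=.
  move=> [xa xc] i; have := xa i; have := xc i.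
  rewrite /= !in_itv/= maxr minr => /andP[? ?] /andP[? ?].
  by rewrite gt_max lt_min; apply/andP; split; apply/andP.
move=> h; split => i; have := h i; rewrite /= !in_itv/= maxr minr gt_max lt_min;
  by move=> /andP[/andP[? ?] /andP[? ?]]; apply/andP.
Qed.

Definition cube (k : nat) : set 'rV[R]_n := obox (fun=> - k%:R) (fun=> k%:R).

Lemma obox_cube k : oboxes (cube k).
Proof.
exists (fun=> - k%:R, fun=> k%:R); rewrite /robox /cube /=.
by congr obox; apply/funext => i; rewrite ?rmorphN /= ratr_nat.
Qed.

Lemma in_cube (x : 'rV[R]_n) (k : nat) : (forall i, `|x ord0 i| < k%:R) -> cube k x.
Proof. by move=> h i; rewrite /= in_itv/= -ltr_norml. Qed.

Lemma cube_bound (x : 'rV[R]_n) : exists k : nat, forall i, `|x ord0 i| < k%:R.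
Proof.
exists (Num.bound (\sum_i `|x ord0 i|)) => i.
apply: le_lt_trans (archi_boundP _); last exact: sumr_ge0.
by rewrite (bigD1 i)//= lerDl sumr_ge0.
Qed.

Lemma cube_cover : \bigcup_k cube k = [set: 'rV[R]_n].
Proof.
apply/seteqP; split => // x _.
by have [k xk] := cube_bound x; exists k => //; exact: in_cube.
Qed.

(** Coordinate half-spaces generate the sigma-algebra. A half-space x_i > r is the countable union
    of the rational boxes with left end q > r in the direction [i] and the ends of a cube
    otherwise. *)
Lemma measurable_oboxes :
  @measurable _ 'rV[R]_n = <<s oboxes >>.
Proof.
apply/seteqP; split; last first.
  move=> A; apply; split; first exact: sigma_algebra_measurable.
  by move=> _ [[a b] ->]; exact: measurable_obox.
apply: smallest_sub; first exact: smallest_sigma_algebra.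
move=> A; rewrite -bigcup_seq => -[i _ [Y mY <-]].
pose T := g_sigma_algebraType oboxes.
suff : measurable_fun [set: T] (fun x : T => (x : 'rV[R]_n) ord0 i).
  by move=> /(_ measurableT _ mY); exact.
move=> mT; apply: (measurability _ (RGenOInfty.measurableE R)) => // _ [_ [r ->] <-].
rewrite setTI.
pose B (qk : rat * nat) := robox (fun j => if j == i then qk.1 else - qk.2%:R)
  (fun=> qk.2%:R).
have -> : (fun x : T => (x : 'rV[R]_n) ord0 i) @^-1` `]r, +oo[%classic =
   \bigcup_(qk in [set qk : rat * nat | r < ratr qk.1]) B qk.
  apply/seteqP; split => x /=.
    rewrite in_itv/= andbT => rx; have [k kx] := cube_bound x.
    have [q] := rat_in_itvoo rx; rewrite in_itv/= => /andP[rq qx].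
    exists (q, k) => // j; rewrite /= in_itv/=.
    have := kx j; rewrite ltr_norml => /andP[kx1 kx2]; rewrite ratr_nat kx2 andbT.
    by case: eqP => [->//|_]; rewrite rmorphN /= ratr_nat.
  move=> [[q k] /= rq /(_ i)]/=; rewrite eqxx in_itv/= in_itv/= => /andP[qx _].
  by rewrite (lt_trans rq).
rewrite bigcup_mkcond; apply: countable_bigcupT_measurable => // qk.
case: ifP => // _; apply: sub_sigma_algebra.
by exists (fun j => if j == i then qk.1 else - qk.2%:R, fun=> qk.2%:R).
Qed.

Lemma lebesgue_obox a b :
  lebesgue_rV n (obox a b) = (\prod_(i < n) @lebesgue_measure R `]a i, b i[%classic)%E.
Proof. exact: (lebesgue_rV_box (fun i => measurable_itv _)). Qed.

Lemma lebesgue_obox_lty a b : (lebesgue_rV n (obox a b) < +oo)%E.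
Proof.
rewrite lebesgue_obox.
have h i : @lebesgue_measure R `]a i, b i[%classic \is a fin_num.
  by rewrite ge0_fin_numE// lebesgue_measure_itv/=; case: ifP => // _; rewrite -EFinD ltry.
have : (\prod_(i < n) @lebesgue_measure R `]a i, b i[%classic)%E \is a fin_num.
  by elim/big_ind: _ => // x y; exact: fin_numM.
by rewrite fin_numElt => /andP[].
Qed.

(** Rational boxes are stable under intersection, generate the measurable sets, and contain cubes of
    finite measure exhausting the space. Fubini in any coordinate, translation invariance and the
    zero-one law all rest on this criterion. *)
Lemma measure_obox_unique (m1 m2 : {measure set 'rV[R]_n -> \bar R}) :
  (forall a b, m1 (obox a b) = m2 (obox a b)) ->
  (forall a b, (m1 (obox a b) < +oo)%E) ->
  forall A, measurable A -> m1 A = m2 A.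
Proof.
move=> m12 m1oo; apply: (measure_unique oboxes cube) => //.
- exact: measurable_oboxes.
- exact: setI_closed_oboxes.
- exact: obox_cube.
- exact: cube_cover.
- by move=> _ [[a b] ->]; exact: m12.
- by move=> k; exact: m1oo.
Qed.

End boxes.

(** * Fubini's theorem in an arbitrary coordinate *)

Section insert_coordinate.
Context {R : realType} {n : nat}.
Implicit Types (k : 'I_n.+1) (t : R) (y : 'rV[R]_n) (x : 'rV[R]_n.+1).
Local Notation mu1 := (@lebesgue_measure R).
Local Notation mu := (@lebesgue_rV R n).
Local Notation mu' := (@lebesgue_rV R n.+1).

Definition ins k t y : 'rV[R]_n.+1 :=
  \row_j oapp (fun l => y ord0 l) t (unlift k j).

Definition del k x : 'rV[R]_n := \row_j x ord0 (lift k j).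

Lemma ins_at k t y : ins k t y ord0 k = t.
Proof. by rewrite mxE unlift_none. Qed.

Lemma ins_lift k t y j : ins k t y ord0 (lift k j) = y ord0 j.
Proof. by rewrite mxE liftK. Qed.

Lemma ins_del k x : ins k (x ord0 k) (del k x) = x.
Proof.
by apply/rowP => j; rewrite mxE; case: unliftP => [i ->|->] //=; rewrite mxE.
Qed.

Lemma del_ins k t y : del k (ins k t y) = y.
Proof. by apply/rowP => j; rewrite !mxE liftK. Qed.

Lemma obox_ins k t y (a b : 'I_n.+1 -> R) : obox a b (ins k t y) <->
  `]a k, b k[%classic t /\ obox (a \o lift k) (b \o lift k) y.
Proof.
split=> [h|[h1 h2] i].
  by split=> [|l]; [have := h k; rewrite ins_at|have := h (lift k l); rewrite ins_lift].
by case: (unliftP k i) => [l ->|->]; [rewrite ins_lift; exact: h2|rewrite ins_at].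
Qed.

Definition insp k (p : measurableTypeR R * 'rV[R]_n) := ins k p.1 p.2.

Lemma measurable_insp k : measurable_fun setT (insp k).
Proof.
apply: measurable_fun_rV => i.
under eq_fun do rewrite mxE.
case: unliftP => [j _|_] /=; last exact: measurable_fst.
exact: (measurableT_comp (measurable_coord j) measurable_snd).
Qed.

Lemma measurable_ins_l k y : measurable_fun setT (fun t : measurableTypeR R => ins k t y).
Proof.
apply: measurable_fun_rV => i.
under eq_fun do rewrite mxE.
by case: unliftP => [j _|_] /=; [exact: measurable_cst|exact: measurable_id].
Qed.

Lemma measurable_del k : measurable_fun setT (del k).
Proof.
apply: measurable_fun_rV => i.
by under eq_fun do rewrite mxE; exact: measurable_coord.
Qed.

(** The measure is built by splitting off coordinate 0, but its product formula on boxes is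
    symmetric in the coordinates, so any coordinate [k] can be split off. *)
Lemma lebesgue_insp k A : measurable A ->
  mu' A = pushforward (mu1 \x mu)%E (insp k) A.
Proof.
move: A; apply: measure_obox_unique => [|mf a b|a b].
- exact: measurable_insp.
- rewrite -[RHS]/((mu1 \x mu)%E (insp k @^-1` obox a b)).
  have -> : insp k @^-1` obox a b =
      `]a k, b k[ `*` obox (a \o lift k) (b \o lift k).
    by apply/seteqP; split => -[t y] /obox_ins.
  rewrite [RHS]product_measure1E//; last exact: measurable_obox.
  rewrite [in RHS]lebesgue_obox -[LHS]/(lebesgue_rV n.+1 (obox a b)).
  by rewrite [LHS]lebesgue_obox (bigD1_ord k).
- exact: lebesgue_obox_lty.
Qed.

Lemma integral_lebesgue_insp k (f : 'rV[R]_n.+1 -> \bar R) :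
  (\int[mu']_x f x = \int[pushforward (mu1 \x mu)%E (insp k)]_x f x)%E.
Proof.
apply: eq_measure_integral; first exact: measurable_insp.
by move=> mf A mA _; rewrite -[LHS]/(mu' A) (lebesgue_insp k).
Qed.

Lemma ge0_integral_insp k (f : 'rV[R]_n.+1 -> \bar R) :
  measurable_fun setT f -> (forall x, 0 <= f x)%E ->
  (\int[mu']_x f x = \int[mu]_y \int[mu1]_t f (ins k t y))%E.
Proof.
move=> mf f0.
rewrite (integral_lebesgue_insp k).
rewrite ge0_integral_pushforward//; last exact: measurable_insp.
rewrite preimage_setT fubini_tonelli2//.
  by apply: measurableT_comp => //; exact: measurable_insp.
by move=> z; exact: f0.
Qed.

Lemma measurable_ge0_integral_ins k (f : 'rV[R]_n.+1 -> \bar R) :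
  measurable_fun setT f -> (forall x, 0 <= f x)%E ->
  measurable_fun setT (fun y => \int[mu1]_t f (ins k t y))%E.
Proof.
move=> mf f0.
have h := @measurable_fun_fubini_tonelli_G _ _ _ _ R mu1 (f \o insp k).
apply: h => [|z]; last exact: f0.
by apply: measurableT_comp => //; exact: measurable_insp.
Qed.

Lemma integrable_insp k (f : 'rV[R]_n.+1 -> \bar R) :
  mu'.-integrable setT f -> (mu1 \x mu)%E.-integrable setT (f \o insp k).
Proof.
move=> /integrableP[mf fi]; apply/integrableP; split.
  by apply: measurableT_comp => //; exact: measurable_insp.
move: fi; rewrite (integral_lebesgue_insp k).
rewrite ge0_integral_pushforward//; first exact: measurable_insp.
exact: measurableT_comp.
Qed.

Lemma integral_insp k (f : 'rV[R]_n.+1 -> \bar R) :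
  mu'.-integrable setT f ->
  (\int[mu']_x f x = \int[mu]_y \int[mu1]_t f (ins k t y))%E.
Proof.
move=> fi.
rewrite (integral_lebesgue_insp k).
rewrite integral_pushforward//; first last.
- by rewrite preimage_setT; exact: integrable_insp.
- exact: measurable_int fi.
- exact: measurable_insp.
rewrite preimage_setT -integral21_prod_meas1//; exact: integrable_insp.
Qed.

Lemma ae_integrable_ins k (f : 'rV[R]_n.+1 -> \bar R) :
  mu'.-integrable setT f ->
  {ae mu, forall y, mu1.-integrable setT (fun t => f (ins k t y))}.
Proof. by move=> /(integrable_insp k) /ae_integrable2. Qed.

Lemma integrable_ins_integral k (f : 'rV[R]_n.+1 -> \bar R) :
  mu'.-integrable setT f ->
  mu.-integrable setT (fun y => \int[mu1]_t f (ins k t y))%E.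
Proof.
move=> fi; have /measurable_fubini_G mG := integrable_insp k fi.
have /integrableP[mf foo] := fi.
apply/integrableP; split; first exact: mG.
apply: le_lt_trans foo.
rewrite (ge0_integral_insp k (f := fun x => `|f x|%E))//; last exact: measurableT_comp.
apply: ge0_le_integral => //.
- by apply: measurableT_comp => //; exact: mG.
- apply: (@measurable_ge0_integral_ins k (fun x => `|f x|%E)) => //.
  exact: measurableT_comp.
move=> y _; apply: le_abse_integral => //.
by apply: (measurableT_comp mf); exact: measurable_ins_l.
Qed.

End insert_coordinate.

(** * Translation invariance *)

Section translation.
Context {R : realType} {n : nat}.
Local Notation mu := (@lebesgue_rV R n).

Lemma measurable_translate (s : 'rV[R]_n) :
  measurable_fun setT (fun x : 'rV[R]_n => x + s).
Proof.
apply: measurable_fun_rV => i; under eq_fun do rewrite mxE.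
by apply: measurable_funD => //; exact: measurable_coord.
Qed.

Lemma lebesgue_translate (s : 'rV[R]_n) A : measurable A ->
  mu A = pushforward mu (fun x : 'rV[R]_n => x + s) A.
Proof.
move: A; apply: measure_obox_unique => [|mf a b|a b].
- exact: measurable_translate.
- rewrite -[RHS]/(mu ((fun x : 'rV[R]_n => x + s) @^-1` obox a b)).
  have -> : (fun x : 'rV[R]_n => x + s) @^-1` obox a b =
      obox (fun i => a i - s ord0 i) (fun i => b i - s ord0 i).
    apply/seteqP; split => x /= h i; have := h i; rewrite /= !in_itv/= mxE.
      by rewrite ltrBlDr ltrBrDr.
    by rewrite ltrBlDr ltrBrDr.
  rewrite -[LHS]/(lebesgue_rV n (obox a b)) lebesgue_obox.
  rewrite -[RHS]/(lebesgue_rV n (obox _ _)) lebesgue_obox.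
  apply: eq_bigr => i _.
  rewrite !lebesgue_measure_itv/= !lte_fin ltrD2r; case: ifP => // _.
  by rewrite -!EFinB; congr EFin; ring.
- exact: lebesgue_obox_lty.
Qed.

Lemma integral_lebesgue_translate (s : 'rV[R]_n) (f : 'rV[R]_n -> \bar R) :
  (\int[mu]_x f x = \int[pushforward mu (fun x : 'rV[R]_n => (x + s)%R)]_x f x)%E.
Proof.
apply: eq_measure_integral; first exact: measurable_translate.
by move=> mf A mA _; rewrite -[LHS]/(mu A) (lebesgue_translate s).
Qed.

Lemma ge0_integral_translate (s : 'rV[R]_n) (f : 'rV[R]_n -> \bar R) :
  measurable_fun setT f -> (forall x, 0 <= f x)%E ->
  (\int[mu]_x f (x + s)%R = \int[mu]_x f x)%E.
Proof.
move=> mf f0; rewrite [RHS](integral_lebesgue_translate s).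
by rewrite ge0_integral_pushforward//; exact: measurable_translate.
Qed.

Lemma integrable_translate (s : 'rV[R]_n) (f : 'rV[R]_n -> \bar R) :
  mu.-integrable setT f -> mu.-integrable setT (fun x => f (x + s)).
Proof.
move=> /integrableP[mf fi]; apply/integrableP; split.
  by apply: measurableT_comp => //; exact: measurable_translate.
rewrite (ge0_integral_translate s (f := fun x => `|f x|%E))//.
exact: measurableT_comp.
Qed.

Lemma integral_translate (s : 'rV[R]_n) (f : 'rV[R]_n -> \bar R) :
  mu.-integrable setT f -> (\int[mu]_x f (x + s)%R = \int[mu]_x f x)%E.
Proof.
move=> fi; rewrite [RHS](integral_lebesgue_translate s).
rewrite integral_pushforward//; first exact: measurable_translate.
- exact: measurable_int fi.
- by rewrite preimage_setT; exact: integrable_translate.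
Qed.

End translation.

(** * Test functions *)

Section continuous_measurable.
Context {R : realType} {n : nat}.

(** The norm is the sup norm, so the rational boxes contained in an open set cover it, and there are
    countably many of them. *)
Lemma open_measurable_rV (U : set 'rV[R]_n) : open U -> measurable U.
Proof.
move=> oU.
pose B (q : {ffun 'I_n -> rat * rat}) : set 'rV[R]_n :=
  obox (fun i => ratr (q i).1) (fun i => ratr (q i).2).
have -> : U = \bigcup_(q in [set q | B q `<=` U]) B q.
  apply/seteqP; split => [x Ux|x [q /= qU /qU]//].
  have /nbhs_ballP[e /= e0 xe] : nbhs x U by exact: open_nbhs_nbhs.
  have h i : exists q : rat * rat,
      (x ord0 i - e < ratr q.1 < x ord0 i) && (x ord0 i < ratr q.2 < x ord0 i + e).
    have [q1] := @rat_in_itvoo R (x ord0 i - e) (x ord0 i) ltac:(by rewrite gtrBl).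
    have [q2] := @rat_in_itvoo R (x ord0 i) (x ord0 i + e) ltac:(by rewrite ltrDl).
    by rewrite !in_itv/= => q2P q1P; exists (q1, q2); rewrite /= q1P q2P.
  have [q qP] := choice h.
  exists [ffun i => q i] => [y By|i] /=.
    apply: xe; split => // j i; rewrite ord1 /ball /=.
    have := By i; rewrite !ffunE /= in_itv/= => /andP[y1 y2].
    have /andP[/andP[x1 x2] /andP[x3 x4]] := qP i.
    by rewrite /ball_/= ltr_norml; apply/andP; split; lra.
  rewrite !ffunE in_itv /=.
  by have /andP[/andP[x1 x2] /andP[x3 x4]] := qP i; rewrite x2 x3.
rewrite bigcup_mkcond; apply: countable_bigcupT_measurable => // q.
by case: ifP => // _; exact: measurable_obox.
Qed.

Lemma continuous_measurable_rV (f : 'rV[R]_n -> R) :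
  continuous f -> measurable_fun setT f.
Proof.
move=> /continuousP cf mT.
apply: (measurability _ (RGenOInfty.measurableE R)) => // _ [_ [r ->] <-].
by rewrite setTI; apply: open_measurable_rV; apply: cf; exact: interval_open.
Qed.

End continuous_measurable.

(** * Derivation rules in pointwise form *)

Section derivation_rules.
Context {R : realType}.
Implicit Types (f g : R -> R) (x a b : R).

Lemma is_derive1_eq f x a b : is_derive x 1 f a -> a = b -> is_derive x 1 f b.
Proof. by move=> + <-. Qed.

Lemma is_derive1D f g x a b : is_derive x 1 f a -> is_derive x 1 g b ->
  is_derive x 1 (fun t => f t + g t) (a + b).
Proof. exact: is_deriveD. Qed.

Lemma is_derive1B f g x a b : is_derive x 1 f a -> is_derive x 1 g b ->
  is_derive x 1 (fun t => f t - g t) (a - b).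
Proof. exact: is_deriveB. Qed.

Lemma is_derive1M f g x a b : is_derive x 1 f a -> is_derive x 1 g b ->
  is_derive x 1 (fun t => f t * g t) (a * g x + f x * b).
Proof.
move=> fa gb; apply: (is_derive1_eq (is_deriveM fa gb)).
by rewrite /GRing.scale/=; ring.
Qed.

Lemma is_derive1_compf f g x a b : is_derive (g x) 1 f a -> is_derive x 1 g b ->
  is_derive x 1 (fun t => f (g t)) (a * b).
Proof. exact: is_derive1_comp. Qed.

Lemma is_derive1_cst (c x : R) : is_derive x 1 (fun=> c) 0.
Proof. exact: is_derive_cst. Qed.

Lemma is_derive1_idf x : is_derive x 1 (fun t : R => t) 1.
Proof. exact: is_derive_id. Qed.

Lemma is_derive1_continuous f x a : is_derive x 1 f a -> {for x, continuous f}.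
Proof. by move=> h; apply: differentiable_continuous; apply/derivable1_diffP; exact: ex_derive. Qed.

Lemma is_derive1_horner (p : {poly R}) x : is_derive x 1 (horner p) (p^`()).[x].
Proof. exact: is_derive_poly. Qed.

Lemma is_derive1_inv x : x != 0 -> is_derive x 1 GRing.inv (- x ^- 2).
Proof.
move=> x0; have h := is_deriveV (f := id) x0 (is_derive_id x 1).
apply: (is_derive1_eq h).
by rewrite /GRing.scale/= mulr1.
Qed.

End derivation_rules.

(** * Smooth functions and bumps on the line *)

Section smooth_one_variable.
Context {R : realType}.
Implicit Types (f g : R -> R) (p : {poly R}) (c x y : R).

Definition smooth1 f := forall n x, derivable (f^`(n))%classic x 1.

Lemma smooth1_is_derive f x : smooth1 f -> is_derive x 1 f (f^`()%classic x).
Proof. by move=> /(_ 0%N x) fx; rewrite derive1E; apply: derivableP. Qed.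

Lemma smooth1_continuous f : smooth1 f -> continuous f.
Proof. by move=> sf x; apply: is_derive1_continuous (smooth1_is_derive x sf). Qed.

Lemma smooth1_derive1 f : smooth1 f -> smooth1 f^`()%classic.
Proof. by move=> sf n x; have := sf n.+1 x; rewrite derive1Sn. Qed.

Lemma is_derive1_derive1 f g : (forall x, is_derive x 1 f (g x)) -> f^`()%classic = g.
Proof. by move=> fg; apply/funext => x; rewrite derive1E; apply: derive_val. Qed.

Lemma smooth1_primitive f g :
  (forall x, is_derive x 1 f (g x)) -> smooth1 g -> smooth1 f.
Proof.
move=> fg sg [|n] x; first exact: (@ex_derive _ _ _ _ _ _ _ (fg x)).
by rewrite derive1Sn (is_derive1_derive1 fg); exact: sg.
Qed.

(** A family closed under differentiation consists of smooth functions; higher derivatives never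
    have to be computed. *)
Lemma smooth1_class (K : set (R -> R)) :
  (forall f, K f -> exists2 g, K g & forall x, is_derive x 1 f (g x)) ->
  K `<=` smooth1.
Proof.
move=> hK f Kf n x.
have [g [Kg ->]] : exists g, K g /\ (f^`(n))%classic = g.
  elim: n => [|n [g [Kg gE]]]; first by exists f.
  have [h Kh gh] := hK _ Kg; exists h; split => //.
  by rewrite derive1nS gE (is_derive1_derive1 gh).
have [h _ gh] := hK _ Kg; exact: (@ex_derive _ _ _ _ _ _ _ (gh x)).
Qed.

Lemma smooth1_lin f g (r s : R) : smooth1 f -> smooth1 g ->
  smooth1 (fun x => r * f x + s * g x).
Proof.
move=> sf sg.
apply: (smooth1_class (K := [set h | exists f g, [/\ smooth1 f, smooth1 g &
    h = (fun x => r * f x + s * g x)]])); last by exists f, g.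
move=> _ [f' [g' [sf' sg' ->]]].
exists (fun x => r * f'^`()%classic x + s * g'^`()%classic x).
  exists f'^`()%classic, g'^`()%classic.
  by split; [exact: smooth1_derive1|exact: smooth1_derive1|].
move=> x; have := is_derive1D
  (is_derive1M (is_derive1_cst r x) (smooth1_is_derive x sf'))
  (is_derive1M (is_derive1_cst s x) (smooth1_is_derive x sg')).
by rewrite !mul0r !add0r.
Qed.

(** From 1 + z <= e^z with z = c y / (k + 1), raised to the power k. Dividing by k + 1 instead of k
    covers k = 0 and leaves an exponent at most c y. *)
Lemma exprn_le_expR (k : nat) c y : 0 < c -> 0 <= y ->
  y ^+ k <= (k.+1%:R / c) ^+ k * expR (c * y).
Proof.
move=> c0 y0.
have h : y <= (k.+1%:R / c) * expR (c / k.+1%:R * y).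
  have := expR_ge1Dx (c / k.+1%:R * y).
  rewrite -(ler_pM2l (x := k.+1%:R / c)) ?divr_gt0//.
  apply: le_trans; rewrite mulrDr mulrA mulrA divfK ?gt_eqF// divff ?pnatr_eq0//.
  by rewrite mul1r lerDr mulr1 divr_ge0// ltW.
apply: (@le_trans _ _ (((k.+1%:R / c) * expR (c / k.+1%:R * y)) ^+ k)).
  by rewrite lerXn2r// nnegrE// (le_trans y0).
rewrite exprMn ler_pM2l; last by rewrite exprn_gt0// divr_gt0.
rewrite -expRM_natl ler_expR mulrA ler_wpM2r//.
by rewrite mulrA ler_pdivrMr// mulrC ler_pM2l// ler_nat.
Qed.

Lemma horner_le_expR p c : 0 < c ->
  exists C, forall y, 0 <= y -> `|p.[y]| <= C * expR (c * y).
Proof.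
move=> c0; exists (\sum_(i < size p) `|p`_i| * (i.+1%:R / c) ^+ i) => y y0.
rewrite horner_coef mulr_suml; apply: le_trans (ler_norm_sum _ _ _) _.
apply: ler_sum => i _; rewrite normrM -mulrA ler_wpM2l//.
by rewrite ger0_norm ?exprn_ge0// exprn_le_expR.
Qed.

(* The powers of 1/x and their polynomials are dominated by [expR (c / x)], so
   this family is closed under differentiation. *)
Definition flat c p x : R := if 0 < x then p.[x^-1] * expR (- c * x^-1) else 0.

(** A bound by x^2 is what makes the derivative at 0 exist and vanish. It comes from dominating the
    polynomial X^2 p at 1/x by the exponential. *)
Lemma flat_bound c p : 0 < c ->
  exists2 C, 0 <= C & forall x, `|flat c p x| <= C * x ^+ 2.
Proof.
move=> c0; have [C hC] := horner_le_expR ('X^2 * p) c0.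
exists `|C| => // x; rewrite /flat; case: ifPn => [x0|_]; last first.
  by rewrite normr0 mulr_ge0// sqr_ge0.
have xV0 : 0 <= x^-1 by rewrite invr_ge0 ltW.
have := hC _ xV0; rewrite !hornerE normrM exprVn.
rewrite [`|_ ^-1|]ger0_norm ?invr_ge0 ?sqr_ge0// ler_pdivrMl ?exprn_gt0// => h.
rewrite normrM mulNr expRN [`|_^-1|]ger0_norm ?invr_ge0 ?expR_ge0//.
rewrite ler_pdivrMr ?expR_gt0//; apply: le_trans h _.
rewrite [leRHS](_ : _ = x ^+ 2 * (`|C| * expR (c / x))); last by rewrite /=; ring.
rewrite ler_wpM2l ?sqr_ge0//.
by rewrite ler_wpM2r ?expR_ge0// ler_norm.
Qed.

(** For x > 0 the inner function 1/x contributes the factor -x^-2, whence the polynomial X^2 (c p -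
    p'); at 0 the quadratic bound applies. *)
Lemma is_derive_flat c p x : 0 < c ->
  is_derive x 1 (flat c p) (flat c ('X^2 * (c *: p - p^`())) x).
Proof.
move=> c0; have [x0|x0|<-] := ltgtP 0 x.
- rewrite {2}/flat x0.
  apply: (@near_eq_is_derive _ _ _ (fun x => p.[x^-1] * expR (- c * x^-1))).
    by near=> t; rewrite /flat ifT//; near: t; exact: lt_nbhsr.
  have dV := is_derive1_inv (lt0r_neq0 x0).
  have h1 := is_derive1_compf (is_derive1_horner p x^-1) dV.
  have h2 := is_derive1M (is_derive1_cst (- c) x) dV.
  have h3 := is_derive1_compf (is_derive_expR _) h2.
  apply: (is_derive1_eq (is_derive1M h1 h3)).
  by rewrite !hornerE exprVn /=; ring.
- rewrite {2}/flat ltNge (ltW x0)/=.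
  apply: (@near_eq_is_derive _ _ _ (fun=> 0)).
  near=> t; by rewrite /flat ltNge ifF//; apply/negbTE; rewrite negbK ltW//; near: t; exact: lt_nbhsl.
rewrite {2}/flat ltxx.
have [C C0 hC] := flat_bound p c0.
have f0 : flat c p 0 = 0 by rewrite /flat ltxx.
have h : h^-1 *: ((flat c p \o shift 0) (h *: 1) - flat c p 0) @[h --> (0:R)^'] --> (0:R).
  apply/cvgr0Pnorm_lt => e e0.
  near=> h.
  have hn0 : h != 0 by near: h; exact: nbhs_dnbhs_neq.
  rewrite /= f0 subr0 addr0 /GRing.scale/= mulr1 normrM normfV ltr_pdivrMl ?normr_gt0//.
  apply: le_lt_trans (hC h) _.
  rewrite -(ger0_norm (sqr_ge0 h)) normrX expr2 mulrCA ltr_pM2l ?normr_gt0//.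
  apply: (@le_lt_trans _ _ ((C + 1) * `|h|)); first by rewrite ler_wpM2r// lerDl.
  rewrite -ltr_pdivlMl; last by rewrite ltr_wpDl.
  near: h; apply: dnbhs0_lt; rewrite mulr_gt0// invr_gt0 ltr_wpDl//.
have d0 : derivable (flat c p) 0 1 by apply/cvg_ex; exists 0.
apply: DeriveDef => //; exact: cvg_lim h.
Unshelve. all: by end_near. Qed.

Lemma flat_gt0 c x : 0 < x -> flat c 1 x = expR (- c * x^-1).
Proof. by move=> x0; rewrite /flat x0 hornerE mul1r. Qed.

Lemma flat_le0 c p x : x <= 0 -> flat c p x = 0.
Proof. by rewrite /flat ltNge => ->. Qed.

(** A syntax closed under differentiation: translates give left ends, reflections give right ends,
    and the product rule forces both products and sums. *)
Inductive flat_algebra c : (R -> R) -> Prop :=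
| FlatL p a : flat_algebra c (fun x => flat c p (x - a))
| FlatR p b : flat_algebra c (fun x => flat c p (b - x))
| FlatM f g : flat_algebra c f -> flat_algebra c g -> flat_algebra c (fun x => f x * g x)
| FlatD f g : flat_algebra c f -> flat_algebra c g -> flat_algebra c (fun x => f x + g x).

Lemma flat_algebra_smooth1 c : 0 < c -> flat_algebra c `<=` smooth1.
Proof.
move=> c0; apply: smooth1_class => f; elim=> {f}
  [p a|p b|f g Kf [f' Kf' ff'] Kg [g' Kg' gg']|f g Kf [f' Kf' ff'] Kg [g' Kg' gg']].
- eexists; first exact: (FlatL c ('X^2 * (c *: p - p^`())) a).
  move=> x; have := is_derive1_compf (g := fun t => t - a)
    (is_derive_flat p (x - a) c0)
    (is_derive1B (is_derive1_idf x) (is_derive1_cst a x)).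
  by rewrite subr0 mulr1.
- eexists; first exact: (FlatR c (- ('X^2 * (c *: p - p^`()))) b).
  move=> x; have h := is_derive1_compf (g := fun t => b - t) (is_derive_flat p (b - x) c0)
    (is_derive1B (is_derive1_cst b x) (is_derive1_idf x)).
  apply: (is_derive1_eq h).
  rewrite sub0r mulrN1 /flat; case: ifP => _; last by rewrite oppr0.
  by rewrite !hornerE /=; ring.
- eexists; first exact: (FlatD (FlatM Kf' Kg) (FlatM Kf Kg')).
  by move=> x; apply: is_derive1M.
- eexists; first exact: (FlatD Kf' Kg').
  by move=> x; apply: is_derive1D.
Qed.

Definition test1 f := smooth1 f /\ exists M : R, forall x, M <= `|x| -> f x = 0.

(** As [c] tends to 0 these functions, with values in [0, 1], converge pointwise to the indicator of
    the open interval. This replaces mollification when passing from test functions to boxes. *)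
Definition hump c a b x : R := flat c 1 (x - a) * flat c 1 (b - x).

Lemma humpE c a b x : a < x < b ->
  hump c a b x = expR (- c * ((x - a)^-1 + (b - x)^-1)).
Proof.
by move=> /andP[ax xb]; rewrite /hump !flat_gt0 ?subr_gt0// -expRD mulrDr.
Qed.

Lemma hump_out c a b x : ~~ (a < x < b) -> hump c a b x = 0.
Proof.
rewrite negb_and -!leNgt => /orP[h|h].
  by rewrite /hump flat_le0 ?mul0r// subr_le0.
by rewrite /hump mulrC flat_le0 ?mul0r// subr_le0.
Qed.

Lemma hump_ge0 c a b x : 0 <= hump c a b x.
Proof.
have [h|h] := boolP (a < x < b); first by rewrite humpE// expR_ge0.
by rewrite hump_out.
Qed.

Lemma hump_le1 c a b x : 0 < c -> hump c a b x <= 1.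
Proof.
move=> c0; have [h|h] := boolP (a < x < b); last by rewrite hump_out.
rewrite humpE// -expR0 ler_expR mulNr oppr_le0 mulr_ge0// ?(ltW c0)//.
by move/andP: h => [ax xb]; rewrite addr_ge0// invr_ge0 subr_ge0 ltW.
Qed.

Lemma test1_hump c a b : 0 < c -> test1 (hump c a b).
Proof.
move=> c0; split.
  by apply: (flat_algebra_smooth1 c0); apply: FlatM; [exact: FlatL|exact: FlatR].
exists (`|a| + `|b|) => x hx; apply: hump_out; apply/negP => /andP[ax xb].
have : `|x| < `|a| + `|b|; last by rewrite ltNge hx.
rewrite ltr_norml; apply/andP; split.
  rewrite ltrNl (lt_le_trans (y := - a)) ?ltrN2// (le_trans (y := `|a|))//.
    by rewrite -normrN ler_norm.
  by rewrite lerDl.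
by rewrite (lt_le_trans xb)// (le_trans (ler_norm b))// lerDr.
Qed.

Lemma cvg_hump a b x : hump k.+1%:R^-1 a b x @[k --> \oo] --> (\1_(`]a, b[%classic) x : R).
Proof.
have [h|h] := boolP (a < x < b); last first.
  rewrite indicE memNset/= ?in_itv/=; last exact/negP.
  by under eq_fun do rewrite hump_out//; exact: cvg_cst.
rewrite indicE mem_set/= ?in_itv/=//.
under eq_fun do rewrite humpE//.
have : expR (- k.+1%:R^-1 * ((x - a)^-1 + (b - x)^-1)) @[k --> \oo] --> expR (- 0 * ((x - a)^-1 + (b - x)^-1)).
  apply: continuous_cvg; first exact: continuous_expR.
  by apply: cvgMl; apply: cvgN; exact: cvg_harmonic.
by rewrite oppr0 mul0r expR0.
Qed.

Lemma test1_continuous f : test1 f -> continuous f.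
Proof. by move=> [sf _]; exact: smooth1_continuous. Qed.

Lemma test1_lin f g (r s : R) : test1 f -> test1 g ->
  test1 (fun x => r * f x + s * g x).
Proof.
move=> [sf [M hM]] [sg [N hN]]; split; first exact: smooth1_lin.
exists (Num.max M N) => x; rewrite ge_max => /andP[Mx Nx].
by rewrite hM// hN// !mulr0 addr0.
Qed.

Lemma test1_derive1 f : test1 f -> test1 f^`()%classic.
Proof.
move=> [sf [M hM]]; split; first exact: smooth1_derive1.
exists (M + 1) => x Mx; rewrite derive1E.
rewrite (@near_eq_derive _ _ _ _ (fun=> 0)); first exact: derive_cst.
near=> t; apply: hM.
have xt : `|x - t| < 1 by near: t; apply: cvgr_dist_lt.
have : `|x| <= `|x - t| + `|t| by rewrite -{1}(subrK t x) ler_normD.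
lra.
Unshelve. all: by end_near. Qed.

End smooth_one_variable.

(** * Partial derivatives along coordinate lines *)

Section partial_line.
Context {R : realType} {n : nat}.
Implicit Types (phi : 'rV[R]_n.+1 -> R) (k : 'I_n.+1).

Lemma ins_shift k (h : R) (x : 'rV[R]_n.+1) :
  ins k (h + x ord0 k) (del k x) = h *: delta_mx ord0 k + x.
Proof.
apply/rowP => j; rewrite !mxE eqxx/=; case: unliftP => [i ->|->] /=.
  by rewrite mxE eq_sym (negbTE (neq_lift _ _)) mulr0 add0r.
by rewrite eqxx mulr1.
Qed.

Let line_quotient k phi x :
  (fun h : R => h^-1 *: (((fun t => phi (ins k t (del k x))) \o shift (x ord0 k)) (h *: 1)
     - phi (ins k (x ord0 k) (del k x)))) =
  (fun h : R => h^-1 *: ((phi \o shift x) (h *: delta_mx ord0 k) - phi x)).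
Proof.
by apply/funext => h /=; rewrite ins_del [h *: 1]mulr1 ins_shift.
Qed.

Lemma derivable_line k phi x :
  derivable (fun t => phi (ins k t (del k x))) (x ord0 k) 1 =
  derivable phi x (delta_mx ord0 k).
Proof.
rewrite /derivable (line_quotient k phi x).
by [].
Qed.

Lemma derive_line k phi x :
  'D_1 (fun t => phi (ins k t (del k x))) (x ord0 k) = partial k phi x.
Proof.
by rewrite /partial /derive (line_quotient k phi x).
Qed.

Lemma is_derive_ins k phi t y :
  derivable phi (ins k t y) (delta_mx ord0 k) ->
  is_derive t 1 (fun t => phi (ins k t y)) (partial k phi (ins k t y)).
Proof.
rewrite -derivable_line -derive_line ins_at del_ins => d.
exact: derivableP.
Qed.

Lemma continuous_ins k y : continuous (fun t : R => ins k t y).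
Proof.
move=> t; apply/cvgrPdist_lt => e e0; near=> s.
have ts : `|t - s| < e by near: s; exact: cvgr_dist_lt.
rewrite -[ltLHS]/(mx_norm _) mx_normrE; apply/bigmax_ltP; split => // -[i j] _ /=.
rewrite !mxE; case: unliftP => [l _|_] //=.
by rewrite subrr normr0.
Unshelve. all: by end_near. Qed.

End partial_line.

(** * Products of one-variable functions *)

Section product_functions.
Context {R : realType}.

Definition prodfun {n} (F : 'I_n -> R -> R) (x : 'rV[R]_n) : R :=
  \prod_j F j (x ord0 j).

Lemma cvg_prod_seq (T : Type) (A : set_system T) (FA : Filter A) (I : Type) (s : seq I)
    (f : I -> T -> R) (l : I -> R) :
  (forall i, f i x @[x --> A] --> l i) ->
  \prod_(i <- s) f i x @[x --> A] --> \prod_(i <- s) l i.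
Proof.
move=> fl; elim: s => [|i s IH].
  rewrite big_nil (_ : (fun x => _) = cst 1); first exact: cvg_cst.
  by apply/funext => x; rewrite big_nil.
rewrite big_cons (_ : (fun x => _) = (fun x => f i x * \prod_(i <- s) f i x)).
  by apply: cvgM.
by apply/funext => x; rewrite big_cons.
Qed.

Lemma continuous_prodfun n (F : 'I_n -> R -> R) :
  (forall j, continuous (F j)) -> continuous (prodfun F).
Proof.
move=> cF; rewrite /prodfun => x; apply: (@cvg_prod_seq _ (nbhs x) (nbhs_filter (x : 'rV[R]_n))) => j.
apply: (@continuous_comp _ _ _ (fun x : 'rV[R]_n => x ord0 j) (F j)).
  exact: coord_continuous.
exact: cF.
Qed.

Lemma prodfun_ins n (F : 'I_n.+1 -> R -> R) k t y :
  prodfun F (ins k t y) = F k t * prodfun (F \o lift k) y.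
Proof.
rewrite /prodfun (bigD1_ord k)//= ins_at; congr (_ * _).
by apply: eq_bigr => j _; rewrite ins_lift.
Qed.

Definition upd n (F : 'I_n -> R -> R) k g j := if j == k then g else F j.

Lemma prodfun_upd n (F : 'I_n.+1 -> R -> R) k g t y :
  prodfun (upd F k g) (ins k t y) = g t * prodfun (F \o lift k) y.
Proof.
rewrite prodfun_ins /upd eqxx; congr (_ * _).
by apply: eq_bigr => j _ /=; rewrite eq_sym (negbTE (neq_lift _ _)).
Qed.

Lemma is_derive_prodfun n (F : 'I_n.+1 -> R -> R) k (x : 'rV[R]_n.+1) (d : R) :
  is_derive (x ord0 k) 1 (F k) d ->
  is_derive x (delta_mx ord0 k) (prodfun F) (d * prodfun (F \o lift k) (del k x)).
Proof.
move=> Fd.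
have h : is_derive (x ord0 k) 1 (fun t => prodfun F (ins k t (del k x)))
    (d * prodfun (F \o lift k) (del k x)).
  rewrite (_ : (fun t => _) = (fun t => F k t * prodfun (F \o lift k) (del k x))).
    have := is_derive1M Fd (is_derive1_cst (prodfun (F \o lift k) (del k x)) (x ord0 k)).
    by rewrite mulr0 addr0.
  by apply/funext => t; rewrite prodfun_ins.
apply: DeriveDef; first by rewrite -derivable_line; exact: ex_derive.
rewrite -[LHS]/(partial k (prodfun F) x) -derive_line; exact: derive_val.
Qed.

Lemma partial_prodfun n (F : 'I_n.+1 -> R -> R) k :
  (forall t, derivable (F k) t 1) ->
  partial k (prodfun F) = prodfun (upd F k (F k)^`()%classic).
Proof.
move=> Fd; apply/funext => x.
have /derivableP/is_derive_prodfun h := Fd (x ord0 k).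
rewrite -[in RHS](ins_del k x) prodfun_upd derive1E.
exact: derive_val.
Qed.

(** A partial derivative of a product only changes one factor into its derivative, so all iterated
    partials are again products of smooth factors. The support lies in a common cube. *)
Lemma test_function_prodfun n (F : 'I_n.+1 -> R -> R) :
  (forall j, test1 (F j)) -> test_function (prodfun F).
Proof.
move=> tF; split.
  move=> s.
  have [G [tG ->]] : exists G, (forall j, smooth1 (G j)) /\
      foldr partial (prodfun F) s = prodfun G.
    elim: s => [|k s [G [tG GE]]]; first by exists F; split=> // j; case: (tF j).
    exists (upd G k (G k)^`()%classic); split.
      by move=> j; rewrite /upd; case: ifP => // _; exact: smooth1_derive1.
    rewrite /= GE partial_prodfun// => t; exact: (tG k 0%N t).
  split; first by apply: continuous_prodfun => j; exact: smooth1_continuous.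
  move=> k x; have /derivableP/is_derive_prodfun h := tG k 0%N (x ord0 k).
  exact: ex_derive.
have [M hM] : exists M : R, forall j t, M <= `|t| -> F j t = 0.
  have h j : exists M : R, forall t, M <= `|t| -> F j t = 0 by case: (tF j).
  have [M hM] := choice h.
  exists (\big[Num.max/0]_j M j) => j t Mt; apply: (hM j).
  by apply: le_trans Mt; exact: le_bigmax.
pose K := [set x : 'rV[R]_n.+1 | forall i, `[- M, M]%classic (x ord0 i)].
have cK : compact K by apply: (@rV_compact R _ (fun=> `[- M, M]%classic)) => i; exact: segment_compact.
apply: (subclosed_compact _ cK); first exact: closed_closure.
have clK : closed K.
  by apply: compact_closed => //; exact: norm_hausdorff.
rewrite [X in _ `<=` X](closure_id K).1//; apply: closure_subset => x /= xn0 i.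
rewrite /= in_itv/= -ler_norml leNgt; apply/negP => Mx.
move: xn0; rewrite /prodfun (bigD1 i)//= (hM i) ?mul0r ?eqxx//; exact: ltW.
Qed.

End product_functions.

(** * The Du Bois-Reymond lemma *)

Section du_bois_reymond.
Context {R : realType} {n : nat}.
Local Notation mu := (@lebesgue_rV R n).

Definition humps (c : R) (a b : 'I_n -> R) : 'rV[R]_n -> R :=
  prodfun (fun j => hump c (a j) (b j)).

Lemma humps_ge0 c a b x : 0 <= humps c a b x.
Proof. by apply: prodr_ge0 => j _; exact: hump_ge0. Qed.

Lemma humps_le1 c a b x : 0 < c -> humps c a b x <= 1.
Proof.
by move=> c0; apply: prodr_ile1 => j _; rewrite hump_ge0 hump_le1.
Qed.

Lemma humps_out c a b x : ~ obox a b x -> humps c a b x = 0.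
Proof.
move=> /existsNP[i] /=; rewrite in_itv/= => /negP xi.
by rewrite /humps /prodfun (bigD1 i)//= hump_out ?mul0r.
Qed.

Lemma cvg_humps a b x : humps k.+1%:R^-1 a b x @[k --> \oo] --> (\1_(obox a b) x : R).
Proof.
have [h|h] := pselect (obox a b x); last first.
  rewrite indicE memNset//.
  by under eq_fun do rewrite humps_out//; exact: cvg_cst.
have -> : (\1_(obox a b) x : R) = \prod_(j < n) \1_(`]a j, b j[%classic) (x ord0 j).
  rewrite indicE mem_set// big1// => i _; rewrite indicE mem_set//; exact: h.
by apply: cvg_prod_seq => j; exact: cvg_hump.
Qed.

Lemma measurable_humps c a b : 0 < c -> measurable_fun setT (humps c a b).
Proof.
move=> c0; apply: continuous_measurable_rV; apply: continuous_prodfun => j.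
by apply: test1_continuous; exact: test1_hump.
Qed.

Lemma obox_sub_cube (a b : 'I_n -> R) : exists k, obox a b `<=` cube k.
Proof.
have [k hk] := @cube_bound R n (\row_i (`|a i| + `|b i|)).
exists k => x abx; apply: in_cube => i; have := hk i; rewrite mxE.
rewrite ger0_norm ?addr_ge0//; apply: le_lt_trans.
have := abx i; rewrite /= in_itv/= => /andP[ax xb].
rewrite ler_norml; apply/andP; split.
  have := ler_norm (- a i); rewrite normrN; have := normr_ge0 (b i); lra.
have := ler_norm (b i); have := normr_ge0 (a i); lra.
Qed.

(** Dominated convergence turns the tests against humps into vanishing integrals over rational
    boxes, and these determine the integral over every measurable subset of a cube. Only countably
    many tests are involved, which later allows a common null set. *)
Lemma integral_humps_eq0 (D : 'rV[R]_n -> R) :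
  (forall k, mu.-integrable (cube k) (EFin \o D)) ->
  (forall (k : nat) (a b : 'I_n -> rat), \int[mu]_x (D x *
     humps k.+1%:R^-1 (fun i => ratr (a i)) (fun i => ratr (b i)) x) = 0) ->
  {ae mu, forall x, D x = 0}.
Proof.
move=> iD hD.
have iDT k : mu.-integrable setT (EFin \o (D \_ (cube k))).
  by rewrite -restrict_EFin; apply/(integrable_mkcond _ (measurable_obox _ _)).1; exact: iD.
have mD : measurable_fun setT D.
  apply/measurable_EFinP; rewrite -cube_cover.
  apply/measurable_fun_bigcup => k; first exact: measurable_obox.
  exact: measurable_int (iD k).
have ibox' (a' b' : 'I_n -> rat) : (\int[mu]_(x in robox a' b') (D x)%:E = 0)%E.
  rewrite /robox; set a := fun i => ratr (a' i); set b := fun i => ratr (b' i).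
  have [K abK] := obox_sub_cube a b.
  pose f_ (k : nat) x := (D x * humps k.+1%:R^-1 a b x)%:E.
  pose f x := (D x * \1_(obox a b) x)%:E.
  have k0 (k : nat) : 0 < k.+1%:R^-1 :> R by rewrite invr_gt0.
  have [] := @dominated_convergence _ _ R mu setT measurableT f_ f
      (fun x => `|(D \_ (cube K)) x|%:E).
  - move=> k; apply/measurable_EFinP/measurable_funM => //; exact: measurable_humps.
  - by apply/measurable_EFinP/measurable_funM => //; apply: measurable_indic; exact: measurable_obox.
  - apply/nearW => x _; apply: cvg_EFin; first exact: nearW.
    by apply: cvgMr; exact: cvg_humps.
  - exact: (integrable_abse (iDT K)).
  - apply/nearW => x k _; rewrite /f_ lee_fin normrM.
    rewrite [`|humps _ _ _ _|]ger0_norm ?humps_ge0//.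
    have [abx|abx] := pselect (obox a b x); last by rewrite humps_out// mulr0.
    rewrite patchE ifT; last by rewrite inE; exact: abK.
    by rewrite ler_piMr// humps_le1.
  move=> fi _ fcvg.
  have f0 : (\int[mu]_x f x = 0)%E.
    rewrite -(cvg_lim (@ereal_hausdorff R) fcvg).
    rewrite (_ : [sequence _]_n = cst 0%E); first exact: lim_cst.
    apply/funext => k /=; rewrite -[LHS]fineK; first by congr EFin; exact: hD.
    apply: integrable_fin_num => //.
    apply: (le_integrable measurableT _ _ (iDT K)).
      apply/measurable_EFinP/measurable_funM => //; exact: measurable_humps.
    move=> x _; rewrite /f_ /= lee_fin normrM.
    rewrite [`|humps _ _ _ _|]ger0_norm ?humps_ge0//.
    have [abx|abx] := pselect (obox a b x); last by rewrite humps_out// mulr0.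
    rewrite patchE ifT; last by rewrite inE; exact: abK.
    by rewrite ler_piMr// humps_le1.
  rewrite -f0 integral_mkcond; apply: eq_integral => x _.
  by rewrite patchE /f indicE; case: ifP; rewrite ?mulr1 ?mulr0.
have ibox A : oboxes A -> (\int[mu]_(x in A) (D x)%:E = 0)%E.
  by move=> [[a b] ->]; exact: ibox'.
(* Dynkin induction runs inside a fixed cube, because [D] is only assumed integrable on cubes. *)
have icube m A : measurable A -> (\int[mu]_(x in A `&` cube m) (D x)%:E = 0)%E.
  rewrite measurable_oboxes; move: A.
  have iDm A : measurable A -> mu.-integrable (A `&` cube m) (EFin \o D).
    move=> mA; apply: (integrableS (measurable_obox _ _) _ _ (iD m)).
      by apply: measurableI => //; exact: measurable_obox.
    exact: subIsetr.
  apply: (dynkin_induction measurable_oboxes setI_closed_oboxes).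
  - by rewrite setTI; apply: ibox; exact: obox_cube.
  - by move=> A oA; apply: ibox; apply: setI_closed_oboxes => //; exact: obox_cube.
  - move=> S mS S0; apply/eqP; have : (\int[mu]_(x in cube m) (D x)%:E = 0)%E.
      by apply: ibox; exact: obox_cube.

    rewrite -[cube m in LHS](setTI (cube m)) -(setUv S) setIUl integral_setU_EFin//.
    + by rewrite S0 add0e => ->.
    + by apply: measurableI => //; exact: measurable_obox.
    + by apply: measurableI; [exact: measurableC|exact: measurable_obox].
    + by apply/measurable_EFinP; apply: measurable_funTS; exact/measurable_EFinP.
    + apply/disj_setPS => x [[Sx _] [nSx _]]; exact: nSx.
  - move=> F mF tF F0; rewrite setI_bigcupl integral_bigcup//.
    + by rewrite eseries0.
    + exact: trivIset_setIr.
    + by move=> k; apply: measurableI => //; exact: measurable_obox.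
    + rewrite -setI_bigcupl; apply: iDm; exact: bigcupT_measurable.
have ae m : {ae mu, forall x, cube m x -> D x = 0}.
  have : ae_eq mu (cube m) (EFin \o D) (cst 0%E).
    apply: integral_ae_eq => //; first exact: measurable_obox.
      move=> E Em mE; rewrite integral0 -[RHS](icube m E)//.
      by rewrite setIidl.
  by apply: filterS => x h /h /= [].
have : {ae mu, forall x, forall m, cube m x -> D x = 0} by exact/ae_foralln.
apply: filterS => x h; have [m _ xm] : (\bigcup_k cube k) x by rewrite cube_cover.
exact: h xm.
Qed.

End du_bois_reymond.

(** * Absolutely continuous functions on the line *)

Section absolutely_continuous.
Context {R : realType}.
Implicit Types (a b c t : R) (f g h w : R -> R).
Local Notation mu1 := (@lebesgue_measure R).

Lemma integrable_itv g a b a' b' : a <= a' -> b' <= b ->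
  mu1.-integrable `[a, b] (EFin \o g) -> mu1.-integrable `[a', b'] (EFin \o g).
Proof.
move=> aa bb; apply: integrableS => // x; rewrite /= !in_itv/= => /andP[? ?].
by apply/andP; split; [exact: le_trans aa _|exact: le_trans bb].
Qed.

Lemma Rintegral_itv_cat g a b c : a <= c -> c <= b ->
  mu1.-integrable `[a, b] (EFin \o g) ->
  \int[mu1]_(t in `[a, b]) g t = \int[mu1]_(t in `[a, c]) g t + \int[mu1]_(t in `[c, b]) g t.
Proof.
move=> ac cb ig.
have h := Rintegral_itvB (a := BLeft a) (b := BRight b) (x := c) ig ac cb.
rewrite Rintegral_itv_obnd_cbnd in h; first by rewrite -h addrC subrK.
apply: integrableS ig => // x; rewrite /= !in_itv/= => /andP[cx ->].
by rewrite (le_trans ac) ?ltW.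
Qed.

Lemma continuous_integrable_itv h a b : {in `[a, b], continuous h} ->
  mu1.-integrable `[a, b] (EFin \o h).
Proof.
move=> ch; apply: continuous_compact_integrable; first exact: segment_compact.
by apply: continuous_in_subspaceT => x; rewrite inE; exact: ch.
Qed.

(** Local absolute continuity of [w] with derivative [g], in integral form, so that differentiation
    almost everywhere is never invoked. *)
Definition primitive g w := forall a b, a <= b ->
  mu1.-integrable `[a, b] (EFin \o g) /\ w b - w a = \int[mu1]_(t in `[a, b]) g t.

Lemma primitive_continuous g w : primitive g w -> continuous w.
Proof.
move=> pw x.
have xx : x - 1 < x + 1 by lra.
have [ig _] := pw _ _ (ltW xx).
have /(continuous_within_itvP _ xx)[h _ _] := parameterized_integral_continuous (ltW xx) ig.
have xin : x \in `]x - 1, x + 1[ by rewrite in_itv/=; apply/andP; split; lra.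
have {}h := h _ xin.
have wE t : x - 1 <= t -> w t = w (x - 1) + parameterized_integral mu1 (x - 1) t g.
  by move=> xt; have [_ h'] := pw _ _ xt; rewrite /parameterized_integral -h' addrC subrK.
rewrite /continuous_at (wE x); last lra.
have : (fun t => w (x - 1) + parameterized_integral mu1 (x - 1) t g) t @[t --> x]
    --> w (x - 1) + parameterized_integral mu1 (x - 1) x g.
  by apply: cvgD; [exact: cvg_cst|exact: h].
apply: cvg_trans; apply: near_eq_cvg; near=> t; rewrite (wE t)//.
by apply: ltW; near: t; apply: lt_nbhsr; lra.
Unshelve. all: by end_near. Qed.

(** With [M = 0] and [G] independent of its second argument this also bounds a continuous function
    on a segment. *)
Lemma continuous_rect_bound (G : R -> R -> R) a b M :
  continuous (fun p : R * R => G p.1 p.2) ->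
  exists2 C : R, 0 <= C & forall t r, a <= t <= b -> `|r| <= M -> `|G t r| <= C.
Proof.
move=> cG.
have : bounded_set [set G p.1 p.2 | p in `[a, b]%classic `*` `[- M, M]%classic].
  apply: compact_bounded; apply: continuous_compact.
    exact: continuous_subspaceT.
  by apply: compact_setX; exact: segment_compact.
move=> [C [_ hC]]; exists (`|C| + 1) => [|t r tab rM]; first by rewrite addr_ge0.
apply: (hC (`|C| + 1)); first by rewrite (le_lt_trans (ler_norm C))// ltrDl.
by exists (t, r) => //; split => /=; rewrite in_itv//= -ler_norml.
Qed.

Lemma continuous2_comp (G : R -> R -> R) w t :
  continuous (fun p : R * R => G p.1 p.2) ->
  {for t, continuous w} -> {for t, continuous (fun t => G t (w t))}.
Proof.
move=> cG cw.
apply: (@continuous_comp _ _ _ (fun t => (t, w t)) (fun p : R * R => G p.1 p.2)).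
  by apply: (@cvg_pair _ _ _ (nbhs t) (nbhs t) (nbhs (w t)) _ _ _ id w); [exact: cvg_id|exact: cw].
exact: cG.
Qed.

(** Continuous functions are dense in L^1 of the segment; the primitive of such an approximation
    that starts from [w a] stays within the L^1 error of [w]. *)
Lemma primitive_approx g w a b (e : R) : a < b -> 0 < e -> primitive g w ->
  exists h W, [/\ continuous h,
    (forall t, a - 1 < t -> is_derive t 1 W (h t)),
    \int[mu1]_(t in `[a, b]) `|g t - h t| <= e &
    forall t, a <= t <= b -> `|W t - w t| <= e].
Proof.
move=> ab e0 pw; have [ig _] := pw _ _ (ltW ab).
have abfin : (mu1 `[a, b]%classic < +oo)%E.
  by rewrite lebesgue_measure_itv/= lte_fin ab -EFinD ltry.
have [g_ [cg ig_ gcvg]] :=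
  approximation_continuous_integrable (measurable_itv `[a, b]) abfin ig.
have [h [ch ih gh]] : exists h, [/\ continuous h, mu1.-integrable `[a, b] (EFin \o h) &
    (\int[mu1]_(t in `[a, b]) `|(g t - h t)%:E| < e%:E)%E].
  have : \forall n \near \oo, (\int[mu1]_(t in `[a, b]) `|(g t - g_ n t)%:E| < e%:E)%E.
    apply: (gcvg [set y | (y < e%:E)%E]); apply: open_nbhs_nbhs; split; first exact: open_ereal_lt_ereal.
    by rewrite /= lte_fin.
  by move=> [n _ /(_ n (leqnn n)) gn]; exists (g_ n).
have igh : mu1.-integrable `[a, b] (EFin \o (fun t => g t - h t)).
  by rewrite (_ : _ \o _ = (EFin \o g) \- (EFin \o h))%E//; exact: integrableB.
have ghe : \int[mu1]_(t in `[a, b]) `|g t - h t| <= e.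
  rewrite /Rintegral -lee_fin fineK; first exact: ltW.
  apply: integrable_fin_num => //; exact: integrable_norm.
(* Integration starts before [a], so that [W] is differentiable at [a] itself. *)
pose A := a - 1.
have ihA t : mu1.-integrable `[A, t] (EFin \o h).
  by apply: continuous_integrable_itv => x _; exact: ch.
exists h, (fun t => w a - \int[mu1]_(t in `[A, a]) h t + \int[mu1]_(t in `[A, t]) h t).
split => // [t At|t /andP[at_ tb]].
  have [d dE] := @continuous_FTC1_closed R h A t (t + 1) ltac:(by rewrite ltrDl) (ihA _) At (ch t).
  have D : is_derive t 1 (fun t => \int[mu1]_(t in `[A, t]) h t) (h t).
    by apply: DeriveDef; [exact: d|rewrite -derive1E; exact: dE].
  by have := is_derive1D (is_derive1_cst (w a - \int[mu1]_(t in `[A, a]) h t) t) D; rewrite add0r.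
have Aa : A <= a by rewrite /A; lra.
rewrite (Rintegral_itv_cat Aa at_ (ihA t)).
have [_ wE] := pw _ _ at_.
have -> : w t = w a + \int[mu1]_(t in `[a, t]) g t by rewrite -wE addrC subrK.
rewrite (_ : _ - _ = - \int[mu1]_(t in `[a, t]) (g t - h t)); last first.
  rewrite RintegralB//; [ring|exact: integrable_itv ig|exact: integrable_itv ih].
rewrite normrN; apply: le_trans ghe.
have ight := integrable_itv (lexx a) tb igh.
apply: le_trans (le_normr_Rintegral _ ight) _ => //.
rewrite (Rintegral_itv_cat at_ tb); last exact: integrable_norm.
by rewrite lerDl Rintegral_ge0.
Qed.

(* The chain rule for an absolutely continuous [w]: it holds for the C^1
   primitives of continuous functions that approximate [g] in L^1. *)
Lemma primitive_chain g w (F G H : R -> R -> R) :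
  primitive g w ->
  continuous (fun p : R * R => F p.1 p.2) ->
  continuous (fun p : R * R => G p.1 p.2) ->
  continuous (fun p : R * R => H p.1 p.2) ->
  (forall (r : R -> R) r' t, is_derive t 1 r r' ->
     is_derive t 1 (fun s => F s (r s)) (G t (r t) + H t (r t) * r')) ->
  primitive (fun t => G t (w t) + H t (w t) * g t) (fun t => F t (w t)).
Proof.
move=> pw cF cG cH dF.
have cw := primitive_continuous pw.
pose k t := G t (w t) + H t (w t) * g t.
suff main a b : a < b -> mu1.-integrable `[a, b] (EFin \o k) /\
    F b (w b) - F a (w a) = \int[mu1]_(t in `[a, b]) k t.
  move=> a b; rewrite le_eqVlt => /predU1P[<-|]; last exact: main.
  split; last by rewrite set_itv1 Rintegral_set1 subrr.
  have [i _] := main a (a + 1) ltac:(by rewrite ltrDl).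
  by apply: integrable_itv i; rewrite ?lerDl.
move=> ab; have [ig _] := pw _ _ (ltW ab).
have [M0 hM0] : exists M : R, forall t, a <= t <= b -> `|w t| <= M.
  have [C _ hC] := @continuous_rect_bound (fun t _ => w t) a b 0
    ltac:(by move=> p; apply: (@continuous_comp _ _ _ fst w); [exact: cvg_fst|exact: cw]).
  by exists C => t tab; apply: (hC t 0); rewrite ?normr0.
(* The uniform errors 1 / (n + 1) are at most 1, so all [W n] stay in the rectangle on which [G] and
   [H] are bounded. *)
pose M : R := M0 + 1.
have [CG CG0 hG] := continuous_rect_bound a b M cG.
have [CH CH0 hH] := continuous_rect_bound a b M cH.
have h_ n := primitive_approx ab (e := n.+1%:R^-1) ltac:(by rewrite invr_gt0) pw.
have [h /choice[W hW]] := choice h_.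
have wM t : a <= t <= b -> `|w t| <= M by move=> /hM0 h1; rewrite (le_trans h1)// lerDl.
have WM n t : a <= t <= b -> `|W n t| <= M.
  move=> tab; have [_ _ _ /(_ _ tab) h1] := hW n.
  rewrite -(subrK (w t) (W n t)) (le_trans (ler_normD _ _))// addrC /M lerD ?hM0//.
  by rewrite (le_trans h1)// invf_le1// ler1n.
have cW n t : a <= t -> {for t, continuous (W n)}.
  move=> at_; have [_ dW _ _] := hW n.
  by apply: is_derive1_continuous; apply: dW; lra.
have Ww t : a <= t <= b -> W n t @[n --> \oo] --> w t.
  move=> tab; apply/cvgrPdist_le => e e0.
  near=> n; have [_ _ _ /(_ _ tab) h1] := hW n.
  rewrite distrC (le_trans h1)//; near: n.
  have := @cvg_harmonic R => /cvgrPdist_le /(_ _ e0).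
  by apply: filterS => n /=; rewrite sub0r normrN ger0_norm ?invr_ge0.
have cc (f : R -> R -> R) t : continuous (fun p : R * R => f p.1 p.2) -> a <= t <= b ->
    f t (W n t) @[n --> \oo] --> f t (w t).
  move=> cf tab.
  apply: (@continuous_cvg _ _ _ _ _ (fun n => (t, W n t)) (fun p : R * R => f p.1 p.2) (t, w t)).
    exact: cf.
  by apply: (@cvg_pair _ _ _ \oo (nbhs t) (nbhs (w t)) _ _ _ (fun=> t) (W ^~ t)); [exact: cvg_cst|exact: Ww].
have mfW (f : R -> R -> R) n : continuous (fun p : R * R => f p.1 p.2) ->
    measurable_fun `[a, b] (fun t => f t (W n t)).
  move=> cf; apply: subspace_continuous_measurable_fun => //.
  apply: continuous_in_subspaceT => t; rewrite inE/= in_itv/= => /andP[at_ _].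
  by apply: continuous2_comp => //; exact: cW.
have mfw (f : R -> R -> R) : continuous (fun p : R * R => f p.1 p.2) ->
    measurable_fun `[a, b] (fun t => f t (w t)).
  move=> cf; apply: subspace_continuous_measurable_fun => //.
  apply: continuous_in_subspaceT => t _.
  by apply: continuous2_comp => //; exact: cw.
have mg : measurable_fun `[a, b] g by have /integrableP[/measurable_EFinP] := ig.
(* [q n] is the exact derivative of F(t, W n t), while [p n] has the limit [g] in place of [h n].
   Then [p n] converges to [k] under the fixed bound [B], and [p n - q n] tends to 0 in L^1 because
   [H] is bounded. *)
pose p n t : R := G t (W n t) + H t (W n t) * g t.
pose q n t : R := G t (W n t) + H t (W n t) * h n t.
pose B t : R := CG + CH * `|g t|.
have iB : mu1.-integrable `[a, b] (EFin \o B).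
  rewrite (_ : _ \o _ = (EFin \o cst CG) \+ (fun t => CH%:E * `|(EFin \o g) t|))%E//.
  apply: integrableD => //.
    by apply: continuous_integrable_itv => x _; exact: cvg_cst.
  by apply: integrableZl => //; exact: integrable_abse.
have pB n t : a <= t <= b -> `|p n t| <= B t.
  move=> tab; rewrite /p /B (le_trans (ler_normD _ _))// lerD ?hG ?WM//.
  by rewrite normrM ler_wpM2r// hH// WM.
have kB t : a <= t <= b -> `|k t| <= B t.
  move=> tab; rewrite /p /B (le_trans (ler_normD _ _))// lerD ?hG ?wM//.
  by rewrite normrM ler_wpM2r// hH// wM.
have mp n : measurable_fun `[a, b] (p n).
  by apply: measurable_funD; [exact: mfW|apply: measurable_funM => //; exact: mfW].
have mk : measurable_fun `[a, b] k.
  by apply: measurable_funD; [exact: mfw|apply: measurable_funM => //; exact: mfw].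
have iP f : measurable_fun `[a, b] f -> (forall t, a <= t <= b -> `|f t| <= B t) ->
    mu1.-integrable `[a, b] (EFin \o f).
  move=> mf fB; apply: (le_integrable _ _ _ iB) => //.
    exact/measurable_EFinP.
  move=> t; rewrite /= in_itv/= => tab; rewrite lee_fin (le_trans (fB _ tab))//.
  exact: ler_norm.
have ik := iP _ mk kB; have ip n := iP _ (mp n) (@pB n).
split => //.
have pk : (\int[mu1]_(t in `[a, b]) (p n t)%:E @[n --> \oo] --> \int[mu1]_(t in `[a, b]) (k t)%:E)%E.
  have [] // := @dominated_convergence _ _ R mu1 `[a, b]%classic (measurable_itv _)
    (fun n t => (p n t)%:E) (EFin \o k) (EFin \o B).
  - by move=> n; apply/measurable_EFinP; exact: mp.
  - exact/measurable_EFinP.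
  - apply/nearW => t; rewrite /= in_itv/= => tab; apply: cvg_EFin; first exact: nearW.
    by apply: cvgD; [exact: cc|apply: cvgMl; exact: cc].
  - by apply/nearW => t n; rewrite /= in_itv/= => tab; rewrite lee_fin; exact: pB.
have {}pk : \int[mu1]_(t in `[a, b]) p n t @[n --> \oo] --> \int[mu1]_(t in `[a, b]) k t.
  apply: fine_cvg; rewrite fineK; first exact: pk.
  exact: integrable_fin_num.
have qE n : \int[mu1]_(t in `[a, b]) q n t = F b (W n b) - F a (W n a).
  have [ch dW _ _] := hW n.
  have dFW t : a <= t -> is_derive t 1 (fun s => F s (W n s)) (q n t).
    by move=> at_; apply: dF; apply: dW; lra.
  rewrite /Rintegral (@continuous_FTC2 R (q n) (fun s => F s (W n s)) a b ab).
  - by rewrite -EFinB.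
  - apply: continuous_in_subspaceT => t; rewrite inE/= in_itv/= => /andP[at_ _].
    apply: cvgD; first by apply: continuous2_comp => //; exact: cW.
    by apply: cvgM; [apply: continuous2_comp => //; exact: cW|exact: ch].
  - split => [t||].
    + by rewrite in_itv/= => /andP[/ltW at_ _]; apply: (@ex_derive _ _ _ _ _ _ _ (dFW t at_)).
    + by apply: cvg_at_right_filter; apply: (is_derive1_continuous (dFW a _)).
    + by apply: cvg_at_left_filter; apply: (is_derive1_continuous (dFW b (ltW ab))).
  - move=> t; rewrite in_itv/= => /andP[/ltW at_ _].
    by rewrite derive1E; have [_ ->] := dFW t at_.
have iq n : mu1.-integrable `[a, b] (EFin \o q n).
  have [ch dW _ _] := hW n.
  apply: continuous_integrable_itv => t; rewrite in_itv/= => /andP[at_ _].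
  apply: cvgD; first by apply: continuous2_comp => //; exact: cW.
  by apply: cvgM; [apply: continuous2_comp => //; exact: cW|exact: ch].
have pq : \int[mu1]_(t in `[a, b]) p n t - \int[mu1]_(t in `[a, b]) q n t @[n --> \oo] --> (0 : R).
  apply/cvgr0Pnorm_le => e e0; near=> n.
  rewrite -RintegralB//.
  have ipq : mu1.-integrable `[a, b] (EFin \o (fun t => p n t - q n t)).
    by rewrite (_ : _ \o _ = (EFin \o p n) \- (EFin \o q n))%E//; exact: integrableB.
  apply: le_trans (le_normr_Rintegral _ ipq) _ => //.
  have [ch _ gh _] := hW n.
  have igh : mu1.-integrable `[a, b] (EFin \o (fun t => g t - h n t)).
    rewrite (_ : _ \o _ = (EFin \o g) \- (EFin \o h n))%E//; apply: integrableB => //.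
    by apply: continuous_integrable_itv => x _; exact: ch.
  apply: (@le_trans _ _ (\int[mu1]_(t in `[a, b]) (CH * `|g t - h n t|))).
    apply: le_Rintegral => //; first exact: integrable_norm.
      rewrite (_ : _ \o _ = (fun t => CH%:E * `|(EFin \o (fun t => (g t - h n t)%R)) t|))%E//.
      by apply: integrableZl => //; exact: integrable_abse.
    move=> t; rewrite /= in_itv/= => tab.
    rewrite (_ : p n t - q n t = H t (W n t) * (g t - h n t)); last by rewrite /p /q; ring.
    by rewrite normrM ler_wpM2r// hH// WM.
  rewrite RintegralZl//; last exact: integrable_norm.
  apply: (@le_trans _ _ ((CH + 1) * n.+1%:R^-1)).
    by apply: ler_pM => //; [exact: Rintegral_ge0|rewrite lerDl].
  rewrite -ler_pdivlMl; last by rewrite ltr_wpDl.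
  near: n.
  have := @cvg_harmonic R => /cvgrPdist_le /(_ (e / (CH + 1)) ltac:(by rewrite divr_gt0// ltr_wpDl)).
  by apply: filterS => n /=; rewrite sub0r normrN ger0_norm ?invr_ge0// mulrC.
have qk : \int[mu1]_(t in `[a, b]) q n t @[n --> \oo] --> \int[mu1]_(t in `[a, b]) k t.
  rewrite (_ : (fun n => _) = (fun n => \int[mu1]_(t in `[a, b]) p n t -
    (\int[mu1]_(t in `[a, b]) p n t - \int[mu1]_(t in `[a, b]) q n t))).
    by rewrite -[X in _ --> X]subr0; exact: cvgB.
  by apply/funext => n; rewrite subKr.
rewrite (_ : (fun n => _) = (fun n => F b (W n b) - F a (W n a))) in qk; last first.
  by apply/funext => n; rewrite qE.
rewrite -(cvg_lim (@norm_hausdorff _ R^o) qk); apply/esym/cvg_lim.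
  exact: norm_hausdorff.
by apply: cvgB; apply: cc => //; rewrite lexx ltW.
Unshelve. all: by end_near. Qed.

End absolutely_continuous.

(** * Weak derivatives *)

Lemma sqr_normE (R : realDomainType) (x : R) : `|x| ^+ 2 = x ^+ 2.
Proof. by rewrite -normrX ger0_norm ?sqr_ge0. Qed.

Section square_integrable.
Context {d} {T : measurableType d} {R : realType} (mu : {measure set T -> \bar R}).
Implicit Types f g h : T -> R.

(** A working form of membership in L^2 with a real-valued square; [sqint_Lfun] identifies the
    two. *)
Definition sqint f :=
  measurable_fun setT f /\ mu.-integrable setT (fun x => (f x ^+ 2)%:E).

Lemma sqint_le f h : measurable_fun setT f -> (forall x, f x ^+ 2 <= h x) ->
  mu.-integrable setT (EFin \o h) -> sqint f.
Proof.
move=> mf fh hi; split => //.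
apply: (le_integrable measurableT _ _ hi).
  by apply/measurable_EFinP; exact: measurable_funX.
move=> x _ /=; rewrite lee_fin ger0_norm ?sqr_ge0// (le_trans (fh x))//.
exact: ler_norm.
Qed.

Lemma integrable_mul f g : sqint f -> sqint g ->
  mu.-integrable setT (fun x => (f x * g x)%:E).
Proof.
move=> [mf fi] [mg gi].
apply: (le_integrable measurableT _ _ (integrableD measurableT fi gi)).
  by apply/measurable_EFinP; exact: measurable_funM.
move=> x _ /=; rewrite lee_fin ler_norml; apply/andP.
have := sqr_ge0 (f x - g x); have := sqr_ge0 (f x + g x).
have := sqr_ge0 (f x); have := sqr_ge0 (g x).
rewrite sqrrB sqrrD [`|_ + _|]ger0_norm; last by rewrite addr_ge0 ?sqr_ge0.
by move=> ? ? ? ?; split; lra.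
Qed.

Lemma sqintD f g : sqint f -> sqint g -> sqint (fun x => f x + g x).
Proof.
move=> [mf fi] [mg gi].
apply: (sqint_le (h := fun x => 2 * (f x ^+ 2 + g x ^+ 2))).
- exact: measurable_funD.
- by move=> x; have := sqr_ge0 (f x - g x); rewrite sqrrB sqrrD; lra.
- rewrite (_ : _ \o _ = (fun x => 2%:E * ((f x ^+ 2)%:E + (g x ^+ 2)%:E))%E)//.
  by apply: integrableZl => //; exact: integrableD.
Qed.

Lemma sqint_bounded f g C : measurable_fun setT g -> (forall x, `|g x| <= C) ->
  sqint f -> sqint (fun x => g x * f x).
Proof.
move=> mg gC [mf fi].
apply: (sqint_le (h := fun x => C ^+ 2 * f x ^+ 2)).
- exact: measurable_funM.
- move=> x; rewrite exprMn ler_wpM2r ?sqr_ge0// -sqr_normE.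
  by rewrite lerXn2r ?nnegrE// (le_trans _ (gC x)).
- rewrite (_ : _ \o _ = (fun x => (C ^+ 2)%:E * (f x ^+ 2)%:E)%E)//.
  exact: integrableZl.
Qed.

Lemma sqintZ f (c : R) : sqint f -> sqint (fun x => c * f x).
Proof. by apply: (@sqint_bounded _ (cst c) `|c|) => //. Qed.

Lemma sqint_sub f g : sqint f -> sqint g -> sqint (fun x => f x - g x).
Proof.
move=> sf sg; rewrite (_ : (fun x => _) = (fun x => f x + -1 * g x)).
  by apply: sqintD => //; exact: sqintZ.
by apply/funext => x; rewrite mulN1r.
Qed.

Lemma sqint_integrable f (A : set T) : measurable A -> (mu A < +oo)%E ->
  sqint f -> mu.-integrable A (EFin \o f).
Proof.
move=> mA Aoo [mf fi].
have i1 : mu.-integrable A (EFin \o cst (1 : R)).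
  apply/integrableP; split; first exact/measurable_EFinP.
  under eq_integral do rewrite /= normr1.
  by rewrite integral_cst// mul1e.
have i2 : mu.-integrable A (fun x => (f x ^+ 2)%:E) by apply: integrableS fi.
apply: (le_integrable mA _ _ (integrableD mA i1 i2)).
  by apply/measurable_EFinP; exact: measurable_funTS.
move=> x _ /=; rewrite lee_fin [`|1 + _|]ger0_norm ?addr_ge0 ?sqr_ge0//.
have := sqr_ge0 (`|f x| - 1); rewrite sqrrB1 sqr_normE; have := normr_ge0 (f x); lra.
Qed.

Lemma sqint_Lfun f : sqint f <-> f \in Lfun mu 2%:E.
Proof.
split => [[mf fi]|Lf]; last first.
  by split; [move: Lf => /andP[/[!inE]]|exact: Lfun2_integrable_sqr].
apply/andP; split; rewrite inE//= /finite_norm unlock /Lnorm; apply: poweR_lty.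
have /integrableP[_] := fi; apply: le_lt_trans; apply: ge0_le_integral => //.
- by move=> x _; exact: poweR_ge0.
- apply: (@measurableT_comp _ _ _ _ _ _ (fun x => poweR x 2)) => //.
    exact: measurable_poweR.
  by apply: measurableT_comp => //; exact/measurable_EFinP.
- by apply: measurableT_comp => //; exact: measurable_int fi.
- move=> x _ /=; rewrite lee_fin [leRHS]ger0_norm ?sqr_ge0//.
  by rewrite powR_mulrn// sqr_normE.
Qed.

End square_integrable.

Section test_functions.
Context {R : realType} {n : nat}.
Implicit Types (phi : 'rV[R]_n -> R) (k : 'I_n).

Lemma test_function_bound phi : test_function phi ->
  exists (C : R) (K : nat), (forall x, `|phi x| <= C) /\
    forall x, ~ cube K x -> phi x = 0.
Proof.
move=> [sphi cphi]; have [/= cf _] := sphi [::].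
have sub : [set x | phi x != 0] `<=` closure [set x | phi x != 0] by exact: subset_closure.
have /compact_bounded[C [_ hC]] : compact [set phi x | x in closure [set x | phi x != 0]].
  by apply: continuous_compact => //; exact: continuous_subspaceT.
have /compact_bounded[M [_ hM]] := cphi.
pose K := Num.bound (`|M| + 1).
exists (`|C| + 1), K; split => x.
  have [->|/eqP x0] := eqVneq (phi x) 0; first by rewrite normr0 addr_ge0.
  apply: (hC (`|C| + 1)); first by rewrite (le_lt_trans (ler_norm C))// ltrDl.
  by exists x => //; apply: sub; exact/eqP.
move=> xK; apply: contra_notP xK => /eqP/sub xs.
apply: in_cube => i; apply: (@le_lt_trans _ _ (`|M| + 1)); last first.
  by apply: le_lt_trans (archi_boundP _); rewrite ?addr_ge0// ler_norm.
apply: le_trans (hM (`|M| + 1) _ _ xs); last by rewrite (le_lt_trans (ler_norm M))// ltrDl.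
rewrite -[leRHS]/(mx_norm _) mx_normrE.
exact: (le_bigmax _ (fun ij : 'I_1 * 'I_n => `|x ij.1 ij.2|) (ord0, i)).
Qed.

Lemma test_function_partial phi k : test_function phi -> test_function (partial k phi).
Proof.
move=> [sphi cphi]; split.
  by move=> s; have := sphi (rcons s k); rewrite foldr_rcons.
apply: (subclosed_compact _ cphi); first exact: closed_closure.
rewrite [X in _ `<=` X](closure_id _).1; last exact: closed_closure.
apply: closure_subset => x /= + ; apply: contraPP => /= xs.
have oS : open (~` closure [set x | phi x != 0]) by exact/closed_openC/closed_closure.
have : nbhs x (~` closure [set x | phi x != 0]) by exact: open_nbhs_nbhs.
move=> nx; apply/negP; rewrite negbK; apply/eqP; rewrite /partial.
rewrite (@near_eq_derive _ _ _ _ (fun=> 0)); first exact: derive_cst.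
near=> y; apply/eqP; rewrite -[_ == _]negbK; apply/negP => y0.
have : (~` closure [set x | phi x != 0]) y by near: y.
by apply; apply: subset_closure.
Unshelve. all: by end_near. Qed.

Let quotient_translate phi k (x s : 'rV[R]_n) :
  (fun h : R => h^-1 *: (((fun x => phi (x + s)) \o shift x) (h *: delta_mx ord0 k)
     - phi (x + s))) =
  (fun h : R => h^-1 *: ((phi \o shift (x + s)) (h *: delta_mx ord0 k) - phi (x + s))).
Proof. by apply/funext => h /=; rewrite addrA. Qed.

Lemma partial_translate phi k (s x : 'rV[R]_n) :
  partial k (fun x => phi (x + s)) x = partial k phi (x + s).
Proof. by rewrite /partial /derive quotient_translate. Qed.

Lemma derivable_translate phi k (s x : 'rV[R]_n) :
  derivable (fun x => phi (x + s)) x (delta_mx ord0 k) =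
  derivable phi (x + s) (delta_mx ord0 k).
Proof. by rewrite /derivable quotient_translate. Qed.

Lemma test_function_translate phi (s : 'rV[R]_n) :
  test_function phi -> test_function (fun x => phi (x + s)).
Proof.
move=> [sphi cphi].
have pt k psi : partial k (fun x => psi (x + s)) = (fun x => partial k psi (x + s)).
  by apply/funext => x; rewrite partial_translate.
have fold t : foldr partial (fun x => phi (x + s)) t = (fun x => foldr partial phi t (x + s)).
  by elim: t => //= k t ->; rewrite pt.
have ct : continuous (fun x : 'rV[R]_n => x + s).
  by move=> x; apply: (@cvgD _ _ _ (nbhs x) _ id (cst s) x s); [exact: cvg_id|exact: cvg_cst].
have ct' : continuous (fun x : 'rV[R]_n => x - s).
  by move=> x; apply: (@cvgD _ _ _ (nbhs x) _ id (cst (- s)) x (- s)); [exact: cvg_id|exact: cvg_cst].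
split.
  move=> t; have [cf df] := sphi t; rewrite fold; split.
    move=> x; apply: (@continuous_comp _ _ _ (fun x : 'rV[R]_n => x + s)); first exact: ct.
    exact: cf.
  by move=> k x; rewrite derivable_translate.
have : compact [set x - s | x in closure [set x | phi x != 0]].
  by apply: continuous_compact => //; exact: continuous_subspaceT.
move=> cK; apply: (subclosed_compact _ cK); first exact: closed_closure.
have clK : closed [set x - s | x in closure [set x | phi x != 0]].
  by apply: compact_closed => //; exact: norm_hausdorff.
rewrite [X in _ `<=` X](closure_id _).1//; apply: closure_subset => x /= x0.
by exists (x + s); rewrite ?addrK//; exact: subset_closure.
Qed.

Lemma measurable_test phi : test_function phi -> measurable_fun setT phi.
Proof. by move=> [/(_ [::])[/= cf _] _]; exact: continuous_measurable_rV. Qed.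

Lemma lebesgue_cube_lty K : (lebesgue_rV n (cube K : set 'rV[R]_n) < +oo)%E.
Proof. exact: lebesgue_obox_lty. Qed.

Lemma sqint_bounded_support (f : 'rV[R]_n -> R) (C : R) (K : nat) :
  measurable_fun setT f -> (forall x, `|f x| <= C) ->
  (forall x, ~ cube K x -> f x = 0) -> sqint (lebesgue_rV n) f.
Proof.
move=> mf fC f0; apply: (sqint_le (h := fun x => C ^+ 2 * \1_(cube K) x)) => //.
  move=> x; have [xK|xK] := pselect (cube K x).
    by rewrite indicE mem_set// mulr1 -sqr_normE lerXn2r ?nnegrE// (le_trans _ (fC x)).
  by rewrite f0// indicE memNset// mulr0 expr0n.
rewrite (_ : _ \o _ = (fun x => (C ^+ 2)%:E * (\1_(cube K) x)%:E)%E)//.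
apply: integrableZl => //; apply/integrableP; split.
  by apply/measurable_EFinP; apply: measurable_indic; exact: measurable_obox.
under eq_integral do rewrite gee0_abs ?lee_fin//.
rewrite integral_indic//; first by rewrite setIT; exact: lebesgue_cube_lty.
exact: measurable_obox.
Qed.

Lemma sqint_test phi : test_function phi -> sqint (lebesgue_rV n) phi.
Proof.
move=> tphi; have [C [K [hC hK]]] := test_function_bound tphi.
by apply: sqint_bounded_support hC hK; exact: measurable_test.
Qed.

End test_functions.

Section weak_derivative.
Context {R : realType} {n : nat}.
Implicit Types (u g : 'rV[R]_n.+1 -> R) (k : 'I_n.+1).
Local Notation mu := (@lebesgue_rV R n.+1).

Lemma L2P u : L2 u <-> sqint mu u.
Proof. by split => [/sqint_Lfun|/sqint_Lfun]. Qed.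

Lemma weak_partial_unique k u g g' : L2 g -> L2 g' ->
  weak_partial k u g -> weak_partial k u g' -> {ae mu, forall x, g x = g' x}.
Proof.
move=> /L2P sg /L2P sg' wg wg'.
have sgg := sqint_sub sg sg'.
have : {ae mu, forall x, g x - g' x = 0}.
  apply: integral_humps_eq0 => [K|l a b].
    by apply: sqint_integrable => //; [exact: measurable_obox|exact: lebesgue_cube_lty].
  have tb : test_function (humps l.+1%:R^-1 (fun i => ratr (a i)) (fun i => ratr (b i)) : 'rV[R]_n.+1 -> R).
    by apply: test_function_prodfun => j; apply: test1_hump; rewrite invr_gt0.
  under eq_Rintegral do rewrite mulrBl.
  rewrite RintegralB//; last 2 first.
  - exact: integrable_mul (sqint_test tb).
  - exact: integrable_mul (sqint_test tb).
  by have := wg _ tb; rewrite (wg' _ tb) => /eqP; rewrite eqr_opp eq_sym -subr_eq0 => /eqP.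
by apply: filterS => x /eqP; rewrite subr_eq0 => /eqP.
Qed.

Lemma weak_gradP u : H1 u ->
  forall k, L2 (weak_grad u k) /\ weak_partial k u (weak_grad u k).
Proof.
move=> [_ hu] k; have [g Lg wg] := hu k.
exact: (@xgetPex _ (cst 0) [set g | L2 g /\ weak_partial k u g] (ex_intro _ g (conj Lg wg))).
Qed.

(** Weak derivatives are unique almost everywhere, which frees the norm from the representative
    chosen by [weak_grad]. *)
Lemma H1normE lam u (g : 'I_n.+1 -> 'rV[R]_n.+1 -> R) : 0 <= lam -> L2 u ->
  (forall k, L2 (g k)) -> (forall k, weak_partial k u (g k)) ->
  H1norm lam u ^+ 2 = \int[mu]_x ((\sum_k g k x ^+ 2) + lam * u x ^+ 2).
Proof.
move=> lam0 Lu Lg wg.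
have pos (G : 'I_n.+1 -> 'rV[R]_n.+1 -> R) x : 0 <= (\sum_k G k x ^+ 2) + lam * u x ^+ 2.
  apply: addr_ge0; first by apply: sumr_ge0 => k _; exact: sqr_ge0.
  by apply: mulr_ge0 => //; exact: sqr_ge0.
rewrite sqr_sqrtr; last by apply: Rintegral_ge0 => x _; exact: pos.
have Hu : H1 u by split => // k; exists (g k).
have mL (f : 'rV[R]_n.+1 -> R) : L2 f -> measurable_fun setT f by move=> /L2P[].
have ms (G : 'I_n.+1 -> 'rV[R]_n.+1 -> R) : (forall k, L2 (G k)) ->
    measurable_fun setT (fun x => (\sum_k G k x ^+ 2) + lam * u x ^+ 2).
  move=> LG; apply: measurable_funD.
    by apply: measurable_sum => k; apply: measurable_funX; exact: mL.
  by apply: measurable_funM => //; apply: measurable_funX; exact: mL.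
rewrite /Rintegral; congr fine; apply: ge0_ae_eq_integral => //.
- by apply/measurable_EFinP; apply: ms => k; have [] := weak_gradP Hu k.
- by apply/measurable_EFinP; exact: ms.
- by move=> x _; rewrite lee_fin; exact: pos.
- by move=> x _; rewrite lee_fin; exact: pos.
have : {ae mu, forall x, forall k, weak_grad u k x = g k x}.
  have h k : {ae mu, forall x, weak_grad u k x = g k x}.
    by have [? ?] := weak_gradP Hu k; exact: (weak_partial_unique (k := k) (u := u)).
  exact: filter_forall.
by apply: filterS => x h _; congr (_ + _)%:E; apply: eq_bigr => k _; rewrite h.
Qed.

Lemma weak_partial_translate k u g (s : 'rV[R]_n.+1) : L2 u -> L2 g ->
  weak_partial k u g -> weak_partial k (fun x => u (x + s)) (fun x => g (x + s)).
Proof.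
move=> /L2P su /L2P sg w phi tphi.
have tphi' := test_function_translate (- s) tphi.
have pE : partial k (fun x => phi (x - s)) = (fun x => partial k phi (x - s)).
  by apply/funext => x; exact: (partial_translate phi k (- s) x).
have := w _ tphi'; rewrite pE /Rintegral.
rewrite -(integral_translate s (f := fun x => (u x * partial k phi (x - s))%:E)).
  rewrite -(integral_translate s (f := fun x => (g x * phi (x - s))%:E)).
    have sK (x : 'rV[R]_n.+1) : x + s - s = x by exact: addrK.
    have E (f h : 'rV[R]_n.+1 -> R) : (\int[mu]_x (f (x + s)%R * h (x + s - s)%R)%:E =
        \int[mu]_x (f (x + s)%R * h x)%:E)%E.
      by apply: eq_integral => x _; rewrite sK.
    by rewrite (E u) (E g).
  exact: (integrable_mul sg (sqint_test tphi')).
apply: (integrable_mul su); rewrite -pE.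
exact: (sqint_test (test_function_partial k tphi')).
Qed.

Lemma sqint_translate u (s : 'rV[R]_n.+1) : sqint mu u -> sqint mu (fun x => u (x + s)).
Proof.
move=> [mu' ui]; split; first by apply: measurableT_comp => //; exact: measurable_translate.
exact: (integrable_translate s ui).
Qed.

End weak_derivative.

(** * Integration by parts and test functions on the line *)

Section lines_1d.
Context {R : realType}.
Local Notation mu1 := (@lebesgue_measure R).
Implicit Types (f g w D : R -> R) (a b t : R).

Lemma integrable_supported f (M : R) :
  (forall t, ~~ (- M <= t <= M) -> f t = 0) ->
  mu1.-integrable `[- M, M] (EFin \o f) ->
  mu1.-integrable setT (EFin \o f) /\
  \int[mu1]_t f t = \int[mu1]_(t in `[- M, M]) f t.
Proof.
move=> f0 fi.
have fE : f \_ `[- M, M] = f.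
  apply/funext => t; rewrite patchE; case: ifPn => //.
  by rewrite notin_setE /= in_itv/= => /negP /f0 ->.
split; last by rewrite [RHS]Rintegral_mkcond fE.
by move/integrable_mkcond : fi => /(_ (measurable_itv _)); rewrite restrict_EFin fE.
Qed.

(** The product [phi * w] is an instance of the chain rule with F(t, r) = phi(t) r, and it vanishes
    at both ends of [-M, M]. *)
Lemma primitive_parts g w (phi dphi : R -> R) (M : R) : 0 <= M ->
  primitive g w -> continuous dphi -> (forall t, is_derive t 1 phi (dphi t)) ->
  (forall t, M <= `|t| -> phi t = 0) -> (forall t, M <= `|t| -> dphi t = 0) ->
  mu1.-integrable setT (EFin \o (fun t => w t * dphi t + g t * phi t)) /\
  \int[mu1]_t (w t * dphi t + g t * phi t) = 0.
Proof.
move=> M0 pw cd dphiE phi0 dphi0.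
have cphi : continuous phi by move=> t; exact: is_derive1_continuous (dphiE t).
have cfst (f : R -> R) : continuous f -> continuous (fun p : R * R => f p.1).
  by move=> cf p; apply: (@continuous_comp _ _ _ fst f); [exact: cvg_fst|exact: cf].
have csnd : continuous (fun p : R * R => p.2) by move=> p; exact: cvg_snd.
have := @primitive_chain R g w (fun t r => phi t * r) (fun t r => dphi t * r)
  (fun t r => phi t) pw.
have cM (f : R -> R) : continuous f -> continuous (fun p : R * R => f p.1 * p.2).
  by move=> cf p; apply: cvgM; [exact: cfst|exact: csnd].
move=> /(_ (cM _ cphi) (cM _ cd) (cfst _ cphi)) h.
have {}h := h (fun r r' t dr => is_derive1M (dphiE t) dr).
have [] := h (- M) M; first by rewrite ge0_cp.
have M1 : M <= `|M| by exact: ler_norm.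
rewrite (phi0 M)// (phi0 (- M)) ?normrN// !mul0r subrr.
have -> : (fun t => dphi t * w t + phi t * g t) = (fun t => w t * dphi t + g t * phi t).
  by apply/funext => t; rewrite mulrC [X in _ + X]mulrC.
move=> hi h0.
have [] := @integrable_supported (fun t => w t * dphi t + g t * phi t) M _ hi.
  move=> t tM; rewrite phi0 ?dphi0 ?mulr0 ?addr0//.
    by rewrite leNgt; apply: contra tM => /ltW; rewrite ler_norml.
  by rewrite leNgt; apply: contra tM => /ltW; rewrite ler_norml.
by move=> ? ->; rewrite h0.
Qed.

Lemma primitive_exists g : (forall a b, mu1.-integrable `[a, b] (EFin \o g)) ->
  exists w, primitive g w.
Proof.
move=> ig.
(* The signed integral from 0 to t: one of the two segments is always empty or a point. *)
exists (fun t => \int[mu1]_(s in `[0, t]) g s - \int[mu1]_(s in `[t, 0]) g s).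
have I0 a b : b <= a -> \int[mu1]_(s in `[a, b]) g s = 0.
  rewrite le_eqVlt => /predU1P[->|ba]; first by rewrite set_itv1 Rintegral_set1.
  by rewrite set_itv_ge ?Rintegral_set0// bnd_simp -ltNge.
move=> a b ab; split => //.
have [a0|a0] := leP 0 a.
  rewrite (I0 a 0)// (I0 b 0) ?(le_trans a0)// !subr0.
  by rewrite (Rintegral_itv_cat a0 ab (ig _ _)) addrAC subrr add0r.
rewrite (I0 0 a) ?(ltW a0)//.
have [b0|b0] := leP 0 b.
  by rewrite (I0 b 0)// subr0 sub0r opprK addrC (Rintegral_itv_cat (ltW a0) b0).
rewrite (I0 0 b) ?(ltW b0)// !sub0r opprK addrC.
by rewrite (Rintegral_itv_cat ab (ltW b0) (ig _ _)) addrK.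
Qed.

Lemma test1_integrable f : test1 f -> mu1.-integrable setT (EFin \o f).
Proof.
move=> tf; have [_ [M hM]] := tf.
have [] // := @integrable_supported f `|M|.
- move=> t tM; apply: hM; rewrite leNgt; apply: contra tM => tM.
  rewrite -ler_norml; apply: ltW; apply: lt_le_trans tM _; exact: ler_norm.
- by apply: continuous_integrable_itv => t _; exact: test1_continuous.
Qed.

(** The primitive from minus infinity vanishes to the left of the support; the zero mean makes it
    vanish to the right as well. *)
Lemma test1_antiderivative f : test1 f -> \int[mu1]_t f t = 0 ->
  exists2 g, test1 g & g^`()%classic = f.
Proof.
move=> tf f0; have [sf [M hM]] := tf; have fi := test1_integrable tf.
pose g t := \int[mu1]_(s in `]-oo, t]) f s.
have dg t : is_derive t 1 g (f t).
  have cft : {for t, continuous f} by exact: test1_continuous.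
  have [d dE] := @continuous_FTC1 R f -oo%O t (t + 1) ltac:(by rewrite ltrDl)
    ltac:(by apply: integrableS fi) (ltNyr t) cft.
  by apply: DeriveDef; [exact: d|rewrite -derive1E; exact: dE].
exists g; last exact: is_derive1_derive1.
split; first exact: smooth1_primitive dg sf.
exists (`|M| + 1) => t Mt.
have MM := ler_norm M.
have [t0|t0] := leP 0 t.
  rewrite /g -f0 [RHS](Rintegral_mkcond) [LHS]Rintegral_mkcond.
  apply: eq_Rintegral => s _; rewrite !patchE mem_setT.
  case: ifPn => //; rewrite notin_setE /= in_itv/= => /negP; rewrite -ltNge => ts.
  rewrite hM// ger0_norm ?(le_trans t0) ?ltW//.
  by move: Mt; rewrite (ger0_norm t0); lra.
rewrite /g (_ : \int[mu1]_(s in `]-oo, t]) f s = \int[mu1]_(s in `]-oo, t]) 0).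
  by rewrite /Rintegral integral0.
apply: eq_Rintegral => s; rewrite inE/= in_itv/= => st; apply: hM.
by move: Mt; rewrite (ltr0_norm t0) (ltr0_norm (le_lt_trans st t0)); lra.
Qed.

(** On [1/3, 2/3] both reciprocals in the exponent are at most 3, so the hump is at least exp(-6)
    there. *)
Lemma integral_hump01_gt0 : 0 < \int[mu1]_t hump 1 0 1 t.
Proof.
have th : test1 (hump (1 : R) 0 1) by exact: test1_hump.
have hi := test1_integrable th.
apply: (@lt_le_trans _ _ (\int[mu1]_(t in `[3^-1, 2/3]) expR (- 6))).
  rewrite /Rintegral integral_cst//= lebesgue_measure_itv/= lte_fin ifT; last lra.
  rewrite -EFinB /= mulr_gt0 ?expR_gt0//; lra.
rewrite [leLHS]Rintegral_mkcond; apply: le_Rintegral => //.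
  have : mu1.-integrable `[3^-1, 2 / 3] (EFin \o cst (expR (- 6))).
    by apply: continuous_integrable_itv => t _; exact: cvg_cst.
  by move/integrable_mkcond => /(_ (measurable_itv _)); rewrite restrict_EFin.
move=> t _; rewrite patchE; case: ifPn; last by rewrite hump_ge0.
rewrite inE/= in_itv/= => /andP[t1 t2].
rewrite humpE; last by apply/andP; split; lra.
rewrite ler_expR subr0 mulN1r lerN2.
have h1 : t^-1 <= 3 by rewrite -[leRHS]invrK lef_pV2 ?posrE//; lra.
have h2 : (1 - t)^-1 <= 3 by rewrite -[leRHS]invrK lef_pV2 ?posrE//; lra.
lra.
Qed.

Local Notation nu := (@lebesgue_rV R 1).

Lemma measurable_coord0 : measurable_fun setT (fun x : 'rV[R]_1 => (x ord0 ord0 : measurableTypeR R)).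
Proof. exact: measurable_coord. Qed.

Lemma lebesgue_rV1 (A : set (measurableTypeR R)) : measurable A ->
  mu1 A = pushforward nu (fun x : 'rV[R]_1 => x ord0 ord0) A.
Proof.
move=> mA; have := @lebesgue_rV_box R 1 (fun=> A) (fun=> mA).
rewrite big_ord1 => <-; rewrite /pushforward; congr (nu _).
apply/seteqP; split => x /=; first by move=> h; exact: h.
by move=> h i; rewrite (ord1 i).
Qed.

(** The Du Bois-Reymond lemma transported through the identification of row vectors of length 1 with
    the line. *)
Lemma integral_humps1_eq0 D : measurable_fun setT D ->
  (forall K : nat, mu1.-integrable `]- K%:R, K%:R[ (EFin \o D)) ->
  (forall (l : nat) (a b : rat),
    \int[mu1]_t (D t * hump l.+1%:R^-1 (ratr a) (ratr b) t) = 0) ->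
  {ae mu1, forall t, D t = 0}.
Proof.
move=> mD Di hD.
have mD' : measurable_fun setT (fun x : 'rV[R]_1 => D (x ord0 ord0)).
  exact: (measurableT_comp mD measurable_coord0).
have cubeE (K : nat) : cube K = (fun x : 'rV[R]_1 => x ord0 ord0) @^-1` `]- K%:R, K%:R[%classic.
  apply/seteqP; split => x /=; first by move=> /(_ ord0).
  by move=> h i; rewrite (ord1 i).
have intE (f : measurableTypeR R -> \bar R) (A : set (measurableTypeR R)) : measurable A -> measurable_fun A f ->
    (forall t, 0 <= f t)%E ->
    (\int[mu1]_(t in A) f t = \int[nu]_(x in (fun x : 'rV[R]_1 => x ord0 ord0) @^-1` A) f (x ord0 ord0))%E.
  move=> mA mf f0.
  rewrite -(@ge0_integral_pushforward _ _ _ _ R _ measurable_coord0 nu A f)//.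
  apply: eq_measure_integral; first exact: measurable_coord0.
  by move=> m B mB _; exact: lebesgue_rV1.
have h : {ae nu, forall x : 'rV[R]_1, D (x ord0 ord0) = 0}.
  apply: (@integral_humps_eq0 R 1 (fun x : 'rV[R]_1 => D (x ord0 ord0))) => [K|l a b].
    apply/integrableP; split; first by apply/measurable_EFinP; exact: measurable_funTS.
    rewrite cubeE -(intE (fun t => `|(D t)%:E|%E))//; first by have /integrableP[] := Di K.
    apply: measurableT_comp => //; apply/measurable_EFinP; exact: measurable_funTS.
  have l0 : 0 < l.+1%:R^-1 :> R by rewrite invr_gt0.
  have mh : measurable_fun setT (hump l.+1%:R^-1 (ratr (a ord0)) (ratr (b ord0)) : R -> R).
    by apply: continuous_measurable_fun; apply: test1_continuous; exact: test1_hump.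
  rewrite -[RHS](hD l (a ord0) (b ord0)).
  pose f t := (D t * hump l.+1%:R^-1 (ratr (a ord0)) (ratr (b ord0)) t)%:E.
  have mf : measurable_fun setT f by apply/measurable_EFinP; exact: measurable_funM.
  have fi : mu1.-integrable setT f.
    have [K abK] := @obox_sub_cube R 1 (fun=> ratr (a ord0)) (fun=> ratr (b ord0)).
    have := Di K; move/integrable_mkcond => /(_ (measurable_itv _)) hK.
    apply: (le_integrable _ _ _ hK) => // t _.
    rewrite /f restrict_EFin /= lee_fin normrM patchE.
    have [tab|tab] := boolP (ratr (a ord0) < t < ratr (b ord0)); last first.
      by rewrite hump_out// normr0 mulr0.
    have : cube K (\row__ t : 'rV[R]_1).
      by apply: abK => i; rewrite /= mxE in_itv.
    rewrite cubeE /= mxE => tK; rewrite mem_set//.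
    by rewrite ler_piMr// ger0_norm ?hump_ge0// hump_le1.
  rewrite /Rintegral; congr fine.
  transitivity (\int[nu]_x f ((x : 'rV[R]_1) ord0 ord0))%E.
    by apply: eq_integral => x _; rewrite /f /humps /prodfun big_ord1.
  have fi' : nu.-integrable setT (fun x : 'rV[R]_1 => f (x ord0 ord0)).
    apply/integrableP; split; first exact: (measurableT_comp mf measurable_coord0).
    have /integrableP[_] := fi; rewrite (intE (fun t => `|f t|%E))//.
    exact: measurableT_comp.
  rewrite -[LHS](@integral_pushforward _ _ _ _ R _ measurable_coord0 nu setT f mf)//.
  apply/esym/eq_measure_integral; first exact: measurable_coord0.
  by move=> m B mB _; exact: lebesgue_rV1.
have [A [mA A0 hA]] := h.
pose N := [set t | D t != 0].
have mN : measurable N.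
  rewrite (_ : N = D @^-1` (~` [set 0])); last first.
    by apply/seteqP; split => t /= /eqP.
  by rewrite -[X in measurable X]setTI; apply: mD => //; exact: measurableC.
exists N; split => //; last by move=> t /= /eqP.
rewrite lebesgue_rV1// /pushforward; apply/eqP; rewrite eq_le; apply/andP; split; last exact: measure_ge0.
rewrite -A0; apply: le_measure; rewrite ?inE//.
  by rewrite -[X in measurable X]setTI; apply: measurable_coord0.
by apply: subset_trans hA => x /= /eqP.
Qed.

End lines_1d.

(** * Weak derivatives on lines *)

Section lines.
Context {R : realType} {n : nat}.
Implicit Types (u g v : 'rV[R]_n.+1 -> R) (k : 'I_n.+1).
Local Notation mu1 := (@lebesgue_measure R).
Local Notation mun := (@lebesgue_rV R n).
Local Notation mu := (@lebesgue_rV R n.+1).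

(** The ACL property: on almost every line in the direction [k], [u] agrees almost everywhere with a
    locally absolutely continuous function of derivative [g]. For square-integrable functions it is
    equivalent to [weak_partial]. *)
Definition lines k u g := {ae mun, forall y, exists2 w,
  primitive (fun t => g (ins k t y)) w & {ae mu1, forall t, u (ins k t y) = w t}}.

Lemma measurable_line k u y : measurable_fun setT u ->
  measurable_fun setT (fun t : measurableTypeR R => u (ins k t y)).
Proof. by move=> mu'; apply: (measurableT_comp mu'); exact: measurable_ins_l. Qed.

Lemma measurable_integral_ins k (f : 'rV[R]_n.+1 -> \bar R) : measurable_fun setT f ->
  measurable_fun setT (fun y => \int[mu1]_t f (ins k t y))%E.
Proof.
move=> mf.
rewrite (_ : (fun y => _) = (fun y => \int[mu1]_t (f^\+ (ins k t y)) -
                                      \int[mu1]_t (f^\- (ins k t y))))%E; last first.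
  apply/funext => y; rewrite integralE.
  by congr (_ - _)%E; apply: eq_integral => t _; rewrite ?funeposE ?funenegE.
apply: emeasurable_funB; apply: measurable_ge0_integral_ins => //.
- exact: measurable_funepos.
- exact: measurable_funeneg.
Qed.

Lemma sqint_line k u : sqint mu u ->
  {ae mun, forall y, sqint mu1 (fun t => u (ins k t y))}.
Proof.
move=> [mu' /(ae_integrable_ins k)]; apply: filterS => y ui; split => //.
exact: measurable_line.
Qed.

Lemma sqint_test1 (f : R -> R) : test1 f -> sqint mu1 f.
Proof.
move=> tf.
have mf : measurable_fun setT f by apply: continuous_measurable_fun; exact: test1_continuous.
have [sf [M hM]] := tf.
have cf : continuous (fun t => f t ^+ 2).
  by move=> t; apply: cvgM; exact: test1_continuous.
split => //; have [] // := @integrable_supported R (fun t => f t ^+ 2) `|M|.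
- move=> t tM; rewrite hM ?expr0n// leNgt; apply: contra tM => tM.
  rewrite -ler_norml; apply: ltW; apply: lt_le_trans tM _; exact: ler_norm.
- by apply: continuous_integrable_itv => t _; exact: cf.
Qed.

Lemma sqint_tensor_cube k (f : R -> R) (m : nat) : test1 f ->
  sqint mu (fun x => f (x ord0 k) * \1_(cube m) (del k x)).
Proof.
move=> tf; have [sf [M hM]] := tf.
have [C hC] : exists C, forall t, `|f t| <= C.
  have [C _ hC] := @continuous_rect_bound R (fun t _ => f t) (- `|M|) `|M| 0
    ltac:(by move=> p; apply: (@continuous_comp _ _ _ fst f); [exact: cvg_fst|exact: test1_continuous]).
  exists `|C| => t; have [tM|/ltW tM] := leP `|t| `|M|.
    by apply: le_trans (ler_norm C); apply: (hC t 0); rewrite ?normr0// -ler_norml.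
  by rewrite hM ?normr0// (le_trans (ler_norm M)).
have mf : measurable_fun setT f by apply: continuous_measurable_fun; exact: test1_continuous.
pose K := maxn m (Num.bound `|M|).
apply: (@sqint_bounded_support _ _ _ C K).
- apply: measurable_funM; first exact: (measurableT_comp mf (measurable_coord k)).
  have mi : measurable_fun setT (\1_(cube m) : 'rV[R]_n -> R).
    by apply: measurable_indic; exact: measurable_obox.
  exact: (measurableT_comp mi (measurable_del k)).
- move=> x; rewrite normrM -[leRHS]mulr1; apply: ler_pM => //.
  by rewrite indicE; case: (_ \in _); rewrite ?normr1 ?normr0.
- move=> x; apply: contra_notP => /eqP; rewrite mulf_eq0 negb_or => /andP[f0 i0].
  apply: in_cube => j; case: (unliftP k j) => [l ->|->].
    have dm : cube m (del k x).
      by move: i0; rewrite indicE; case: (boolP (_ \in _)) => [/set_mem//|]; rewrite eqxx.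
    have := dm l; rewrite /= mxE in_itv/= -ltr_norml => h; apply: lt_le_trans h _.
    by rewrite ler_nat leq_maxl.
  apply: (@lt_le_trans _ _ (Num.bound `|M|)%:R); last by rewrite ler_nat leq_maxr.
  apply: le_lt_trans (archi_boundP _) => //.
  rewrite leNgt; apply: contra f0 => h; rewrite hM// (le_trans (ler_norm M))// ltW//.
Qed.

(** Testing with theta(x_k) times humps in the other coordinates shows that the line integral, as a
    function of y, is orthogonal to all humps, so Du Bois-Reymond applies in y. The exceptional null
    set depends on [theta]. *)
Lemma weak_partial_test1_line k u g theta : L2 u -> L2 g -> weak_partial k u g ->
  test1 theta ->
  {ae mun, forall y, \int[mu1]_t (u (ins k t y) * theta^`()%classic t +
                                   g (ins k t y) * theta t) = 0}.
Proof.
move=> /L2P su /L2P sg wug tt.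
pose f x := u x * theta^`()%classic (x ord0 k) + g x * theta (x ord0 k).
have mtheta : measurable_fun setT theta.
  by apply: continuous_measurable_fun; exact: test1_continuous.
have mtheta' : measurable_fun setT theta^`()%classic.
  by apply: continuous_measurable_fun; apply: test1_continuous; exact: test1_derive1.
have mf : measurable_fun setT f.
  apply: measurable_funD; apply: measurable_funM; [by case: su| |by case: sg|].
    exact: (measurableT_comp mtheta' (measurable_coord k)).
  exact: (measurableT_comp mtheta (measurable_coord k)).
have fE y t : f (ins k t y) = u (ins k t y) * theta^`()%classic t + g (ins k t y) * theta t.
  by rewrite /f ins_at.
pose E y := \int[mu1]_t f (ins k t y).
suff : {ae mun, forall y, E y = 0}.
  by apply: filterS => y <-; apply: eq_Rintegral => t _; rewrite fE.
have fline : {ae mun, forall y, mu1.-integrable setT (EFin \o (fun t => f (ins k t y)))}.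
  apply: filterS2 (sqint_line k su) (sqint_line k sg) => y uy gy.
  have i1 := integrable_mul uy (sqint_test1 (test1_derive1 tt)).
  have i2 := integrable_mul gy (sqint_test1 tt).
  apply: eq_integrable (integrableD measurableT i1 i2) => // t _ /=.
  by rewrite fE EFinD.
apply: integral_humps_eq0 => [m|l a b].
  (* On [cube m] the line integral of [f] is that of [fm], whose factors are square integrable on
     the whole space; this gives local integrability of [E]. *)
  pose fm x := u x * (theta^`()%classic (x ord0 k) * \1_(cube m) (del k x)) +
               g x * (theta (x ord0 k) * \1_(cube m) (del k x)).
  have fmi : mu.-integrable setT (EFin \o fm).
    rewrite (_ : _ \o _ = (EFin \o (fun x => u x * (theta^`()%classic (x ord0 k) * \1_(cube m) (del k x)))%R) \+
      (EFin \o (fun x => g x * (theta (x ord0 k) * \1_(cube m) (del k x)))%R))%E//.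
    apply: integrableD => //.
      by apply: integrable_mul => //; apply: sqint_tensor_cube; exact: test1_derive1.
    by apply: integrable_mul => //; exact: sqint_tensor_cube.
  have hI := integrable_ins_integral k fmi.
  have hI' : mun.-integrable setT (EFin \o (fun y => fine (\int[mu1]_t (EFin \o fm) (ins k t y)))).
    apply: (le_integrable _ _ _ hI) => //.
      apply/measurable_EFinP; apply: measurableT_comp; first exact: fine_measurable.
      exact: measurable_int hI.
    by move=> y _ /=; case: (\int[mu1]_t _)%E => [r| |] //=; rewrite leey.
  have hI'' : mun.-integrable (cube m) (EFin \o (fun y => fine (\int[mu1]_t (EFin \o fm) (ins k t y)))).
    by apply: integrableS hI' => //; exact: measurable_obox.
  apply: eq_integrable hI''; first exact: measurable_obox.
  move=> y; rewrite inE => ym /=; rewrite /E /Rintegral; congr (fine _)%:E.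
  apply: eq_integral => t _; rewrite /fm /f ins_at del_ins indicE mem_set//.
  by rewrite !mulr1.
set h := humps _ _ _.
(* The function [cst 0] in position [k] is a default, overwritten by [theta]. *)
pose F := upd (fun j => if unlift k j is Some i then
   hump l.+1%:R^-1 (ratr (a i)) (ratr (b i)) else cst (0 : R)) k theta.
have Fh : F \o lift k = fun i => hump l.+1%:R^-1 (ratr (a i)) (ratr (b i)).
  apply/funext => i /=; rewrite /F /upd eq_sym (negbTE (neq_lift _ _)) liftK//.
have Fk : F k = theta by rewrite /F /upd eqxx.
have tF : test_function (prodfun F).
  apply: test_function_prodfun => j; case: (unliftP k j) => [i ->|->]; last by rewrite Fk.
  by rewrite -[F _]/((F \o lift k) i) Fh; apply: test1_hump; rewrite invr_gt0.
have pF x : prodfun F x = theta (x ord0 k) * h (del k x).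
  by rewrite -{1}(ins_del k x) prodfun_ins Fk Fh.
have dF x : partial k (prodfun F) x = theta^`()%classic (x ord0 k) * h (del k x).
  rewrite partial_prodfun => [|t]; last by rewrite Fk; apply: (tt.1 0%N).
  by rewrite -{1}(ins_del k x) prodfun_upd Fk Fh.
have i1 := integrable_mul su (sqint_test (test_function_partial k tF)).
have i2 := integrable_mul sg (sqint_test tF).
have i12 := integrableD measurableT i1 i2.
have : (\int[mu]_x ((u x * partial k (prodfun F) x)%:E + (g x * prodfun F x)%:E) = 0)%E.
  rewrite integralD//.
  have := wug _ tF; rewrite /Rintegral => wE.
  rewrite -[X in (X + _)%E]fineK; last exact: integrable_fin_num.
  by rewrite wE -[X in (_ + X)%E]fineK ?integrable_fin_num// -EFinD addNr.
rewrite (integral_insp k)// => I0.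
rewrite /Rintegral -[RHS]/(fine 0) -I0; congr fine; apply: ae_eq_integral => //.
- apply/measurable_EFinP; apply: measurable_funM; last first.
    by apply: measurable_humps; rewrite invr_gt0.
  apply: (@measurableT_comp _ _ _ _ _ _ fine); first exact: fine_measurable.
  apply: (@measurable_integral_ins k (EFin \o f)); exact/measurable_EFinP.
- by have := integrable_ins_integral k i12 => /measurable_int.
apply: filterS fline => y fy _.
rewrite /E EFinM /Rintegral fineK; last exact: integrable_fin_num.
rewrite muleC -integralZl//; apply: eq_integral => t _ /=.
rewrite pF dF ins_at del_ins -EFinD -EFinM; congr EFin.
by rewrite /f ins_at -/h; ring.
Qed.

End lines.

Section lines_weak.
Context {R : realType} {n : nat}.
Implicit Types (u g v : 'rV[R]_n.+1 -> R) (k : 'I_n.+1).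
Local Notation mu1 := (@lebesgue_measure R).
Local Notation mun := (@lebesgue_rV R n).
Local Notation mu := (@lebesgue_rV R n.+1).

Lemma ae1S (P Q : R -> Prop) : (forall t, P t -> Q t) ->
  {ae mu1, forall t, P t} -> {ae mu1, forall t, Q t}.
Proof. by move=> PQ; apply: (@filterS _ _ (ae_filter_ringOfSetsType mu1)). Qed.

Lemma sqint1_integrable_itv (f : R -> R) (a b : R) : sqint mu1 f ->
  mu1.-integrable `[a, b] (EFin \o f).
Proof.
have aboo : (mu1 `[a, b]%classic < +oo)%E.
  by rewrite lebesgue_measure_itv/=; case: ifP => // _; rewrite -EFinD ltry.
by move=> sf; apply: sqint_integrable.
Qed.

(* The constant of integration [c] is the mean of [u - U] against a fixed bump,
   [U] being any primitive of [g]. *)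
Lemma primitive_of_test1 (f g : R -> R) :
  sqint mu1 f -> sqint mu1 g ->
  (forall (l : nat) (a b : rat), exists2 theta, test1 theta &
    theta^`()%classic = (fun t => 1 * hump l.+1%:R^-1 (ratr a) (ratr b) t +
       - (\int[mu1]_t hump l.+1%:R^-1 (ratr a) (ratr b) t / \int[mu1]_t hump 1 0 1 t) *
       hump 1 0 1 t) /\
    \int[mu1]_t (f t * theta^`()%classic t + g t * theta t) = 0) ->
  exists2 w, primitive g w & {ae mu1, forall t, f t = w t}.
Proof.
move=> sf sg hth.
have [U pU] := primitive_exists (fun a b => sqint1_integrable_itv a b sg).
have cU := primitive_continuous pU.
pose D t := f t - U t.
pose h0 : R -> R := hump 1 0 1.
have th0 : test1 h0 by exact: test1_hump.
pose c0 := \int[mu1]_t h0 t.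
have c00 : c0 != 0 by rewrite gt_eqF// integral_hump01_gt0.
have iD eta : test1 eta -> mu1.-integrable setT (EFin \o (fun t => D t * eta t)).
  move=> te; have [_ [M hM]] := te.
  have i1 := integrable_mul sf (sqint_test1 te).
  have [] := @integrable_supported R (fun t => U t * eta t) `|M|.
  - move=> t tM; rewrite hM ?mulr0// leNgt; apply: contra tM => tM.
    rewrite -ler_norml; apply: ltW; apply: lt_le_trans tM _; exact: ler_norm.
  - apply: continuous_integrable_itv => t _.
    by apply: cvgM; [exact: cU|exact: test1_continuous].
  move=> i2 _; apply: eq_integrable (integrableB measurableT i1 i2) => // t _ /=.
  by rewrite -EFinB /D mulrBl.
pose c := \int[mu1]_t (D t * h0 t) / c0.
exists (fun t => U t + c).
  move=> a b ab; have [ig hU] := pU a b ab; split => //.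
  by rewrite -hU; ring.
suff : {ae mu1, forall t, D t - c = 0}.
  by apply: ae1S => t; rewrite /D => h; apply/eqP; rewrite -subr_eq0 -h; apply/eqP; ring.
have mf : measurable_fun setT f by case: sf.
have mU : measurable_fun setT U by exact: continuous_measurable_fun.
apply: integral_humps1_eq0 => [|K|l a b].
- by apply: measurable_funB => //; exact: measurable_funB.
- have h : mu1.-integrable `[- K%:R, K%:R] (EFin \o (fun t => D t - c)).
    have i1 := sqint1_integrable_itv (- K%:R) K%:R sf.
    have i2 : mu1.-integrable `[- K%:R, K%:R] (EFin \o (fun t => U t + c)).
      by apply: continuous_integrable_itv => t _; apply: cvgD; [exact: cU|exact: cvg_cst].
    apply: eq_integrable (integrableB _ i1 i2) => // t _ /=.
    by rewrite -EFinB /D; congr EFin; ring.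
  apply: integrableS h => //; exact: subset_itv_oo_cc.
set eta := hump _ _ _.
have te : test1 eta by apply: test1_hump; rewrite invr_gt0.
have [theta tt [dth I1]] := hth l a b.
set r := \int[mu1]_t hump _ _ _ t / _ in dth.
have rE : r = \int[mu1]_t eta t / c0 by [].
have [M M0 [hM hM']] : exists2 M : R, 0 <= M & (forall t, M <= `|t| -> theta t = 0) /\
    (forall t, M <= `|t| -> theta^`()%classic t = 0).
  have [_ [M1 h1]] := tt; have [_ [M2 h2]] := test1_derive1 tt.
  exists (Num.max `|M1| `|M2|); first by rewrite le_max normr_ge0.
  split => t; rewrite ge_max => /andP[t1 t2].
    by apply: h1; apply: le_trans t1; exact: ler_norm.
  by apply: h2; apply: le_trans t2; exact: ler_norm.
have cth' : continuous theta^`()%classic by apply: test1_continuous; exact: test1_derive1.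
have dtheta (t : R) : is_derive t 1 theta (theta^`()%classic t).
  exact: (smooth1_is_derive t tt.1).
have [i2 I2] := primitive_parts M0 pU cth' dtheta hM hM'.
have i1 : mu1.-integrable setT (EFin \o (fun t => f t * theta^`()%classic t + g t * theta t)).
  have j1 := integrable_mul sf (sqint_test1 (test1_derive1 tt)).
  have j2 := integrable_mul sg (sqint_test1 tt).
  by apply: eq_integrable (integrableD measurableT j1 j2).
(* Subtracting the two integrations by parts cancels the terms in [g] and leaves [D] tested against
   theta' = eta - r h0. *)
have I3 : \int[mu1]_t (D t * eta t) - r * \int[mu1]_t (D t * h0 t) = 0.
  rewrite -RintegralZl//; last exact: iD.
  have iDh : mu1.-integrable setT (EFin \o (fun t => r * (D t * h0 t))).
    by apply: eq_integrable (integrableZl measurableT r (iD _ th0)).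
  rewrite -RintegralB//; last exact: iD.
  rewrite -[RHS](subrr (0 : R)) -[X in _ = X - _]I1 -[X in _ = _ - X]I2 -RintegralB//.
  apply: eq_Rintegral => t _; rewrite dth /D -/eta -/h0; ring.
transitivity (\int[mu1]_t (D t * eta t) - c * \int[mu1]_t eta t); last first.
  rewrite -[RHS]I3 rE /c; congr (_ - _); rewrite mulrAC [RHS]mulrAC; congr (_ / _).
  by rewrite mulrC.
have ieta := test1_integrable te.
rewrite -RintegralZl// -RintegralB//.
- by apply: eq_Rintegral => t _; rewrite mulrBl.
- exact: iD.
- by apply: eq_integrable (integrableZl measurableT c ieta).
Qed.

(** One [theta] for each hump with rational data suffices: these are countably many, so their null
    sets are discarded together. Subtracting a multiple of a fixed bump gives mean zero, hence a
    compactly supported antiderivative. *)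
Lemma weak_partial_lines k u g : L2 u -> L2 g -> weak_partial k u g -> lines k u g.
Proof.
move=> Lu Lg wug.
pose c0 := \int[mu1]_t hump 1 0 1 t : R.
have c00 : c0 != 0 by rewrite gt_eqF// integral_hump01_gt0.
have hth (i : nat * (rat * rat)) : exists theta : R -> R, test1 theta /\
    theta^`()%classic = (fun t => 1 * hump i.1.+1%:R^-1 (ratr i.2.1) (ratr i.2.2) t +
       - (\int[mu1]_t hump i.1.+1%:R^-1 (ratr i.2.1) (ratr i.2.2) t / c0) * hump 1 0 1 t).
  have te : test1 (hump (i.1.+1%:R^-1 : R) (ratr i.2.1) (ratr i.2.2)).
    by apply: test1_hump; rewrite invr_gt0.
  have t0 : test1 (hump (1 : R) 0 1) by exact: test1_hump.
  have ie := test1_integrable te; have i0 := test1_integrable t0.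
  set r := (X in - X).
  have tl := test1_lin 1 (- r) te t0.
  have [|theta tt dE] := test1_antiderivative tl; last by exists theta.
  have iZ (s : R) (f : R -> R) : mu1.-integrable setT (EFin \o f) ->
      mu1.-integrable setT (EFin \o (fun t => s * f t)).
    by move=> fi; apply: eq_integrable (integrableZl measurableT s fi).
  rewrite RintegralD//; [|exact: iZ|exact: iZ].
  by rewrite !RintegralZl// mul1r mulNr /r divfK ?subrr.
have [theta thP] := choice hth.
have hae : {ae mun, forall y, forall i, \int[mu1]_t (u (ins k t y) * (theta i)^`()%classic t +
                                   g (ins k t y) * theta i t) = 0}.
  have : {ae mun, forall y, forall m, if unpickle m is Some i then \int[mu1]_t (u (ins k t y) * (theta i)^`()%classic t +
                                   g (ins k t y) * theta i t) = 0 else True}.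
    apply: ae_foralln => m; case: (unpickle m) => [i|]; last exact: nearW.
    exact: weak_partial_test1_line (thP i).1.
  by apply: filterS => y h i; have := h (pickle i); rewrite pickleK.
move: Lu Lg => /L2P su /L2P sg.
apply: filterS3 hae (sqint_line k su) (sqint_line k sg) => y hy uy gy.
apply: primitive_of_test1 => // l a b; have [tt dE] := thP (l, (a, b)).
by exists (theta (l, (a, b))).
Qed.

(** Integration by parts against the test function on almost every line, followed by Fubini. *)
Lemma lines_weak_partial k v h : L2 v -> L2 h -> lines k v h -> weak_partial k v h.
Proof.
move=> /L2P sv /L2P sh lvh phi tphi.
have tdphi := test_function_partial k tphi.
have i1 := integrable_mul sv (sqint_test tdphi).
have i2 := integrable_mul sh (sqint_test tphi).
apply/eqP; rewrite -addr_eq0 -RintegralD//; apply/eqP.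
have i12 := integrableD measurableT i1 i2.
rewrite /Rintegral -[RHS]/(fine 0); congr fine.
rewrite (integral_insp k i12) -(integral0 mun setT).
have mpv : measurable_fun setT (fun x => v x * partial k phi x + h x * phi x).
  apply: measurable_funD; apply: measurable_funM; [by case: sv| |by case: sh|].
    exact: measurable_test.
  exact: measurable_test.
apply: ae_eq_integral => //.
  apply: (@measurable_integral_ins R n k (EFin \o (fun x => v x * partial k phi x + h x * phi x))).
  exact/measurable_EFinP.
apply: filterS lvh => y [w pw vw] _ /=.
have [_ [K [_ hK]]] := test_function_bound tphi.
have [_ [K' [_ hK']]] := test_function_bound tdphi.
have out (f : 'rV[R]_n.+1 -> R) (L : nat) : (forall x, ~ cube L x -> f x = 0) ->
    forall t, L%:R <= `|t| -> f (ins k t y) = 0.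
  move=> hf t tL; apply: hf => /(_ k); rewrite ins_at /= in_itv/= -ltr_norml.
  by rewrite ltNge tL.
pose M := (maxn K K')%:R : R.
have [] := @primitive_parts R (fun t => h (ins k t y)) w (fun t => phi (ins k t y))
  (fun t => partial k phi (ins k t y)) M _ pw.
- by rewrite ler0n.
- have [/(_ [::])[/= cf _] _] := tdphi => t.
  apply: (@continuous_comp _ _ _ (fun t : R => ins k t y) (partial k phi)).
    exact: continuous_ins.
  exact: cf.
- move=> t; apply: is_derive_ins; have [/(_ [::])[/= _ df] _] := tphi; exact: df.
- move=> t tM; apply: (out phi K) => //; apply: le_trans tM.
  by rewrite ler_nat leq_maxl.
- move=> t tM; apply: (out (partial k phi) K') => //; apply: le_trans tM.
  by rewrite ler_nat leq_maxr.
move=> iw I0.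
transitivity (\int[mu1]_t (w t * partial k phi (ins k t y) + h (ins k t y) * phi (ins k t y))%:E)%E.
  apply: ae_eq_integral => //.
  - by apply/measurable_EFinP; exact: (measurable_line k y mpv).
  - exact: measurable_int iw.
  - by apply: ae1S vw => t -> _.
rewrite -[LHS]fineK; last exact: (integrable_fin_num _ iw).
by rewrite -[fine _]/(\int[mu1]_t (w t * partial k phi (ins k t y) + h (ins k t y) * phi (ins k t y))) I0.
Qed.

Lemma primitive_ae (g g' w : R -> R) : measurable_fun setT g' ->
  {ae mu1, forall t, g t = g' t} -> primitive g w -> primitive g' w.
Proof.
move=> mg' gg pw a b ab; have [ig wE] := pw a b ab.
have mg : measurable_fun `[a, b] (EFin \o g) by exact: measurable_int ig.
have mg'' : measurable_fun `[a, b] (EFin \o g').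
  by apply/measurable_EFinP; exact: measurable_funTS.
split.
  apply/integrableP; split => //; have /integrableP[_] := ig.
  apply: le_lt_trans; rewrite le_eqVlt; apply/orP; left; apply/eqP.
  apply: ge0_ae_eq_integral => //.
  - exact: measurableT_comp.
  - exact: measurableT_comp.
  - by apply: ae1S gg => t /= -> _.
rewrite wE /Rintegral; congr fine; apply: ae_eq_integral => //.
by apply: ae1S gg => t /= -> _.
Qed.

(** [G] is the derivative of [F] in the explicit variable x_k and [H] its derivative in the value.
    On each good line the statement is the one-variable chain rule for absolutely continuous
    functions, which is how the Sobolev chain rule is obtained. *)
Lemma lines_chain k u g (F G H : 'rV[R]_n.+1 -> R -> R) :
  measurable_fun setT (fun x => G x (u x) + H x (u x) * g x) ->
  (forall y, continuous (fun p : R * R => F (ins k p.1 y) p.2)) ->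
  (forall y, continuous (fun p : R * R => G (ins k p.1 y) p.2)) ->
  (forall y, continuous (fun p : R * R => H (ins k p.1 y) p.2)) ->
  (forall y (r : R -> R) (r' t : R), is_derive t 1 r r' ->
     is_derive t 1 (fun s => F (ins k s y) (r s))
       (G (ins k t y) (r t) + H (ins k t y) (r t) * r')) ->
  lines k u g ->
  lines k (fun x => F x (u x)) (fun x => G x (u x) + H x (u x) * g x).
Proof.
move=> mGH cF cG cH dF; apply: filterS => y [w pw uw].
exists (fun t => F (ins k t y) (w t)); last by apply: ae1S uw => t ->.
have := @primitive_chain R _ w (fun t => F (ins k t y)) (fun t => G (ins k t y))
  (fun t => H (ins k t y)) pw (cF y) (cG y) (cH y) (dF y).
apply: primitive_ae; first exact: (measurable_line k y mGH).
by apply: ae1S uw => t ->.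
Qed.

End lines_weak.

(** * Weak gradients and energies *)

Section gradients.
Context {R : realType} {n : nat}.
Implicit Types (u v : 'rV[R]_n.+1 -> R) (g : 'I_n.+1 -> 'rV[R]_n.+1 -> R) (k : 'I_n.+1).
Local Notation mu := (@lebesgue_rV R n.+1).

(* Valid without integrability, since [fine] sends [+oo] and [-oo] to 0. *)
Lemma RintegralZ_ge0 d (T : measurableType d) (m : {measure set T -> \bar R})
    (f : T -> R) (r : R) : measurable_fun setT f -> (forall x, 0 <= f x) ->
  \int[m]_x (r * f x) = r * \int[m]_x f x.
Proof.
move=> mf f0.
have mf' : measurable_fun setT (EFin \o f) by exact/measurable_EFinP.
have I0 : (0 <= \int[m]_x (f x)%:E)%E by apply: integral_ge0 => x _; rewrite lee_fin.
have [If|If] := pselect (m.-integrable setT (EFin \o f)); first by rewrite RintegralZl.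
have Ioo : (\int[m]_x (f x)%:E = +oo)%E.
  apply/eqP; rewrite -[_ == _]negbK; apply/negP => Ifin; apply: If; apply/integrableP; split => //.
  by under eq_integral do rewrite gee0_abs ?lee_fin//; rewrite ltey.
rewrite [in RHS]/Rintegral Ioo /= mulr0.
have [->|rn0] := eqVneq r 0.
  by rewrite /Rintegral (eq_integral (cst 0%E)) ?integral0// => x _; rewrite mul0r.
have [r0|r0] := leP 0 r.
  rewrite /Rintegral; under eq_integral do rewrite EFinM.
  rewrite ge0_integralZl_EFin// ?Ioo; last by move=> x _; rewrite lee_fin.
  by rewrite gt0_muley// lte_fin lt_neqAle eq_sym rn0.
rewrite /Rintegral (eq_integral (fun x => - ((- r)%:E * (f x)%:E))%E); last first.
  by move=> x _; rewrite -EFinM -EFinN mulNr opprK.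
rewrite integral_ge0N; last first.
  by move=> x _; rewrite -EFinM lee_fin mulr_ge0// oppr_ge0 ltW.
rewrite ge0_integralZl_EFin// ?Ioo; first by rewrite gt0_muley// lte_fin oppr_gt0.
- by move=> x _; rewrite lee_fin.
- by rewrite oppr_ge0 ltW.
Qed.

(** The gradient is carried explicitly, since every construction below comes with a formula for it,
    whereas [weak_grad] is an arbitrary representative. *)
Definition isgrad u g :=
  sqint mu u /\ forall k, sqint mu (g k) /\ weak_partial k u (g k).

Definition energy (lam : R) u g : R :=
  \int[mu]_x ((\sum_k g k x ^+ 2) + lam * u x ^+ 2).

Lemma H1P u : H1 u <-> exists g, isgrad u g.
Proof.
split=> [Hu|[g [su hg]]].
  exists (weak_grad u); split; first by apply/L2P; case: Hu.
  by move=> k; have [/L2P] := weak_gradP Hu k.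
split; first exact/L2P.
by move=> k; have [/L2P] := hg k; exists (g k).
Qed.

Lemma H1norm_energy lam u g : 0 <= lam -> isgrad u g ->
  H1norm lam u ^+ 2 = energy lam u g.
Proof.
move=> lam0 [su hg]; apply: H1normE => //; first exact/L2P.
  by move=> k; apply/L2P; have [] := hg k.
by move=> k; have [] := hg k.
Qed.

Lemma energy_ge0 lam u g : 0 <= lam -> 0 <= energy lam u g.
Proof.
move=> lam0; apply: Rintegral_ge0 => x _; apply: addr_ge0.
  by apply: sumr_ge0 => k _; exact: sqr_ge0.
by apply: mulr_ge0 => //; exact: sqr_ge0.
Qed.

Lemma integrable_energy lam u g : sqint mu u -> (forall k, sqint mu (g k)) ->
  mu.-integrable setT (EFin \o (fun x => (\sum_k g k x ^+ 2) + lam * u x ^+ 2)).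
Proof.
move=> [mu' ui] hg.
rewrite (_ : _ \o _ = (fun x => (\sum_k (g k x ^+ 2)%:E) + lam%:E * (u x ^+ 2)%:E)%E).
  apply: integrableD => //; last exact: integrableZl.
  by apply: integrable_sum => // k _; have [] := hg k.
by apply/funext => x /=; rewrite EFinD -sumEFin.
Qed.

Lemma weak_partialZ k (c : R) u (h : 'rV[R]_n.+1 -> R) : sqint mu u -> sqint mu h ->
  weak_partial k u h -> weak_partial k (fun x => c * u x) (fun x => c * h x).
Proof.
move=> su sh w phi tphi.
under eq_Rintegral do rewrite -mulrA.
under [in RHS]eq_Rintegral do rewrite -mulrA.
rewrite RintegralZl//; last exact: (integrable_mul su (sqint_test (test_function_partial k tphi))).
rewrite RintegralZl//; last exact: (integrable_mul sh (sqint_test tphi)).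
by rewrite w// mulrN.
Qed.

Lemma isgradZ (c : R) u g : isgrad u g -> isgrad (fun x => c * u x) (fun k x => c * g k x).
Proof.
move=> [su hg]; split; first exact: sqintZ.
move=> k; have [sg wg] := hg k; split; first exact: sqintZ.
exact: weak_partialZ.
Qed.

Lemma energyZ (c lam : R) u g : isgrad u g ->
  energy lam (fun x => c * u x) (fun k x => c * g k x) = c ^+ 2 * energy lam u g.
Proof.
move=> [su hg]; rewrite /energy -RintegralZl//; last first.
  by apply: integrable_energy => // k; have [] := hg k.
apply: eq_Rintegral => x _; rewrite mulrDr mulr_sumr exprMn mulrCA; congr (_ + _).
by apply: eq_bigr => k _; rewrite exprMn.
Qed.

Lemma isgrad_translate (s : 'rV[R]_n.+1) u g : isgrad u g ->
  isgrad (fun x => u (x + s)) (fun k x => g k (x + s)).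
Proof.
move=> [su hg]; split; first exact: sqint_translate.
move=> k; have [sg wg] := hg k; split; first exact: sqint_translate.
by apply: weak_partial_translate => //; exact/L2P.
Qed.

Lemma Rintegral_translate (s : 'rV[R]_n.+1) (f : 'rV[R]_n.+1 -> R) :
  mu.-integrable setT (EFin \o f) -> \int[mu]_x f (x + s) = \int[mu]_x f x.
Proof. by move=> fi; rewrite /Rintegral (integral_translate s fi). Qed.

Lemma energy_translate (s : 'rV[R]_n.+1) lam u g : isgrad u g ->
  energy lam (fun x => u (x + s)) (fun k x => g k (x + s)) = energy lam u g.
Proof.
move=> [su hg].
rewrite /energy -(@Rintegral_translate s (fun x => (\sum_k g k x ^+ 2) + lam * u x ^+ 2))//.
by apply: integrable_energy => // k; have [] := hg k.
Qed.

Lemma isgrad_chain u g (F : 'rV[R]_n.+1 -> R -> R)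
    (G : 'I_n.+1 -> 'rV[R]_n.+1 -> R -> R) (H : 'rV[R]_n.+1 -> R -> R) :
  isgrad u g ->
  sqint mu (fun x => F x (u x)) ->
  (forall k, sqint mu (fun x => G k x (u x) + H x (u x) * g k x)) ->
  (forall k y, continuous (fun p : R * R => F (ins k p.1 y) p.2)) ->
  (forall k y, continuous (fun p : R * R => G k (ins k p.1 y) p.2)) ->
  (forall k y, continuous (fun p : R * R => H (ins k p.1 y) p.2)) ->
  (forall k y (r : R -> R) (r' t : R), is_derive t 1 r r' ->
     is_derive t 1 (fun s => F (ins k s y) (r s))
       (G k (ins k t y) (r t) + H (ins k t y) (r t) * r')) ->
  isgrad (fun x => F x (u x)) (fun k x => G k x (u x) + H x (u x) * g k x).
Proof.
move=> [su hg] sF sGH cF cG cH dF; split => // k; split => //.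
have [sg wg] := hg k.
apply: lines_weak_partial; [exact/L2P|exact/L2P|].
apply: lines_chain => //; first by case: (sGH k).
by apply: weak_partial_lines => //; exact/L2P.
Qed.

End gradients.

(** * Cut-off and truncation functions *)

Section truncation.
Context {R : realType}.

Lemma cutoff_exists : exists (chi dchi : R -> R) (C : R),
  [/\ 0 <= C, (forall t, 0 <= chi t <= 1), chi 0 = 1 &
      [/\ (forall t : R, is_derive t 1 chi (dchi t)), continuous dchi,
       (forall t, `|dchi t| <= C) & forall t, 1 <= `|t| -> chi t = 0]].
Proof.
pose h : R -> R := hump 1 (-1) 1.
have th : test1 h by exact: test1_hump.
have [C C0 hC] : exists2 C, 0 <= C & forall t, `|h^`()%classic t| <= C.
  have th' := test1_derive1 th; have [_ [M hM]] := th'.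
  have [C C0 hC] := @continuous_rect_bound R (fun t _ => h^`()%classic t) (- `|M|) `|M| 0
    ltac:(by move=> p; apply: (@continuous_comp _ _ _ fst h^`()%classic); [exact: cvg_fst|exact: test1_continuous]).
  exists C => // t; have [tM|/ltW tM] := leP `|t| `|M|.
    by apply: (hC t 0); rewrite ?normr0// -ler_norml.
  by rewrite hM ?normr0// (le_trans (ler_norm M)).
(* The hump on ]-1, 1[ is exp(-2 / (1 - t^2)), with maximum exp(-2) at 0; the factor normalises it
   to 1. *)
exists (fun t => expR 2 * h t), (fun t => expR 2 * h^`()%classic t), (expR 2 * C).
split; [by rewrite mulr_ge0// expR_ge0| | |split].
- move=> t; rewrite mulr_ge0 ?expR_ge0 ?hump_ge0//=.
  have [t1|t1] := boolP (-1 < t < 1); last by rewrite /h hump_out ?mulr0.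
  rewrite /h humpE// -expRD -[leRHS]expR0 ler_expR.
  move: t1 => /andP[t1 t2].
  have p1 : 0 < t - -1 by lra.
  have p2 : 0 < 1 - t by lra.
  have p3 : 0 < (t - -1) * (1 - t) by exact: mulr_gt0.
  rewrite (_ : (t - -1)^-1 + (1 - t)^-1 = 2 / ((t - -1) * (1 - t))); last first.
    by field; rewrite !gt_eqF//; lra.
  rewrite mulN1r subr_le0 ler_pdivlMr//.
  by have := sqr_ge0 t; nra.
- rewrite /h humpE; last by apply/andP; split; lra.
  rewrite -expRD -[RHS]expR0; congr expR; rewrite opprK add0r subr0 invr1; lra.
- move=> t; have := is_derive1M (is_derive1_cst (expR 2) t) (smooth1_is_derive t th.1).
  by rewrite mul0r add0r.
- move=> t; apply: cvgM; first exact: cvg_cst.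
  by apply: test1_continuous; exact: test1_derive1.
- by move=> t; rewrite normrM ger0_norm ?expR_ge0// ler_wpM2l ?expR_ge0.
- move=> t t1; rewrite /h hump_out ?mulr0// -ltr_norml -leNgt//.
Qed.

(** A smooth bounded substitute for truncation at a height of order c^(-1/2). Its derivative is
    continuous, as the chain rule requires, and bounded by 1, and it tends to the identity as [c]
    tends to 0. *)
Definition trunc (c r : R) : R := r / (1 + c * r ^+ 2).
Definition dtrunc (c r : R) : R := (1 - c * r ^+ 2) / (1 + c * r ^+ 2) ^+ 2.

Lemma trunc_den_ge1 (c r : R) : 0 <= c -> 1 <= 1 + c * r ^+ 2.
Proof. by move=> c0; rewrite lerDl mulr_ge0// sqr_ge0. Qed.

Lemma trunc_den_gt0 (c r : R) : 0 <= c -> 0 < 1 + c * r ^+ 2.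
Proof. by move=> c0; apply: lt_le_trans (trunc_den_ge1 r c0). Qed.

Lemma is_derive_trunc (c r : R) : 0 <= c -> is_derive r 1 (trunc c) (dtrunc c r).
Proof.
move=> c0; have d0 := trunc_den_gt0 r c0.
have h1 := is_derive1M (is_derive1_idf r) (is_derive1_idf r).
have h2 := is_derive1D (is_derive1_cst 1 r) (is_derive1M (is_derive1_cst c r) h1).
have h3 := is_derive1_compf (g := fun t => 1 + c * (t * t)) (is_derive1_inv (lt0r_neq0 d0)) h2.
have h4 := is_derive1M (is_derive1_idf r) h3.
apply: (is_derive1_eq h4); rewrite /dtrunc; field.
by rewrite gt_eqF.
Qed.

Lemma continuous_trunc (c : R) : 0 <= c -> continuous (trunc c).
Proof. by move=> c0 r; apply: is_derive1_continuous (is_derive_trunc r c0). Qed.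

Lemma continuous_dtrunc (c : R) : 0 <= c -> continuous (dtrunc c).
Proof.
move=> c0 r.
have cs : continuous (fun r : R => c * r ^+ 2).
  move=> t; apply: cvgM; first exact: cvg_cst.
  by apply: cvgM; exact: cvg_id.
have cd : continuous (fun r : R => 1 + c * r ^+ 2).
  by move=> t; apply: cvgD; [exact: cvg_cst|exact: cs].
apply: cvgM; first by apply: cvgB; [exact: cvg_cst|exact: cs].
apply: cvgV; first by rewrite expf_neq0// gt_eqF// trunc_den_gt0.
by apply: cvgM; exact: cd.
Qed.

Lemma norm_trunc_le (c r : R) : 0 <= c -> `|trunc c r| <= `|r|.
Proof.
move=> c0; rewrite /trunc normrM normfV (ger0_norm (ltW (trunc_den_gt0 r c0))).
by rewrite ler_pdivrMr ?trunc_den_gt0// ler_peMr// trunc_den_ge1.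
Qed.

Lemma norm_dtrunc_le1 (c r : R) : 0 <= c -> `|dtrunc c r| <= 1.
Proof.
move=> c0; have d0 := trunc_den_gt0 r c0; have d1 := trunc_den_ge1 r c0.
rewrite /dtrunc normrM normfV [`|_ ^+ 2|]ger0_norm ?sqr_ge0//.
rewrite ler_pdivrMr ?exprn_gt0// mul1r.
set s := c * r ^+ 2 in d0 d1 *; have s0 : 0 <= s by rewrite mulr_ge0// sqr_ge0.
by rewrite ler_norml; apply/andP; split; nra.
Qed.

Lemma trunc_sqr_le (c r : R) : 0 < c -> trunc c r ^+ 2 <= c^-1.
Proof.
move=> c0; have d0 := trunc_den_gt0 r (ltW c0).
rewrite /trunc exprMn exprVn ler_pdivrMr ?exprn_gt0// mulrC ler_pdivlMr//.
set s := r ^+ 2; have s0 : 0 <= s by rewrite sqr_ge0.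
have := mulr_ge0 (ltW c0) s0; rewrite (mulrC s c); set z := c * s.
by have := sqr_ge0 z; nra.
Qed.

Lemma cvg_trunc (r : R) (c : nat -> R) : (forall j, 0 <= c j) -> c j @[j --> \oo] --> 0 ->
  trunc (c j) r @[j --> \oo] --> r.
Proof.
move=> c0 hc.
have h1 : 1 + c j * r ^+ 2 @[j --> \oo] --> 1 + 0 * r ^+ 2.
  by apply: cvgD; [exact: cvg_cst|apply: cvgMl].
rewrite mul0r addr0 in h1.
have h2 : (1 + c j * r ^+ 2)^-1 @[j --> \oo] --> (1 : R)^-1.
  by apply: cvgV => //; exact: oner_neq0.
have : r * (1 + c j * r ^+ 2)^-1 @[j --> \oo] --> r * 1^-1.
  by apply: cvgM => //; exact: cvg_cst.
by rewrite invr1 mulr1.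
Qed.

End truncation.

(** * The functional on the constraint *)

(** The blocks partition the indices, so a labelling [b] encodes them; later arguments compare
    labels instead of intervals. *)
Lemma block_index (d m : nat) (a : m.+1.-tuple nat) : is_decomposition d a ->
  exists b : 'I_d -> 'I_m, forall h i, (i \in block a h) = (b i == h).
Proof.
move=> /and3P[/eqP a0 /eqP am sa].
have mono p q : (p <= q <= m)%N -> (nth 0 a p <= nth 0 a q)%N.
  move=> /andP[]; rewrite leq_eqVlt => /predU1P[->//|pq qm].
  by apply: ltnW; apply: (sorted_ltn_nth ltn_trans 0%N sa); rewrite ?inE ?size_tuple// ltnS (leq_trans _ qm)// ltnW.
have ex (i : 'I_d) : exists h : 'I_m, (nth 0 a h <= i < nth 0 a h.+1)%N.
  have ex : exists p, (i < nth 0 a p)%N by exists m; rewrite am.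
  (* The least p with i < a_p is not 0 because a_0 = 0; its predecessor is the label of the
     block. *)
  case: (ex_minnP ex) => [[|p]]; first by rewrite a0.
  move=> ip pmin.
  have pm : (p < m)%N by apply: pmin; rewrite am.
  exists (Ordinal pm); rewrite /= ip andbT leqNgt; apply/negP => /pmin.
  by rewrite ltnn.
have [b hb] := choice ex.
exists b => h i; rewrite inE; apply/idP/eqP => [/andP[h1 h2]|<-]; last exact: hb.
have /andP[b1 b2] := hb i; apply/val_inj/eqP; rewrite /= eqn_leq; apply/andP; split.
  rewrite leqNgt; apply/negP => hlt.
  have := leq_trans h2 (mono h.+1 (b i) _); rewrite hlt ltnW ?ltn_ord// => /(_ isT).
  by rewrite ltnNge b1.
rewrite leqNgt; apply/negP => hlt.
have := leq_trans b2 (mono (b i).+1 h _); rewrite hlt ltnW ?ltn_ord// => /(_ isT).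
by rewrite ltnNge h1.
Qed.

Section functional.
Context {R : realType} {n d : nat}.
Variables (lam : 'I_d -> R) (beta : 'I_d -> 'I_d -> R).
Hypothesis lam0 : forall i, 0 < lam i.
Hypothesis beta_sym : forall i j, i != j -> beta i j = beta j i.
Implicit Types u v : 'I_d -> 'rV[R]_n.+1 -> R.
Local Notation mu := (@lebesgue_rV R n.+1).

(** A real integral, equal to 0 when it diverges. [J] follows the same convention, so the algebraic
    formulas below hold before any finiteness is known. *)
Definition overlap (f h : 'rV[R]_n.+1 -> R) : R := \int[mu]_x (f x ^+ 2 * h x ^+ 2).

Definition nrg u i : R := H1norm (lam i) (u i) ^+ 2.

Lemma nrg_ge0 u i : 0 <= nrg u i.
Proof. exact: sqr_ge0. Qed.

Lemma overlapC f h : overlap f h = overlap h f.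
Proof. by apply: eq_Rintegral => x _; rewrite mulrC. Qed.

Lemma overlap_ge0 f h : 0 <= overlap f h.
Proof. by apply: Rintegral_ge0 => x _; rewrite mulr_ge0// sqr_ge0. Qed.

Lemma H1_measurable (f : 'rV[R]_n.+1 -> R) : H1 f -> measurable_fun setT f.
Proof. by move=> [/L2P[]]. Qed.

Lemma measurable_overlap (f h : 'rV[R]_n.+1 -> R) :
  measurable_fun setT f -> measurable_fun setT h ->
  measurable_fun setT (fun x => f x ^+ 2 * h x ^+ 2).
Proof. by move=> mf mh; apply: measurable_funM; exact: measurable_funX. Qed.

Lemma overlapZ (c e : R) (f h : 'rV[R]_n.+1 -> R) :
  measurable_fun setT f -> measurable_fun setT h ->
  overlap (fun x => c * f x) (fun x => e * h x) = c ^+ 2 * e ^+ 2 * overlap f h.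
Proof.
move=> mf mh; rewrite /overlap -RintegralZ_ge0; last 2 first.
- exact: measurable_overlap.
- by move=> x; rewrite mulr_ge0// sqr_ge0.
by apply: eq_Rintegral => x _; rewrite !exprMn; ring.
Qed.

Lemma nrgZ (c : 'I_d -> R) u i : H1 (u i) ->
  nrg (fun j x => c j * u j x) i = c i ^+ 2 * nrg u i.
Proof.
move=> /H1P[g hg]; rewrite /nrg (H1norm_energy (ltW (lam0 i)) (isgradZ (c i) hg)).
by rewrite (H1norm_energy (ltW (lam0 i)) hg) energyZ.
Qed.

Lemma JE u : (forall i, H1 (u i)) ->
  J lam beta u = 2^-1 * (\sum_i nrg u i) -
    4^-1 * (\sum_i \sum_j beta i j * overlap (u i) (u j)).
Proof.
move=> Hu; rewrite /J; congr (_ - _ * _); apply: eq_bigr => i _; apply: eq_bigr => j _.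
rewrite -RintegralZ_ge0; last 2 first.
- by apply: measurable_overlap; exact: H1_measurable.
- by move=> x; rewrite mulr_ge0// sqr_ge0.
by apply: eq_Rintegral => x _; rewrite mulrA.
Qed.

Lemma H1Z (c : R) (f : 'rV[R]_n.+1 -> R) : H1 f -> H1 (fun x => c * f x).
Proof. by move=> /H1P[g hg]; apply/H1P; eexists; exact: (isgradZ c hg). Qed.

Lemma J_scaled (c : 'I_d -> R) u : (forall i, H1 (u i)) ->
  J lam beta (fun j x => c j * u j x) = 2^-1 * (\sum_i c i ^+ 2 * nrg u i) -
    4^-1 * (\sum_i \sum_j beta i j * (c i ^+ 2 * c j ^+ 2 * overlap (u i) (u j))).
Proof.
move=> Hu; rewrite JE; last by move=> i; exact: H1Z.
congr (_ * _ - _ * _); first by apply: eq_bigr => i _; rewrite nrgZ.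
apply: eq_bigr => i _; apply: eq_bigr => j _; congr (_ * _).
by rewrite overlapZ//; exact: H1_measurable.
Qed.

Lemma is_derive1_sum (I : Type) (s : seq I) (f : I -> R -> R) (df : I -> R) (x : R) :
  (forall i, is_derive x 1 (f i) (df i)) ->
  is_derive x 1 (fun t => \sum_(i <- s) f i t) (\sum_(i <- s) df i).
Proof.
move=> hf; elim: s => [|i s IH].
  rewrite big_nil (_ : (fun t => _) = cst 0); first exact: is_derive1_cst.
  by apply/funext => t; rewrite big_nil.
rewrite big_cons (_ : (fun t => _) = (fun t => f i t + \sum_(i <- s) f i t)).
  exact: is_derive1D.
by apply/funext => t; rewrite big_cons.
Qed.

(** Replacing u_i by (1 + t) u_i multiplies squared norms and overlaps by powers of 1 + t, so [J]
    becomes a polynomial in t. *)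
Lemma partialJE i u : (forall j, H1 (u j)) ->
  partialJ lam beta i u (u i) = nrg u i - \sum_j beta i j * overlap (u i) (u j).
Proof.
move=> Hu; rewrite /partialJ.
pose c (j : 'I_d) (t : R) := if j == i then 1 + t else 1.
pose dc (j : 'I_d) : R := if j == i then 1 else 0.
rewrite (_ : (fun t => _) = (fun t => 2^-1 * (\sum_j c j t ^+ 2 * nrg u j) -
    4^-1 * (\sum_j \sum_k beta j k * (c j t ^+ 2 * c k t ^+ 2 * overlap (u j) (u k))))); last first.
  apply/funext => t; rewrite -J_scaled//; congr J; apply/funext => j; apply/funext => x.
  rewrite /c; case: eqP => [->|_]; last by rewrite mul1r.
  by rewrite mulrDl mul1r.
have hc j : is_derive (0 : R) 1 (fun t => c j t ^+ 2) (2 * dc j).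
  have h : is_derive (0 : R) 1 (c j) (dc j).
    rewrite /c /dc; case: eqP => _; last exact: is_derive1_cst.
    have := is_derive1D (is_derive1_cst 1 0) (is_derive1_idf (0 : R)).
    by rewrite add0r.
  apply: (is_derive1_eq (is_derive1M h h)).
  by rewrite /c /dc; case: eqP => _; ring.
have c0 j : c j 0 = 1 by rewrite /c; case: eqP => _ //; rewrite addr0.
rewrite derive1E.
have h1 := is_derive1M (is_derive1_cst 2^-1 0) (is_derive1_sum (index_enum 'I_d)
  (fun j => is_derive1M (hc j) (is_derive1_cst (nrg u j) 0))).
have h2 := is_derive1M (is_derive1_cst 4^-1 0) (is_derive1_sum (index_enum 'I_d)
  (fun j => is_derive1_sum (index_enum 'I_d) (fun k =>
   is_derive1M (is_derive1_cst (beta j k) 0)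
    (is_derive1M (is_derive1M (hc j) (hc k)) (is_derive1_cst (overlap (u j) (u k)) 0))))).
have [_ ->] := is_derive1B h1 h2.
rewrite !mul0r !add0r; congr (_ - _).
  rewrite (bigD1 i)//= big1 ?addr0.
    by rewrite /dc eqxx; field.
  by move=> j ji; rewrite /dc (negbTE ji) !mulr0 mul0r add0r.
rewrite (_ : \sum_j _ = \sum_j \sum_k (2 * dc j * (beta j k * overlap (u j) (u k)) +
   2 * dc k * (beta j k * overlap (u j) (u k)))); last first.
  by apply: eq_bigr => j _; apply: eq_bigr => k _; rewrite !c0 !expr1n; ring.
(* The index [i] occurs once as a row and once as a column; symmetry of [beta] makes the two halves
   equal, and (2 + 2) / 4 = 1. *)
under eq_bigr do rewrite big_split.
rewrite big_split /= [X in _ * (_ + X)]exchange_big /=.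
have E (F : 'I_d -> 'I_d -> R) : \sum_j \sum_k 2 * dc j * F j k = 2 * \sum_k F i k.
  rewrite (bigD1 i)//= [X in _ + X]big1 ?addr0.
    by rewrite mulr_sumr; apply: eq_bigr => k _; rewrite /dc eqxx mulr1.
  by move=> j ji; apply: big1 => k _; rewrite /dc (negbTE ji) mulr0 mul0r.
rewrite !E (_ : \sum_k beta k i * overlap (u k) (u i) = \sum_k beta i k * overlap (u i) (u k)).
  by field.
apply: eq_bigr => k _; rewrite overlapC; congr (_ * _).
by have [->//|ki] := eqVneq k i; rewrite beta_sym.
Qed.

Section blocks.
Variables (m : nat) (a : m.+1.-tuple nat) (b : 'I_d -> 'I_m).
Hypothesis ab : forall h i, (i \in block a h) = (b i == h).

Definition block_nrg u (h : 'I_m) : R := \sum_(i | b i == h) nrg u i.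

Lemma block_nrg_ge0 u h : 0 <= block_nrg u h.
Proof. by apply: sumr_ge0 => i _; exact: nrg_ge0. Qed.

(** Norms are nonnegative, so their sum is nonzero exactly when the sum of their squares is
    positive; the other condition is [partialJE] summed over the block. *)
Lemma NehariP u : (forall i, H1 (u i)) ->
  Nehari lam beta a u <-> forall h, 0 < block_nrg u h /\
    block_nrg u h = \sum_(i | b i == h) \sum_j beta i j * overlap (u i) (u j).
Proof.
move=> Hu.
have bE (F : 'I_d -> R) h : \sum_(i in block a h) F i = \sum_(i | b i == h) F i.
  by apply: eq_bigl => i; rewrite ab.
have pE h : \sum_(i in block a h) partialJ lam beta i u (u i) =
    block_nrg u h - \sum_(i | b i == h) \sum_j beta i j * overlap (u i) (u j).
  by rewrite bE -sumrB; apply: eq_bigr => i _; rewrite partialJE.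
have nE h : (\sum_(i in block a h) H1norm (lam i) (u i) != 0) = (0 < block_nrg u h).
  rewrite bE lt_neqAle block_nrg_ge0 andbT [0 == _]eq_sym; congr negb.
  rewrite /block_nrg !psumr_eq0; [|by move=> i _; exact: nrg_ge0|by move=> i _; exact: sqrtr_ge0].
  by apply: eq_all => i; rewrite /nrg sqrf_eq0.
split => [[_ hu] h|hu].
  have [h1 h2] := hu h; split; first by rewrite -nE.
  by apply/eqP; rewrite -subr_eq0 -pE h2.
by split => // h; have [h1 h2] := hu h; split; [rewrite nE|rewrite pE h2 subrr].
Qed.

Lemma sum_blocks (F : 'I_d -> R) : \sum_i F i = \sum_h \sum_(i | b i == h) F i.
Proof. by rewrite (partition_big b xpredT). Qed.

(** Summing the constraints makes the quartic part equal to the energy, and 1/2 - 1/4 = 1/4. *)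
Lemma J_Nehari u : Nehari lam beta a u -> J lam beta u = 4^-1 * \sum_h block_nrg u h.
Proof.
move=> Mu; have Hu : forall i, H1 (u i) by case: Mu.
have /(NehariP Hu) hu := Mu.
rewrite JE// !(sum_blocks (fun i => _)).
rewrite [X in _ - _ * X](_ : _ = \sum_h block_nrg u h); first by rewrite /block_nrg; field.
by apply: eq_bigr => h _; have [_ ->] := hu h.
Qed.

End blocks.
End functional.

(** * Competitors *)

(** Fatou's lemma as lower semicontinuity. The limit integral may be infinite, hence a comparison
    with a level [c] below it rather than a convergence statement. *)
Lemma fatou_near d (T : measurableType d) (R : realType) (mu : {measure set T -> \bar R})
    (f_ : nat -> T -> R) (f : T -> R) (c : \bar R) :
  (forall j, measurable_fun setT (f_ j)) -> (forall j x, 0 <= f_ j x) ->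
  (forall x, f_ j x @[j --> \oo] --> f x) ->
  (c < \int[mu]_x (f x)%:E)%E ->
  \forall j \near \oo, (c < \int[mu]_x (f_ j x)%:E)%E.
Proof.
move=> mf f0 ff cf; pose a j := (\int[mu]_x (f_ j x)%:E)%E.
have fat : (\int[mu]_x (f x)%:E <= limn_einf a)%E.
  have := @fatou _ _ _ mu setT measurableT (fun j x => (f_ j x)%:E) _ _.
  rewrite (_ : (fun x => limn_einf _) = (fun x => (f x)%:E)).
    apply; first by move=> j; exact/measurable_EFinP.
    by move=> j x _; rewrite lee_fin.
  apply/funext => x; have h : ((f_ j x)%:E @[j --> \oo] --> (f x)%:E)%E.
    by apply: cvg_EFin; [exact: nearW|exact: ff].
  by have [-> _] := cvg_limn_einf_sup h.
apply: contrapT => H.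
have {}H N : exists2 j, (N <= j)%N & (a j <= c)%E.
  apply: contrapT => H'; apply: H; exists N => // j /= Nj.
  by rewrite ltNge; apply/negP => jc; apply: H'; exists j.
have : (limn_einf a <= c)%E.
  rewrite limn_einf_lim; apply: lime_le; first exact: is_cvg_einfs.
  apply: nearW => N; have [j Nj jc] := H N.
  by apply: le_trans jc; apply: ereal_inf_lbound; exists j.
by rewrite leNgt (lt_le_trans cf fat).
Qed.

(** * Bounded approximations supported in a slab *)

Section cut_and_truncate.
Context {R : realType} {n : nat}.
Local Notation mu := (@lebesgue_rV R n.+1).
Variables (chi dchi : R -> R) (C : R).
Hypotheses (C0 : 0 <= C) (chi01 : forall t, 0 <= chi t <= 1) (chi1 : chi 0 = 1).
Hypotheses (dchiE : forall t : R, is_derive t 1 chi (dchi t)) (cdchi : continuous dchi).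
Hypotheses (dchiC : forall t, `|dchi t| <= C) (chi0 : forall t, 1 <= `|t| -> chi t = 0).
Implicit Types (M lam : R) (x : 'rV[R]_n.+1) (u : 'rV[R]_n.+1 -> R) (g : 'I_n.+1 -> 'rV[R]_n.+1 -> R).

(** The cut-off acts in the first coordinate alone, the direction in which blocks are translated
    apart; the truncation bounds the function by [M], which makes the overlaps finite. *)
Definition cutr (M : R) u (x : 'rV[R]_n.+1) : R := chi (x ord0 ord0 / M) * trunc (M ^- 2) (u x).

Definition dcutr (M : R) u g (k : 'I_n.+1) (x : 'rV[R]_n.+1) : R :=
  dchi (x ord0 ord0 / M) * ((k == ord0)%:R / M) * trunc (M ^- 2) (u x) +
  chi (x ord0 ord0 / M) * dtrunc (M ^- 2) (u x) * g k x.

Let cchi : continuous chi.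
Proof. by move=> t; exact: is_derive1_continuous (dchiE t). Qed.

Lemma is_derive_ins0 (k : 'I_n.+1) (y : 'rV[R]_n) (t : R) :
  is_derive t 1 (fun s => ins k s y ord0 ord0) (k == ord0)%:R.
Proof.
have [->|k0] := eqVneq k ord0.
  rewrite (_ : (fun s => _) = id); first exact: is_derive1_idf.
  by apply/funext => s; rewrite ins_at.
case: (unliftP k ord0) => [l lE|kE]; last by rewrite kE eqxx in k0.
rewrite (_ : (fun s => _) = cst (y ord0 l)); first exact: is_derive1_cst.
by apply/funext => s; rewrite lE ins_lift.
Qed.

Lemma norm_cutr_le M u x : 0 < M -> `|cutr M u x| <= `|u x|.
Proof.
move=> M0; rewrite /cutr normrM -[leRHS]mul1r; apply: ler_pM => //.
  by have /andP[? ?] := chi01 (x ord0 ord0 / M); rewrite ger0_norm.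
by apply: norm_trunc_le; rewrite invr_ge0 sqr_ge0.
Qed.

Lemma cutr_sqr_le M u x : 0 < M -> cutr M u x ^+ 2 <= M ^+ 2.
Proof.
move=> M0; rewrite /cutr exprMn -[leRHS]mul1r; apply: ler_pM; rewrite ?sqr_ge0//.
  by have /andP[c0 c1] := chi01 (x ord0 ord0 / M); rewrite expr_le1.
rewrite -[leRHS]invrK; apply: trunc_sqr_le.
by rewrite invr_gt0 exprn_gt0.
Qed.

Lemma cutr_out M u x : 0 < M -> M <= `|x ord0 ord0| -> cutr M u x = 0.
Proof.
move=> M0 xM; rewrite /cutr chi0 ?mul0r// normrM normfV (gtr0_norm M0).
by rewrite ler_pdivlMr// mul1r.
Qed.

Lemma cvg_cutr u x : cutr j.+1%:R u x @[j --> \oo] --> u x.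
Proof.
have hV : (j.+1%:R : R)^-1 @[j --> \oo] --> (0 : R) by exact: cvg_harmonic.
have h1 : chi (x ord0 ord0 / j.+1%:R) @[j --> \oo] --> (1 : R).
  have h0 : x ord0 ord0 / j.+1%:R @[j --> \oo] --> x ord0 ord0 * 0.
    by apply: cvgM; [exact: cvg_cst|exact: hV].
  have : chi (x ord0 ord0 / j.+1%:R) @[j --> \oo] --> chi (x ord0 ord0 * 0).
    by apply: continuous_cvg => //; exact: cchi.
  by rewrite mulr0 chi1.
have h2 : j.+1%:R ^- 2 @[j --> \oo] --> (0 : R).
  have : (j.+1%:R^-1 * j.+1%:R^-1 : R) @[j --> \oo] --> (0 * 0 : R) by apply: cvgM.
  rewrite mulr0 (_ : (fun j : nat => j.+1%:R^-1 * j.+1%:R^-1) = (fun j : nat => j.+1%:R ^- 2 : R))//.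
  by apply/funext => j; rewrite -expr2 exprVn.
have h3 : trunc (j.+1%:R ^- 2) (u x) @[j --> \oo] --> u x.
  by apply: cvg_trunc => // j; rewrite invr_ge0 sqr_ge0.
have : chi (x ord0 ord0 / j.+1%:R) * trunc (j.+1%:R ^- 2) (u x) @[j --> \oo] --> 1 * u x.
  by apply: cvgM.
by rewrite mul1r; apply.
Qed.

(** The cut-off adds at most q |u| to |g|, with q = C / M. In the square, the cross term is at most
    q (u^2 + g^2), and q^2 <= C^2 / M because 1 <= M; all errors are thus of order 1 / M. *)
Lemma dcutr_sqr_le M u g k x : 1 <= M ->
  dcutr M u g k x ^+ 2 <= (1 + C / M) * g k x ^+ 2 + (C + C ^+ 2) / M * u x ^+ 2.
Proof.
move=> M1; have M0 : 0 < M by exact: lt_le_trans M1.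
have c0 : 0 <= M ^- 2 by rewrite invr_ge0 sqr_ge0.
pose q := C / M; have q0 : 0 <= q by rewrite divr_ge0// ltW.
have p1 : `|dchi (x ord0 ord0 / M) * ((k == ord0)%:R / M) * trunc (M ^- 2) (u x)| <= q * `|u x|.
  rewrite normrM ler_pM// ?norm_trunc_le// normrM /q ler_pM// normrM normfV (gtr0_norm M0).
  by rewrite ler_piMl ?invr_ge0 ?(ltW M0)//; case: (_ == _); rewrite ?normr1 ?normr0.
have p2 : `|chi (x ord0 ord0 / M) * dtrunc (M ^- 2) (u x) * g k x| <= `|g k x|.
  rewrite normrM ler_piMl// normrM mulr_ile1// ?norm_dtrunc_le1//.
  by have /andP[? ?] := chi01 (x ord0 ord0 / M); rewrite ger0_norm.
have p3 : dcutr M u g k x ^+ 2 <= (q * `|u x| + `|g k x|) ^+ 2.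
  have h0 : 0 <= q * `|u x| + `|g k x| by apply: addr_ge0 => //; exact: mulr_ge0.
  rewrite -sqr_normE lerXn2r ?nnegrE//.
  by rewrite /dcutr (le_trans (ler_normD _ _))// lerD.
apply: (le_trans p3); rewrite -(sqr_normE (g k x)) -(sqr_normE (u x)).
have p4 : q ^+ 2 <= C ^+ 2 / M.
  rewrite /q exprMn ler_wpM2l ?sqr_ge0// expr2 ler_piMl ?invr_ge0 ?(ltW M0)//.
  by rewrite invf_le1.
have p5 : (C + C ^+ 2) / M = q + C ^+ 2 / M by rewrite mulrDl.
rewrite p5 -/q.
set s := `|u x|; set t := `|g k x|; set z := C ^+ 2 / M in p4 *.
have := ler_wpM2r (sqr_ge0 s) p4; have := mulr_ge0 q0 (sqr_ge0 (s - t)).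
move=> h1 h2; lra.
Qed.

Lemma measurable_chi0 (f : R -> R) (M : R) : continuous f ->
  measurable_fun setT (fun x : 'rV[R]_n.+1 => f (x ord0 ord0 / M)).
Proof.
move=> cf; have mf : measurable_fun setT f by exact: continuous_measurable_fun.
apply: (measurableT_comp mf); apply: measurable_funM => //; exact: measurable_coord.
Qed.

Lemma measurable_cutr M u : 0 < M -> measurable_fun setT u -> measurable_fun setT (cutr M u).
Proof.
move=> M0 mu'; apply: measurable_funM; first exact: measurable_chi0.
apply: (measurableT_comp _ mu'); apply: continuous_measurable_fun.
by apply: continuous_trunc; rewrite invr_ge0 sqr_ge0.
Qed.

Lemma sqint_cutr M u : 0 < M -> sqint mu u -> sqint mu (cutr M u).
Proof.
move=> M0 [mu' ui]; apply: (sqint_le (h := fun x => u x ^+ 2)) => //.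
  exact: measurable_cutr.
by move=> x; rewrite -sqr_normE -(sqr_normE (u x)) lerXn2r ?nnegrE// norm_cutr_le.
Qed.

Lemma sqint_dcutr M u g k : 1 <= M -> sqint mu u -> sqint mu (g k) ->
  sqint mu (dcutr M u g k).
Proof.
move=> M1 [mu' ui] [mg gi]; have M0 : 0 < M by exact: lt_le_trans M1.
have c0 : 0 <= M ^- 2 by rewrite invr_ge0 sqr_ge0.
have mT : measurable_fun setT (fun x => trunc (M ^- 2) (u x)).
  by apply: (measurableT_comp _ mu'); apply: continuous_measurable_fun; exact: continuous_trunc.
have mdT : measurable_fun setT (fun x => dtrunc (M ^- 2) (u x)).
  by apply: (measurableT_comp _ mu'); apply: continuous_measurable_fun; exact: continuous_dtrunc.
apply: sqint_le (fun x => dcutr_sqr_le u g k x M1) _.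
  apply: measurable_funD; apply: measurable_funM => //; apply: measurable_funM => //.
    exact: measurable_chi0.
  exact: measurable_chi0.
rewrite (_ : _ \o _ = (fun x => (1 + C / M)%:E * (g k x ^+ 2)%:E +
    ((C + C ^+ 2) / M)%:E * (u x ^+ 2)%:E)%E)//.
by apply: integrableD => //; exact: integrableZl.
Qed.

Lemma isgrad_cutr M u g : 1 <= M -> isgrad u g -> isgrad (cutr M u) (dcutr M u g).
Proof.
move=> M1 hug; have [su hg] := hug; have M0 : 0 < M by exact: lt_le_trans M1.
have c0 : 0 <= M ^- 2 by rewrite invr_ge0 sqr_ge0.
have c1 (k : 'I_n.+1) y (f : R -> R) : continuous f ->
    continuous (fun p : R * R => f (ins k p.1 y ord0 ord0 / M)).
  move=> cf p.
  apply: (@continuous_comp _ _ _ fst (fun t => f (ins k t y ord0 ord0 / M))).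
    exact: cvg_fst.
  apply: (@continuous_comp _ _ _ (fun t => ins k t y ord0 ord0 / M) f); last exact: cf.
  apply: cvgM; last exact: cvg_cst.
  exact: is_derive1_continuous (is_derive_ins0 k y _).
have c2 (f : R -> R) : continuous f -> continuous (fun p : R * R => f p.2).
  by move=> cf p; apply: (@continuous_comp _ _ _ snd f); [exact: cvg_snd|exact: cf].
apply: (isgrad_chain (F := fun x r => chi (x ord0 ord0 / M) * trunc (M ^- 2) r)
  (G := fun k x r => dchi (x ord0 ord0 / M) * ((k == ord0)%:R / M) * trunc (M ^- 2) r)
  (H := fun x r => chi (x ord0 ord0 / M) * dtrunc (M ^- 2) r) hug).
- exact: sqint_cutr.
- by move=> k; have [sg _] := hg k; exact: sqint_dcutr.
- by move=> k y p; apply: cvgM; [exact: c1|apply: c2; exact: continuous_trunc].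
- move=> k y p; apply: cvgM; last by apply: c2; exact: continuous_trunc.
  by apply: cvgM; [exact: c1|exact: cvg_cst].
- by move=> k y p; apply: cvgM; [exact: c1|apply: c2; exact: continuous_dtrunc].
move=> k y r r' t dr.
have d1 := is_derive1M (is_derive_ins0 k y t) (is_derive1_cst M^-1 t).
have d2 := is_derive1_compf (g := fun s => ins k s y ord0 ord0 / M) (dchiE _) d1.
have d3 := is_derive1_compf (is_derive_trunc (r t) c0) dr.
by apply: (is_derive1_eq (is_derive1M d2 d3)); ring.
Qed.

(** The errors in u^2, one for each of the n + 1 directions, are absorbed by the zeroth-order term
    of the energy, which explains the division by [lam]. *)
Lemma energy_cutr_le lam M u g : 0 < lam -> 1 <= M -> isgrad u g ->
  energy lam (cutr M u) (dcutr M u g) <=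
  (1 + (C + n.+1%:R * (C + C ^+ 2) / lam) / M) * energy lam u g.
Proof.
move=> lam0 M1 hug; have [su hg] := hug; have M0 : 0 < M by exact: lt_le_trans M1.
have [sw hdw] := isgrad_cutr M1 hug.
have ie : mu.-integrable setT (EFin \o (fun x => (\sum_k g k x ^+ 2) + lam * u x ^+ 2)).
  by apply: integrable_energy => // k; have [] := hg k.
rewrite /energy -RintegralZl//; apply: le_Rintegral => //.
- by apply: integrable_energy => // k; have [] := hdw k.
- exact: (integrableZl measurableT _ ie).
move=> x _.
have S : \sum_k dcutr M u g k x ^+ 2 <=
    (1 + C / M) * (\sum_k g k x ^+ 2) + n.+1%:R * ((C + C ^+ 2) / M * u x ^+ 2).
  apply: (@le_trans _ _ (\sum_k ((1 + C / M) * g k x ^+ 2 + (C + C ^+ 2) / M * u x ^+ 2))).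
    by apply: ler_sum => k _; exact: dcutr_sqr_le.
  by rewrite big_split /= -mulr_sumr lerD2l sumr_const card_ord [leRHS]mulr_natl.
have W : lam * cutr M u x ^+ 2 <= lam * u x ^+ 2.
  rewrite ler_pM2l// -sqr_normE -(sqr_normE (u x)) lerXn2r ?nnegrE// norm_cutr_le//.
apply: (le_trans (lerD S W)).
set G := \sum_k _; set U := u x ^+ 2.
have G0 : 0 <= G by apply: sumr_ge0 => k _; exact: sqr_ge0.
have U0 : 0 <= U by exact: sqr_ge0.
rewrite -subr_ge0 (_ : _ - _ = n.+1%:R * (C + C ^+ 2) / lam / M * G + C / M * (lam * U)).
  have K0 : 0 <= n.+1%:R * (C + C ^+ 2).
    by apply: mulr_ge0 => //; apply: addr_ge0 => //; exact: sqr_ge0.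
  apply: addr_ge0; apply: mulr_ge0 => //.
  - exact: divr_ge0 (divr_ge0 K0 (ltW lam0)) (ltW M0).
  - exact: divr_ge0 (ltW M0).
  - exact: mulr_ge0 (ltW lam0) U0.
by field; rewrite !gt_eqF.
Qed.

End cut_and_truncate.

Section competitors.
Context {R : realType} {n d m : nat}.
Variables (lam : 'I_d -> R) (beta : 'I_d -> 'I_d -> R).
Hypothesis lam0 : forall i, 0 < lam i.
Hypothesis beta_sym : forall i j, i != j -> beta i j = beta j i.
Variables (a : m.+1.-tuple nat) (b : 'I_d -> 'I_m).
Hypothesis ab : forall h i, (i \in block a h) = (b i == h).
Hypothesis beta_ge0 : forall i j, b i = b j -> 0 <= beta i j.
Implicit Types (x : 'rV[R]_n.+1) (u v w : 'I_d -> 'rV[R]_n.+1 -> R) (g : 'I_d -> 'I_n.+1 -> 'rV[R]_n.+1 -> R).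
Local Notation mu := (@lebesgue_rV R n.+1).

Definition blockc (h : 'I_m) (i j : 'I_d) : R := beta i j *+ ((b i == h) && (b j == h)).

Lemma blockc_ge0 h i j : 0 <= blockc h i j.
Proof.
rewrite /blockc; case: (boolP (_ && _)) => [/andP[/eqP bi /eqP bj]|_]; last by rewrite mulr0n.
by rewrite mulr1n beta_ge0// bi bj.
Qed.

Definition quartic (h : 'I_m) v x : R :=
  \sum_i \sum_j blockc h i j * (v i x ^+ 2 * v j x ^+ 2).

Lemma quartic_ge0 h v x : 0 <= quartic h v x.
Proof.
apply: sumr_ge0 => i _; apply: sumr_ge0 => j _; apply: mulr_ge0; first exact: blockc_ge0.
by apply: mulr_ge0; exact: sqr_ge0.
Qed.

Lemma measurable_quartic h v : (forall i, measurable_fun setT (v i)) ->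
  measurable_fun setT (quartic h v).
Proof.
move=> mv; apply: measurable_sum => i; apply: measurable_sum => j.
by apply: measurable_funM => //; exact: measurable_overlap.
Qed.

Lemma integral_quartic h v : (forall i, measurable_fun setT (v i)) ->
  (\int[mu]_x (quartic h v x)%:E =
   \sum_i \sum_j (blockc h i j)%:E * \int[mu]_x (v i x ^+ 2 * v j x ^+ 2)%:E)%E.
Proof.
move=> mv.
have mq i j : measurable_fun setT (fun x => (v i x ^+ 2 * v j x ^+ 2)%:E).
  by apply/measurable_EFinP; exact: measurable_overlap.
have q0 i j x : (0 <= (v i x ^+ 2 * v j x ^+ 2)%:E)%E.
  by rewrite lee_fin; apply: mulr_ge0; exact: sqr_ge0.
have b0 i j : (0 <= (blockc h i j)%:E)%E by rewrite lee_fin; exact: blockc_ge0.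
transitivity (\int[mu]_x (\sum_i \sum_j (blockc h i j)%:E * (v i x ^+ 2 * v j x ^+ 2)%:E))%E.
  apply: eq_integral => x _; rewrite /quartic -sumEFin; apply: eq_bigr => i _.
  by rewrite -sumEFin; apply: eq_bigr => j _; rewrite EFinM.
have mt i j : measurable_fun setT (fun x => (blockc h i j)%:E * (v i x ^+ 2 * v j x ^+ 2)%:E)%E.
  by apply: emeasurable_funM.
have t0 i j x : (0 <= (blockc h i j)%:E * (v i x ^+ 2 * v j x ^+ 2)%:E)%E.
  exact: mule_ge0.
rewrite ge0_integral_sum//; last 2 first.
- by move=> i; exact: emeasurable_sum.
- by move=> i x _; exact: sume_ge0.
apply: eq_bigr => i _; rewrite ge0_integral_sum//.
by apply: eq_bigr => j _; rewrite ge0_integralZl_EFin//; exact: blockc_ge0.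
Qed.

Lemma blockc_sum h (F : 'I_d -> 'I_d -> R) :
  \sum_i \sum_j blockc h i j * F i j =
  \sum_(i | b i == h) \sum_(j | b j == h) beta i j * F i j.
Proof.
rewrite [RHS]big_mkcond; apply: eq_bigr => i _; rewrite /blockc.
case: (b i == h); last by apply: big1 => j _; rewrite mulr0n mul0r.
rewrite [RHS]big_mkcond; apply: eq_bigr => j _.
by case: (b j == h); rewrite ?mulr1n ?mulr0n ?mul0r.
Qed.

Definition block_energy v g (h : 'I_m) : R :=
  \sum_(i | b i == h) energy (lam i) (v i) (g i).

Lemma block_energy_nrg v g h : (forall i, isgrad (v i) (g i)) ->
  block_nrg lam b v h = block_energy v g h.
Proof.
move=> hv; apply: eq_bigr => i _; apply: H1norm_energy; last exact: hv.
exact: ltW.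
Qed.

(* Translating the blocks along the first axis makes their supports disjoint, so
   that only the interactions inside each block remain and each block can be
   scaled onto the constraint separately. *)
Lemma separated_competitor w g (M : R) : 0 < M ->
  (forall i, isgrad (w i) (g i)) ->
  (forall i x, M <= `|x ord0 ord0| -> w i x = 0) ->
  (forall i j, mu.-integrable setT (fun x => (w i x ^+ 2 * w j x ^+ 2)%:E)) ->
  let B h := \sum_i \sum_j blockc h i j * overlap (w i) (w j) in
  (forall h, 0 < block_energy w g h) -> (forall h, 0 < B h) ->
  exists2 z : 'I_d -> 'rV[R]_n.+1 -> R, Nehari lam beta a z &
    J lam beta z = 4^-1 * \sum_h block_energy w g h ^+ 2 / B h.
Proof.
move=> M0 hw w0 wi B A0 B0.
(* Each component lives in the open slab |x_0| < M, so shifts by successive multiples of 2 M already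
   make the blocks disjoint. *)
pose s (h : 'I_m) : 'rV[R]_n.+1 := (2 * M * (h : nat)%:R) *: delta_mx ord0 ord0.
(* Scaling by t turns the constraint of a separated block into t^2 A = t^4 B, hence t^2 = A / B. *)
pose tau h := Num.sqrt (block_energy w g h / B h).
have tau2 h : tau h ^+ 2 = block_energy w g h / B h.
  by rewrite sqr_sqrtr// divr_ge0// ltW.
pose y i x := w i (x + s (b i)).
pose z i x := tau (b i) * y i x.
have hy i : isgrad (y i) (fun k x => g i k (x + s (b i))) by exact: isgrad_translate.
have Hy i : H1 (y i) by apply/H1P; eexists; exact: hy.
have Hz i : H1 (z i) by exact: H1Z.
have my i : measurable_fun setT (y i) by exact: H1_measurable.
have nrgy i : nrg lam y i = energy (lam i) (w i) (g i).
  by rewrite /nrg (H1norm_energy (ltW (lam0 i)) (hy i)) energy_translate.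
have nrgz i : nrg lam z i = tau (b i) ^+ 2 * energy (lam i) (w i) (g i).
  by rewrite -nrgy -(nrgZ lam0 (fun i => tau (b i)) (Hy i)).
have s0 x h : (x + s h) ord0 ord0 = x ord0 ord0 + 2 * M * (h : nat)%:R.
  by rewrite !mxE !eqxx mulr1.
have oy i j : overlap (y i) (y j) = overlap (w i) (w j) *+ (b i == b j).
  case: eqP => [bij|/eqP bij].
    rewrite mulr1n /overlap /y -bij.
    exact: (Rintegral_translate (s (b i)) (wi i j)).
  rewrite mulr0n /overlap (_ : (fun x => _) = cst 0).
    by rewrite /Rintegral integral0.
  apply/funext => x /=; rewrite /y.
  have [xi|xi] := leP M `|(x + s (b i)) ord0 ord0|.
    by rewrite (w0 i)// expr0n mul0r.
  have [xj|xj] := leP M `|(x + s (b j)) ord0 ord0|.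
    by rewrite (w0 j)// expr0n mulr0.
  exfalso; move: xi xj; rewrite !s0 !ltr_norml => /andP[i1 i2] /andP[j1 j2].
  have : (b i : nat) != b j by apply: contra bij => /eqP/val_inj ->.
  rewrite neq_ltn => /orP[lt|lt].
    have : (b i : nat)%:R + 1 <= (b j : nat)%:R :> R by rewrite natr1 ler_nat.
    by move=> h; nra.
  have : (b j : nat)%:R + 1 <= (b i : nat)%:R :> R by rewrite natr1 ler_nat.
  by move=> h; nra.
have oz i j : overlap (z i) (z j) =
    tau (b i) ^+ 2 * tau (b j) ^+ 2 * overlap (w i) (w j) *+ (b i == b j).
  by rewrite /z overlapZ// oy mulrnAr.
have Az h : block_nrg lam b z h = block_energy w g h ^+ 2 / B h.
  rewrite /block_nrg (eq_bigr (fun i => tau h ^+ 2 * energy (lam i) (w i) (g i))).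
    by rewrite -mulr_sumr tau2 -/(block_energy w g h) mulrAC expr2.
  by move=> i /eqP bi; rewrite nrgz bi.
have Mz : Nehari lam beta a z.
  apply/(NehariP lam0 beta_sym ab Hz) => h; rewrite Az; split.
    by rewrite divr_gt0// exprn_gt0.
  rewrite (_ : \sum_(i | _) _ = tau h ^+ 2 * tau h ^+ 2 * B h); last first.
    rewrite /B blockc_sum mulr_sumr; apply: eq_bigr => i /eqP bi.
    rewrite mulr_sumr [RHS]big_mkcond; apply: eq_bigr => j _; rewrite oz bi eq_sym.
    by case: eqP => [->|_]; rewrite ?mulr1n ?mulr0n ?mulr0// mulrCA.
  by rewrite tau2; field; rewrite gt_eqF.
exists z => //; rewrite (J_Nehari lam0 beta_sym ab Mz); congr (_ * _).
by apply: eq_bigr => h _; rewrite Az.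
Qed.

(** The bound on h^2 leaves M times the integral of f^2, which [lam'] compares with the energy. For
    truncated functions the overlaps are thus finite, and real and extended integrals agree. *)
Lemma overlap_le_energy lam' (f h : 'rV[R]_n.+1 -> R) (g : 'I_n.+1 -> 'rV[R]_n.+1 -> R) (M : R) :
  0 < lam' -> isgrad f g -> measurable_fun setT h -> (forall x, h x ^+ 2 <= M) ->
  mu.-integrable setT (fun x => (f x ^+ 2 * h x ^+ 2)%:E) /\
  overlap f h <= M / lam' * energy lam' f g.
Proof.
move=> l0 [sf hg] mh hM; have M0 : 0 <= M by apply: le_trans (hM 0); exact: sqr_ge0.
have ie : mu.-integrable setT (EFin \o (fun x => (\sum_k g k x ^+ 2) + lam' * f x ^+ 2)).
  by apply: integrable_energy => // k; have [] := hg k.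
have le x : f x ^+ 2 * h x ^+ 2 <= M / lam' * ((\sum_k g k x ^+ 2) + lam' * f x ^+ 2).
  rewrite mulrDr [M / _ * (_ * f x ^+ 2)]mulrA divfK ?gt_eqF//.
  have g0 : 0 <= \sum_k g k x ^+ 2 by apply: sumr_ge0 => k _; exact: sqr_ge0.
  have m0 : 0 <= M / lam' by rewrite divr_ge0// ltW.
  have := mulr_ge0 m0 g0; have := ler_wpM2l (sqr_ge0 (f x)) (hM x).
  by rewrite [_ * M]mulrC; lra.
have ie' : mu.-integrable setT (EFin \o (fun x => M / lam' * ((\sum_k g k x ^+ 2) + lam' * f x ^+ 2))).
  exact: (integrableZl measurableT _ ie).
have i1 : mu.-integrable setT (fun x => (f x ^+ 2 * h x ^+ 2)%:E).
  apply: (le_integrable _ _ _ ie') => //.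
    apply/measurable_EFinP; apply: measurable_overlap => //; by case: sf.
  move=> x _ /=; rewrite lee_fin ger0_norm; last by apply: mulr_ge0; exact: sqr_ge0.
  by apply: le_trans (le x) _; exact: ler_norm.
split => //; rewrite /overlap /energy -RintegralZl//.
by apply: le_Rintegral.
Qed.

(** [c h] is any positive real below the quartic integral, which may be infinite. For small e,
    cutting and truncating far enough gives energies at most 1 + e times those of [v] and, by Fatou,
    quartic integrals above (1 - e) c h; the separated competitor yields the bound up to the factor
    (1 + e)^2 / (1 - e). *)
Lemma competitor_bound (L : R) v g (c : 'I_m -> R) :
  (forall z : 'I_d -> 'rV[R]_n.+1 -> R, Nehari lam beta a z -> L <= J lam beta z) ->
  (forall i, isgrad (v i) (g i)) -> (forall h, 0 < c h) ->
  (forall h, (c h)%:E <= \int[mu]_x (quartic h v x)%:E)%E ->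
  L <= 4^-1 * \sum_h block_energy v g h ^+ 2 / c h.
Proof.
move=> hL hv c0 hc.
have mv i : measurable_fun setT (v i) by case: (hv i) => -[].
have [chi [dchi [C [C0 chi01 chi1 [dchiE cdchi dchiC chi0]]]]] := @cutoff_exists R.
pose K := \sum_i (C + n.+1%:R * (C + C ^+ 2) / lam i).
have Ki i : C + n.+1%:R * (C + C ^+ 2) / lam i <= K.
  rewrite /K (bigD1 i)//= lerDl; apply: sumr_ge0 => j _; apply: addr_ge0 => //.
  apply: divr_ge0; last exact: ltW.
  by apply: mulr_ge0 => //; apply: addr_ge0 => //; exact: sqr_ge0.
pose X := 4^-1 * \sum_h block_energy v g h ^+ 2 / c h.
have A0 h : 0 <= block_energy v g h.
  by apply: sumr_ge0 => i _; apply: energy_ge0; exact: ltW.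
have X0 : 0 <= X.
  apply: mulr_ge0; first by rewrite invr_ge0.
  by apply: sumr_ge0 => h _; apply: divr_ge0; [exact: sqr_ge0|exact: ltW].
have key (e : R) : 0 < e -> e < 1 -> L <= (1 + e) ^+ 2 / (1 - e) * X.
  move=> e0 e1.
  pose w (j : nat) i := cutr chi j.+1%:R (v i).
  pose dw (j : nat) i := dcutr chi dchi j.+1%:R (v i) (g i).
  have M1 (j : nat) : 1 <= j.+1%:R :> R by rewrite ler1n.
  have M0 (j : nat) : 0 < j.+1%:R :> R by rewrite ltr0n.
  have hw j i : isgrad (w j i) (dw j i) by apply: isgrad_cutr dchiC _ _ _ _ _ => //.
  have mw j i : measurable_fun setT (w j i) by case: (hw j i) => -[].
  have B_near h : \forall j \near \oo, (((1 - e) * c h)%:E < \int[mu]_x (quartic h (w j) x)%:E)%E.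
    apply: (@fatou_near _ _ _ mu (fun j => quartic h (w j)) (quartic h v)).
    - by move=> j; exact: measurable_quartic.
    - by move=> j x; exact: quartic_ge0.
    - move=> x.
      have sumcvg (F : 'I_d -> nat -> R) (l : 'I_d -> R) :
          (forall i, F i j @[j --> \oo] --> l i) -> \sum_i F i j @[j --> \oo] --> \sum_i l i.
        move=> hF; elim: (index_enum _) => [|i r IH].
          rewrite big_nil (_ : (fun j => _) = cst 0); first exact: cvg_cst.
          by apply/funext => j; rewrite big_nil.
        rewrite big_cons (_ : (fun j => _) = (fun j => F i j + \sum_(i <- r) F i j)).
          by apply: cvgD.
        by apply/funext => j; rewrite big_cons.
      have wv i : w j i x ^+ 2 @[j --> \oo] --> v i x ^+ 2.
        have h1 : w j i x @[j --> \oo] --> v i x by exact: (cvg_cutr chi1 dchiE).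
        by rewrite expr2; apply: cvgM.
      apply: (sumcvg (fun i j => \sum_k blockc h i k * (w j i x ^+ 2 * w j k x ^+ 2))
        (fun i => \sum_k blockc h i k * (v i x ^+ 2 * v k x ^+ 2))) => i.
      apply: (sumcvg (fun k j => blockc h i k * (w j i x ^+ 2 * w j k x ^+ 2))
        (fun k => blockc h i k * (v i x ^+ 2 * v k x ^+ 2))) => k.
      by apply: cvgM; [exact: cvg_cst|exact: cvgM].
    - by apply: lt_le_trans (hc h); rewrite lte_fin gtr_pMl// gtrBl.
  have Bn : \forall j \near \oo, forall h,
      (((1 - e) * c h)%:E < \int[mu]_x (quartic h (w j) x)%:E)%E.
    exact: filter_forall.
  have Kn : \forall j \near \oo, K / j.+1%:R <= e.
    have hK : K * j.+1%:R^-1 @[j --> \oo] --> K * 0.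
      by apply: cvgM; [exact: cvg_cst|exact: cvg_harmonic].
    rewrite mulr0 in hK.
    have /cvgrPdist_le/(_ _ e0) := hK.
    by apply: filterS => j; rewrite sub0r normrN; apply: le_trans; exact: ler_norm.
  have [j [Bj Kj]] : exists j, (forall h,
      (((1 - e) * c h)%:E < \int[mu]_x (quartic h (w j) x)%:E)%E) /\ K / j.+1%:R <= e.
    have [N _ hN] := filterI Bn Kn.
    by exists N; have [] := hN N (leqnn N).
  have wM i x : w j i x ^+ 2 <= j.+1%:R ^+ 2 by exact: cutr_sqr_le.
  have wi i k := (overlap_le_energy (lam0 i) (hw j i) (mw j k) (wM k)).1.
  have wle i k := (overlap_le_energy (lam0 i) (hw j i) (mw j k) (wM k)).2.
  pose B h := \sum_i \sum_k blockc h i k * overlap (w j i) (w j k).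
  have BE h : (\int[mu]_x (quartic h (w j) x)%:E = (B h)%:E)%E.
    rewrite integral_quartic// /B -sumEFin; apply: eq_bigr => i _.
    rewrite -sumEFin; apply: eq_bigr => k _.
    rewrite EFinM /overlap /Rintegral fineK//; exact: integrable_fin_num.
  have Bc h : (1 - e) * c h < B h by rewrite -lte_fin -BE.
  have e1' : 0 < 1 - e by rewrite subr_gt0.
  have B0 h : 0 < B h by apply: lt_trans (Bc h); exact: mulr_gt0.
  (* A block of zero energy would have zero overlaps, against the positivity of [B h]. *)
  have Aw0 h : 0 < block_energy (w j) (dw j) h.
    rewrite lt_neqAle; apply/andP; split; last first.
      by apply: sumr_ge0 => i _; apply: energy_ge0; exact: ltW.
    apply/negP => /eqP/esym/eqP; rewrite psumr_eq0; last first.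
      by move=> i _; apply: energy_ge0; exact: ltW.
    move=> /allP hA; have := B0 h; rewrite /B blockc_sum big1 ?ltxx// => i bi.
    have ei : energy (lam i) (w j i) (dw j i) = 0.
      by apply/eqP; have := hA i (mem_index_enum _); rewrite bi.
    apply: big1 => k _; rewrite (_ : overlap _ _ = 0) ?mulr0//.
    apply/eqP; rewrite eq_le overlap_ge0 andbT.
    by have := wle i k; rewrite ei mulr0.
  have [z Mz Jz] := separated_competitor (M0 j) (hw j)
    (fun i x => cutr_out chi0 (v i) (M0 j)) wi Aw0 B0.
  apply: le_trans (hL z Mz) _; rewrite Jz mulrCA ler_wpM2l ?invr_ge0//.
  rewrite mulr_sumr; apply: ler_sum => h _.
  have Ah : block_energy (w j) (dw j) h <= (1 + e) * block_energy v g h.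
    rewrite /block_energy mulr_sumr; apply: ler_sum => i _.
    apply: le_trans (energy_cutr_le C0 chi01 dchiE cdchi dchiC (lam0 i) (M1 j) (hv i)) _.
    apply: ler_wpM2r; first by apply: energy_ge0; exact: ltW.
    rewrite lerD2l; apply: le_trans Kj; rewrite ler_wpM2r ?invr_ge0//.
  rewrite (_ : _ * (_ / c h) = ((1 + e) * block_energy v g h) ^+ 2 / ((1 - e) * c h)); last first.
    by field; rewrite !gt_eqF.
  apply: ler_pM.
  - exact: sqr_ge0.
  - by rewrite invr_ge0; exact: (ltW (B0 h)).
  - rewrite lerXn2r// ?nnegrE; first exact: ltW.
    by apply: mulr_ge0 => //; rewrite addr_ge0// ltW.
  - rewrite lef_pV2 ?posrE; [exact: (ltW (Bc h))|exact: (B0 h)|exact: mulr_gt0].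
apply/ler_addgt0Pr => e e0; rewrite -/X.
(* For f <= 1/4 the factor (1 + f)^2 / (1 - f) is at most 1 + 8 f, and the second bound makes 8 f X
   at most e; X + 1 avoids a division by 0. *)
pose f := Num.min 4^-1 (e / (8 * (X + 1))).
have X1 : 0 < X + 1 by rewrite ltr_wpDl.
have f0 : 0 < f by rewrite lt_min invr_gt0 ltr0n /= divr_gt0// mulr_gt0.
have f1 : f <= 4^-1 by rewrite ge_min lexx.
have f2 : f <= e / (8 * (X + 1)) by rewrite ge_min lexx orbT.
have f3 : 8 * f * X <= e.
  have : f * (8 * (X + 1)) <= e by rewrite -ler_pdivlMr// mulr_gt0.
  by have := mulr_ge0 (ltW f0) X0; nra.
have f4 : f < 1 by lra.
apply: le_trans (key f f0 f4) _.
have : (1 + f) ^+ 2 / (1 - f) <= 1 + 8 * f.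
  rewrite ler_pdivrMr; last lra.
  by nra.
by move=> /(ler_wpM2r X0); lra.
Qed.

End competitors.

(** * Perturbation of one component *)

Lemma measurable_inv_gt0 d (T : measurableType d) (R : realType) (f : T -> R) :
  measurable_fun setT f -> (forall x, 0 < f x) -> measurable_fun setT (fun x => (f x)^-1).
Proof.
move=> mf f0; rewrite (_ : (fun x => _) = (fun x => expR (- ln (f x)))).
  by apply: measurableT_comp => //; apply: measurableT_comp => //; exact: measurableT_comp.
by apply/funext => x; rewrite expRN lnK// posrE.
Qed.

(** * A positive weight with bounded logarithmic derivatives *)

Section weight.
Context {R : realType}.
Local Notation mu1 := (@lebesgue_measure R).

(** The profile 1 / (1 + t^2) is positive, integrable, and has a logarithmic derivative [dlog]
    bounded by 1. The product over the coordinates inherits these properties in every direction. *)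
Definition decay (t : R) : R := (oneDsqr t)^-1.
Definition dlog (t : R) : R := - (2 * t * decay t).

Lemma decay_gt0 t : 0 < decay t.
Proof. by rewrite invr_gt0. Qed.

Lemma decay_le1 t : decay t <= 1.
Proof. exact: oneDsqrV_le1. Qed.

Lemma continuous_decay : continuous decay.
Proof. exact: continuous_oneDsqrV. Qed.

Lemma continuous_dlog : continuous dlog.
Proof.
move=> t; apply: cvgN; apply: cvgM; last exact: continuous_decay.
by apply: cvgM; [exact: cvg_cst|exact: cvg_id].
Qed.

Lemma is_derive_decay (t : R) : is_derive t 1 decay (dlog t * decay t).
Proof.
have h1 := is_derive1M (is_derive1_idf t) (is_derive1_idf t).
have h2 := is_derive1D (is_derive1_cst 1 t) h1.
have t0 : 1 + t * t != 0 by rewrite -expr2 gt_eqF // ltr_wpDr ?sqr_ge0.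
have := is_derive1_compf (g := fun t => 1 + t * t) (is_derive1_inv t0) h2.
move=> h; apply: (is_derive1_eq h); rewrite /dlog /decay /oneDsqr expr2.
by field.
Qed.

Lemma norm_dlog_le1 t : `|dlog t| <= 1.
Proof.
rewrite /dlog normrN /decay normrM normfV [`|oneDsqr t|]ger0_norm//.
rewrite ler_pdivrMr// mul1r /oneDsqr ler_norml.
by have := sqr_ge0 (t - 1); have := sqr_ge0 (t + 1); rewrite sqrrB sqrrD => h1 h2; apply/andP; split; lra.
Qed.

Lemma integral_decay : (\int[mu1]_t (decay t)%:E < +oo)%E.
Proof.
rewrite ge0_symfun_integralT.
- rewrite (_ : [set x | 0 <= x] = `[0, +oo[%classic); last first.
    by apply/seteqP; split => x /=; rewrite in_itv/= ?andbT.
  by rewrite integral0y_oneDsqr ltry.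
- by move=> t; rewrite ltW// decay_gt0.
- exact: continuous_decay.
- by move=> t; rewrite /= /decay /oneDsqr sqrrN.
Qed.

Definition weight {n} : 'rV[R]_n -> R := prodfun (fun _ => decay).

Lemma weight_gt0 n (x : 'rV[R]_n) : 0 < weight x.
Proof. by apply: prodr_gt0 => i _; exact: decay_gt0. Qed.

Lemma weight_le1 n (x : 'rV[R]_n) : weight x <= 1.
Proof. by apply: prodr_ile1 => i _; rewrite decay_le1 ltW// decay_gt0. Qed.

Lemma continuous_weight n : continuous (@weight n).
Proof. by apply: continuous_prodfun => _; exact: continuous_decay. Qed.

Lemma weight_ins n k t (y : 'rV[R]_n) : weight (ins k t y) = decay t * weight y.
Proof. exact: prodfun_ins. Qed.

Lemma integral_weight n : (\int[@lebesgue_rV R n]_x (weight x)%:E < +oo)%E.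
Proof.
elim: n => [|n IH].
  rewrite /= integral_dirac//; last first.
    by apply/measurable_EFinP; apply: continuous_measurable_rV; exact: continuous_weight.
  by rewrite diracT mul1e ltry.
rewrite (ge0_integral_insp ord0).
- rewrite (eq_integral (fun y => (\int[mu1]_t (decay t)%:E) * (weight y)%:E)%E); last first.
    move=> y _; under eq_integral do rewrite weight_ins EFinM muleC.
    rewrite ge0_integralZl_EFin//.
    + by rewrite muleC.
    + by move=> t _; rewrite lee_fin ltW// decay_gt0.
    + by apply/measurable_EFinP; apply: continuous_measurable_fun; exact: continuous_decay.
    + by rewrite ltW// weight_gt0.
  rewrite ge0_integralZl//.
  + apply: lte_mul_pinfty => //.
      by apply: integral_ge0 => t _; rewrite lee_fin ltW// decay_gt0.
    rewrite ge0_fin_numE; first exact: integral_decay.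
    by apply: integral_ge0 => t _; rewrite lee_fin ltW// decay_gt0.
  + by apply/measurable_EFinP; apply: continuous_measurable_rV; exact: continuous_weight.
  + by move=> x _; rewrite lee_fin ltW// weight_gt0.
  + by apply: integral_ge0 => t _; rewrite lee_fin ltW// decay_gt0.
- by apply/measurable_EFinP; apply: continuous_measurable_rV; exact: continuous_weight.
- by move=> x; rewrite lee_fin ltW// weight_gt0.
Qed.

Lemma sqint_weight n : sqint (@lebesgue_rV R n) weight.
Proof.
have mw : measurable_fun setT (@weight n).
  by apply: continuous_measurable_rV; exact: continuous_weight.
apply: (sqint_le (h := weight)) => //.
  by move=> x; rewrite expr2 ler_piMl ?weight_le1// ltW// weight_gt0.
apply/integrableP; split; first exact/measurable_EFinP.
under eq_integral do rewrite /= ger0_norm ?ltW ?weight_gt0//.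
exact: integral_weight.
Qed.

End weight.

(** * The energy of the perturbed component *)

Section perturbation.
Context {R : realType} {n : nat}.
Implicit Types (u : 'rV[R]_n.+1 -> R) (g : 'I_n.+1 -> 'rV[R]_n.+1 -> R) (x : 'rV[R]_n.+1) (s : R).
Local Notation mu := (@lebesgue_rV R n.+1).

Definition psq u s x : R := u x ^+ 2 + s * weight x ^+ 2.

Definition perturb u s x : R := Num.sqrt (psq u s x).

Definition dperturb u g s (k : 'I_n.+1) x : R :=
  s * weight x ^+ 2 * dlog (x ord0 k) / perturb u s x + u x / perturb u s x * g k x.

(** The numerator is the square of w grad u - u grad w, because [dlog] times the weight is the
    derivative of the weight. It measures how far u is from a multiple of w. *)
Definition defect u g s x : R :=
  (\sum_k (weight x * (g k x - dlog (x ord0 k) * u x)) ^+ 2) / psq u s x.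

Lemma psq_gt0 u s x : 0 < s -> 0 < psq u s x.
Proof. by move=> s0; rewrite /psq ltr_wpDl ?sqr_ge0// mulr_gt0// exprn_gt0// weight_gt0. Qed.

Lemma perturb_gt0 u s x : 0 < s -> 0 < perturb u s x.
Proof. by move=> s0; rewrite sqrtr_gt0 psq_gt0. Qed.

Lemma perturb_sqr u s x : 0 < s -> perturb u s x ^+ 2 = psq u s x.
Proof. by move=> s0; rewrite sqr_sqrtr// ltW// psq_gt0. Qed.

(** Lagrange's identity for the vectors (u, s^(1/2) w) and (g, s^(1/2) w p), with p the logarithmic
    derivative of w, divided by u^2 + s w^2. *)
Lemma dperturb_sqr u g s k x : 0 < s ->
  dperturb u g s k x ^+ 2 = g k x ^+ 2 + s * (dlog (x ord0 k) * weight x) ^+ 2 -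
    s * ((weight x * (g k x - dlog (x ord0 k) * u x)) ^+ 2 / psq u s x).
Proof.
move=> s0; have p0 := perturb_gt0 u x s0.
rewrite (_ : dperturb u g s k x ^+ 2 =
    (s * weight x ^+ 2 * dlog (x ord0 k) + u x * g k x) ^+ 2 / perturb u s x ^+ 2); last first.
  by rewrite /dperturb; field; rewrite gt_eqF.
rewrite perturb_sqr//; have := psq_gt0 u x s0; rewrite /psq => q0.
by field; rewrite gt_eqF.
Qed.

Lemma measurable_dlog (k : 'I_n.+1) : measurable_fun setT (fun x => dlog (x ord0 k)).
Proof.
have mf : measurable_fun setT (@dlog R).
  by apply: continuous_measurable_fun; exact: continuous_dlog.
by apply: (measurableT_comp mf); exact: measurable_coord.
Qed.

Lemma measurable_weight : measurable_fun setT (@weight R n.+1).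
Proof. by have [] := @sqint_weight R n.+1. Qed.

Lemma measurable_psq u s : measurable_fun setT u -> measurable_fun setT (psq u s).
Proof.
move=> mu'; apply: measurable_funD; first exact: measurable_funX.
by apply: measurable_funM => //; apply: measurable_funX; exact: measurable_weight.
Qed.

Lemma measurable_perturb u s : measurable_fun setT u -> measurable_fun setT (perturb u s).
Proof.
move=> mu'; have ms : measurable_fun setT (@Num.sqrt R).
  by apply: continuous_measurable_fun; exact: sqrt_continuous.
by apply: (measurableT_comp ms); exact: measurable_psq.
Qed.

Lemma measurable_defect_term u g s k : 0 < s -> measurable_fun setT u -> measurable_fun setT (g k) ->
  measurable_fun setT (fun x => (weight x * (g k x - dlog (x ord0 k) * u x)) ^+ 2 / psq u s x).
Proof.
move=> s0 mu' mg; apply: measurable_funM; last first.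
  by apply: measurable_inv_gt0 => [|x]; [exact: measurable_psq|exact: psq_gt0].
apply: measurable_funX; apply: measurable_funM; first exact: measurable_weight.
by apply: measurable_funB => //; apply: measurable_funM => //; exact: measurable_dlog.
Qed.

Lemma defectE u g s x : defect u g s x =
  \sum_k (weight x * (g k x - dlog (x ord0 k) * u x)) ^+ 2 / psq u s x.
Proof. by rewrite /defect mulr_suml. Qed.

Lemma measurable_defect u g s : 0 < s -> measurable_fun setT u ->
  (forall k, measurable_fun setT (g k)) -> measurable_fun setT (defect u g s).
Proof.
move=> s0 mu' mg; rewrite (_ : defect u g s = (fun x =>
    \sum_k (weight x * (g k x - dlog (x ord0 k) * u x)) ^+ 2 / psq u s x)).
  by apply: measurable_sum => k; exact: measurable_defect_term.
by apply/funext => x; exact: defectE.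
Qed.

Lemma sqint_perturb u s : 0 < s -> sqint mu u -> sqint mu (perturb u s).
Proof.
move=> s0 [mu' ui]; have [mw wi] := sqint_weight (R := R) n.+1.
apply: (sqint_le (h := psq u s)); first exact: measurable_perturb.
  by move=> x; rewrite perturb_sqr.
rewrite (_ : _ \o _ = (fun x => (u x ^+ 2)%:E + s%:E * (weight x ^+ 2)%:E)%E)//.
by apply: integrableD => //; exact: integrableZl.
Qed.

Lemma sqint_dperturb u g s k : 0 < s -> measurable_fun setT u -> sqint mu (g k) ->
  sqint mu (dperturb u g s k).
Proof.
move=> s0 mu' [mg gi]; have [mw wi] := sqint_weight (R := R) n.+1.
have mv : measurable_fun setT (fun x => (perturb u s x)^-1).
  by apply: measurable_inv_gt0 => [|x]; [exact: measurable_perturb|exact: perturb_gt0].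
apply: (sqint_le (h := fun x => g k x ^+ 2 + s * weight x ^+ 2)).
- apply: measurable_funD; last by apply: measurable_funM => //; exact: measurable_funM.
  apply: measurable_funM => //; apply: measurable_funM; last exact: measurable_dlog.
  by apply: measurable_funM => //; exact: measurable_funX.
- move=> x; rewrite dperturb_sqr// -addrA lerD2l.
  have d0 : 0 <= (weight x * (g k x - dlog (x ord0 k) * u x)) ^+ 2 / psq u s x.
    by apply: divr_ge0; [exact: sqr_ge0|rewrite ltW// psq_gt0].
  have d1 : (dlog (x ord0 k) * weight x) ^+ 2 <= weight x ^+ 2.
    by rewrite exprMn ler_piMl ?sqr_ge0// -sqr_normE expr_le1// norm_dlog_le1.
  by have := mulr_ge0 (ltW s0) d0; have := ler_wpM2l (ltW s0) d1; lra.
rewrite (_ : _ \o _ = (fun x => (g k x ^+ 2)%:E + s%:E * (weight x ^+ 2)%:E)%E)//.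
by apply: integrableD => //; exact: integrableZl.
Qed.

Lemma isgrad_perturb u g s : 0 < s -> isgrad u g -> isgrad (perturb u s) (dperturb u g s).
Proof.
move=> s0 hug; have [su hg] := hug; have [mu' _] := su.
pose D (x : 'rV[R]_n.+1) (r : R) : R := r ^+ 2 + s * weight x ^+ 2.
have D0 x r : 0 < D x r by rewrite /D ltr_wpDl ?sqr_ge0// mulr_gt0// exprn_gt0// weight_gt0.
have cw (k : 'I_n.+1) y : continuous (fun p : R * R => weight (ins k p.1 y)).
  move=> p; rewrite (_ : (fun _ => _) = (fun p : R * R => decay p.1 * weight y)); last first.
    by apply/funext => q; rewrite weight_ins.
  apply: cvgM; last exact: cvg_cst.
  by apply: (@continuous_comp _ _ _ fst decay); [exact: cvg_fst|exact: continuous_decay].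
have cw2 (k : 'I_n.+1) y : continuous (fun p : R * R => s * weight (ins k p.1 y) ^+ 2).
  by move=> p; apply: cvgM; [exact: cvg_cst|rewrite expr2; apply: cvgM; exact: cw].
have cF (k : 'I_n.+1) y : continuous (fun p : R * R => Num.sqrt (D (ins k p.1 y) p.2)).
  move=> p; apply: (@continuous_comp _ _ _ (fun p : R * R => D (ins k p.1 y) p.2) Num.sqrt); last exact: sqrt_continuous.
  by apply: cvgD; [rewrite expr2; apply: cvgM; exact: cvg_snd|exact: cw2].
have cFV (k : 'I_n.+1) y : continuous (fun p : R * R => (Num.sqrt (D (ins k p.1 y) p.2))^-1).
  by move=> p; apply: cvgV; [rewrite gt_eqF// sqrtr_gt0|exact: cF].
apply: (isgrad_chain (F := fun x r => Num.sqrt (D x r))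
  (G := fun k x r => s * weight x ^+ 2 * dlog (x ord0 k) / Num.sqrt (D x r))
  (H := fun x r => r / Num.sqrt (D x r)) hug).
- exact: sqint_perturb.
- by move=> k; have [sg _] := hg k; exact: sqint_dperturb.
- exact: cF.
- move=> k y p; apply: cvgM; last exact: cFV.
  apply: cvgM; first exact: cw2.
  rewrite (_ : (fun _ => _) = (fun p : R * R => dlog p.1)); last first.
    by apply/funext => q; rewrite ins_at.
  rewrite ins_at.
  by apply: (@continuous_comp _ _ _ fst dlog); [exact: cvg_fst|exact: continuous_dlog].
- by move=> k y p; apply: cvgM; [exact: cvg_snd|exact: cFV].
move=> k y r r' t dr.
have dw : is_derive t 1 (fun q => weight (ins k q y)) (dlog t * weight (ins k t y)).
  rewrite weight_ins mulrA (_ : (fun q => _) = (fun q => decay q * weight y)); last first.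
    by apply/funext => q; rewrite weight_ins.
  by apply: (is_derive1_eq (is_derive1M (is_derive_decay t) (is_derive1_cst (weight y) t))); rewrite mulr0 addr0.
have d1 := is_derive1D (is_derive1M dr dr)
  (is_derive1M (is_derive1_cst s t) (is_derive1M dw dw)).
have d2 := is_derive1_compf (g := fun q => D (ins k q y) (r q)) (is_derive1_sqrt (D0 (ins k t y) (r t))) d1.
apply: (is_derive1_eq d2); rewrite ins_at.
have : Num.sqrt (D (ins k t y) (r t)) != 0 by rewrite gt_eqF// sqrtr_gt0.
by move=> h; field.
Qed.

(* The energy of [perturb u s] is [energy lam u g + s * energy lam weight _] minus
   [s] times the integral of the defect: pointwise, [g^2 + s w^2 p^2 - (s w^2 p + u g)^2 / (u^2 + s w^2)]
   is [s w^2 (g - p u)^2 / (u^2 + s w^2)]. *)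
Lemma defect_le u g s lam : 0 < s -> 0 < lam -> isgrad u g ->
  energy lam u g <= energy lam (perturb u s) (dperturb u g s) ->
  (\int[mu]_x (defect u g s x)%:E <=
   (energy lam weight (fun k x => dlog (x ord0 k) * weight x))%:E)%E.
Proof.
move=> s0 lam0 hug uv; have [su hg] := hug; have [mu' _] := su.
have sg k : sqint mu (g k) by case: (hg k).
have sv := sqint_perturb s0 su.
have sdv k := sqint_dperturb s0 mu' (sg k).
have sw := sqint_weight (R := R) n.+1.
have sdw (k : 'I_n.+1) : sqint mu (fun x => dlog (x ord0 k) * weight x).
  by apply: (sqint_bounded (C := 1)) => //; [exact: measurable_dlog|move=> x; exact: norm_dlog_le1].
have iu := integrable_energy lam su sg.
have iv := integrable_energy lam sv sdv.
have iw := integrable_energy lam sw sdw.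
have sE x : s * defect u g s x = (((\sum_k g k x ^+ 2) + lam * u x ^+ 2) +
    s * ((\sum_k (dlog (x ord0 k) * weight x) ^+ 2) + lam * weight x ^+ 2)) -
    ((\sum_k dperturb u g s k x ^+ 2) + lam * perturb u s x ^+ 2).
  rewrite (eq_bigr (fun k => _ : R) (fun k _ => dperturb_sqr u g k x s0)).
  rewrite sumrB big_split /= -!mulr_sumr perturb_sqr// -defectE /psq; ring.
have isd : mu.-integrable setT (EFin \o (fun x => s * defect u g s x)).
  rewrite (_ : _ \o _ = ((fun x => (((\sum_k g k x ^+ 2) + lam * u x ^+ 2)%:E +
    s%:E * ((\sum_k (dlog (x ord0 k) * weight x) ^+ 2) + lam * weight x ^+ 2)%:E) -
    ((\sum_k dperturb u g s k x ^+ 2) + lam * perturb u s x ^+ 2)%:E)%E)); last first.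
    by apply/funext => x /=; rewrite sE.
  apply: integrableB => //; apply: integrableD => //.
  exact: (integrableZl measurableT _ iw).
have id : mu.-integrable setT (EFin \o (defect u g s)).
  rewrite (_ : _ \o _ = (fun x => s^-1%:E * (s * defect u g s x)%:E)%E).
    exact: (integrableZl measurableT _ isd).
  by apply/funext => x /=; rewrite -EFinM mulKf// gt_eqF.
have : s * \int[mu]_x defect u g s x = energy lam u g +
    s * energy lam weight (fun k x => dlog (x ord0 k) * weight x) -
    energy lam (perturb u s) (dperturb u g s).
  rewrite -RintegralZl// /energy -[s * \int[mu]_x (_ + lam * weight x ^+ 2)]RintegralZl//.
  rewrite -RintegralD//; last exact: (integrableZl measurableT _ iw).
  rewrite -RintegralB//; last first.
    exact: (integrableD measurableT iu (integrableZl measurableT s iw)).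
  by apply: eq_Rintegral => x _; rewrite sE.
move=> E; have {}E : \int[mu]_x defect u g s x <= energy lam weight (fun k x => dlog (x ord0 k) * weight x).
  by rewrite -(ler_pM2l s0) E; lra.
have := E; rewrite -lee_fin /Rintegral fineK//.
exact: (integrable_fin_num measurableT id).
Qed.

End perturbation.

(** * Zeros on lines *)

Section line_alternative.
Context {R : realType}.
Local Notation mu1 := (@lebesgue_measure R).

(** The term of [defect] in one direction, restricted to a line: the weight there is [decay t] times
    the weight [W] of the other coordinates. *)
Definition ldefect (W : R) (w p : R -> R) (s t : R) : R :=
  ((decay t * W) * (p t - dlog t * w t)) ^+ 2 / (w t ^+ 2 + s * (decay t * W) ^+ 2).

Lemma ldefect_ge0 (W : R) w p s t : 0 <= s -> 0 <= ldefect W w p s t.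
Proof.
move=> s0; rewrite /ldefect divr_ge0 ?sqr_ge0//.
by apply: addr_ge0; [exact: sqr_ge0|apply: mulr_ge0 => //; exact: sqr_ge0].
Qed.

Lemma measurable_ldefect (W : R) (w p : R -> R) s : 0 < W -> 0 < s ->
  measurable_fun (@setT (measurableTypeR R)) w -> measurable_fun (@setT (measurableTypeR R)) p ->
  measurable_fun (@setT (measurableTypeR R)) (ldefect W w p s).
Proof.
move=> W0 s0 mw mp.
have md : measurable_fun (@setT (measurableTypeR R)) (fun t : R => decay t * W).
  apply: measurable_funM => //; apply: continuous_measurable_fun; exact: continuous_decay.
have ml : measurable_fun (@setT (measurableTypeR R)) (@dlog R).
  by apply: continuous_measurable_fun; exact: continuous_dlog.
apply: measurable_funM.
  apply: measurable_funX; apply: measurable_funM => //.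
  by apply: measurable_funB => //; exact: measurable_funM.
apply: measurable_inv_gt0 => [|t].
  by apply: measurable_funD; [exact: measurable_funX|apply: measurable_funM => //; exact: measurable_funX].
by rewrite ltr_wpDl ?sqr_ge0// mulr_gt0// exprn_gt0// mulr_gt0// decay_gt0.
Qed.

(** Write phi for decay times W and z for p - dlog w. The logarithm has derivative 2 dlog + 2 w z /
    (w^2 + s phi^2). The first term is at most 2 in absolute value, and 2 |w z| <= w^2 + z^2 bounds
    the second by 1 plus a multiple of [ldefect]; hence the 3, and no dependence on [s] in the
    bound. *)
Lemma ln_oscillation (W : R) (w p : R -> R) (a b K s : R) : 0 < W -> 0 < s -> a <= b ->
  primitive p w -> measurable_fun (@setT (measurableTypeR R)) p ->
  (\int[mu1]_t (ldefect W w p s t)%:E <= K%:E)%E ->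
  `|ln (w b ^+ 2 + s * (decay b * W) ^+ 2) - ln (w a ^+ 2 + s * (decay a * W) ^+ 2)| <=
  3 * (b - a) + ((1 + a ^+ 2 + b ^+ 2) / W) ^+ 2 * K.
Proof.
move=> W0 s0 ab pw mp hK.
pose D (t r : R) : R := r ^+ 2 + s * (decay t * W) ^+ 2.
have D0 t r : 0 < D t r.
  by rewrite /D ltr_wpDl ?sqr_ge0// mulr_gt0// exprn_gt0// mulr_gt0// decay_gt0.
have cw : continuous w by exact: primitive_continuous pw.
have mw : measurable_fun (@setT (measurableTypeR R)) w by exact: continuous_measurable_fun.
have cphi : continuous (fun q : R * R => s * (decay q.1 * W) ^+ 2).
  move=> q; apply: cvgM; first exact: cvg_cst.
  have h : (fun q : R * R => decay q.1 * W) x @[x --> q] --> decay q.1 * W.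
    apply: cvgM; last exact: cvg_cst.
    by apply: (@continuous_comp _ _ _ fst decay); [exact: cvg_fst|exact: continuous_decay].
  by rewrite expr2; exact: cvgM.
have cD : continuous (fun q : R * R => D q.1 q.2).
  by move=> q; apply: cvgD; [rewrite expr2; apply: cvgM; exact: cvg_snd|exact: cphi].
have cDV : continuous (fun q : R * R => (D q.1 q.2)^-1).
  by move=> q; apply: cvgV; [rewrite gt_eqF|exact: cD].
have [] := primitive_chain (F := fun t r => ln (D t r))
  (G := fun t r => 2 * (s * (decay t * W) ^+ 2) * dlog t / D t r)
  (H := fun t r => 2 * r / D t r) pw _ _ _ _ ab.
- move=> q; apply: (@continuous_comp _ _ _ (fun q : R * R => D q.1 q.2) (@ln R)); first exact: cD.
  exact: continuous_ln.
- move=> q; apply: cvgM; last exact: cDV.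
  apply: cvgM; first by apply: cvgM; [exact: cvg_cst|exact: cphi].
  by apply: (@continuous_comp _ _ _ fst dlog); [exact: cvg_fst|exact: continuous_dlog].
- move=> q; apply: cvgM; last exact: cDV.
  by apply: cvgM; [exact: cvg_cst|exact: cvg_snd].
- move=> r r' t dr.
  have d1 := is_derive1M (is_derive_decay t) (is_derive1_cst W t).
  have d2 := is_derive1D (is_derive1M dr dr) (is_derive1M (is_derive1_cst s t) (is_derive1M d1 d1)).
  have d3 := is_derive1_compf (g := fun q => D q (r q)) (is_derive1_ln (D0 t (r t))) d2.
  apply: (is_derive1_eq d3).
  by have := D0 t (r t) => h; field; rewrite gt_eqF.
set f := (fun t => _ + _) => fi E.
rewrite -/(D b (w b)) -/(D a (w a)) E.
have mI : measurable (`[a, b]%classic : set (measurableTypeR R)) by exact: measurable_itv.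
apply: le_trans (le_normr_Rintegral mI fi) _.
have K0 : 0 <= K.
  rewrite -lee_fin; apply: le_trans hK; apply: integral_ge0 => t _.
  by rewrite lee_fin ldefect_ge0// ltW.
have ml := measurable_ldefect W0 s0 mw mp.
have il : mu1.-integrable (@setT (measurableTypeR R)) (EFin \o ldefect W w p s).
  apply/integrableP; split; first exact/measurable_EFinP.
  under eq_integral do rewrite /= ger0_norm ?ldefect_ge0 ?(ltW s0)//.
  by apply: le_lt_trans hK _; rewrite ltry.
have il' : mu1.-integrable `[a, b] (EFin \o ldefect W w p s).
  exact: (integrableS measurableT).
(* On [a, b], 1 + t^2 <= 1 + a^2 + b^2, so m phi >= 1; this removes the weight from the numerator of
   [ldefect]. *)
pose m := (1 + a ^+ 2 + b ^+ 2) / W.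
have i3 : mu1.-integrable `[a, b] (EFin \o cst (3 : R)).
  by apply: continuous_integrable_itv => t _; exact: cvg_cst.
have im : mu1.-integrable `[a, b] (EFin \o (fun t => m ^+ 2 * ldefect W w p s t)).
  exact: (integrableZl mI _ il').
apply: (@le_trans _ _ (\int[mu1]_(t in `[a, b]) (3 + m ^+ 2 * ldefect W w p s t))).
  apply: le_Rintegral => //.
  - exact: (integrable_abse fi).
  - exact: (integrableD mI i3 im).
  move=> t; rewrite /= in_itv/= => /andP[ta tb]; rewrite /f.
  have := D0 t (w t); set d := D t (w t) => d0.
  have phi0 : 0 < decay t * W by rewrite mulr_gt0// decay_gt0.
  have m1 : 1 <= m * (decay t * W).
    rewrite /m mulrCA -mulrA mulVf ?gt_eqF// mulr1 mulrC /decay ler_pdivlMr//.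
    rewrite mul1r /oneDsqr.
    by have := sqr_ge0 a; have := sqr_ge0 b; case: (leP 0 t) => t0; nra.
  have p1 := norm_dlog_le1 t.
  (* Subtracting 2 dlog, the logarithmic derivative of phi^2, isolates the combination p - dlog w
     that the defect controls. *)
  have E2 : 2 * (s * (decay t * W) ^+ 2) * dlog t / d + 2 * w t / d * p t =
      2 * dlog t + 2 * (w t * (p t - dlog t * w t)) / d.
    by rewrite /d /D; have := D0 t (w t); rewrite /D => h; field; rewrite gt_eqF.
  rewrite E2; apply: le_trans (ler_normD _ _) _.
  have h1 : `|2 * dlog t| <= 2 by rewrite normrM ger0_norm// ler_piMr.
  have h2 : `|2 * (w t * (p t - dlog t * w t)) / d| <= 1 + m ^+ 2 * ldefect W w p s t.
    rewrite normrM normfV (gtr0_norm d0) ler_pdivrMr//.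
    rewrite /ldefect -/(D t (w t)) -/d [leRHS]mulrDl mul1r -(mulrA (m ^+ 2)) divfK ?gt_eqF//.
    have h3 : w t ^+ 2 <= d by rewrite /d /D lerDl mulr_ge0 ?sqr_ge0// ltW.
    set z := p t - dlog t * w t.
    have h4 : z ^+ 2 <= m ^+ 2 * (decay t * W * z) ^+ 2.
      rewrite -exprMn [_ * (_ * z)]mulrA [(_ * z) ^+ 2]exprMn ler_peMl ?sqr_ge0//.
      by rewrite exprn_ege1.
    rewrite normrM normrM ger0_norm//.
    rewrite -(sqr_normE (w t)) in h3; rewrite -(sqr_normE z) in h4.
    by have := sqr_ge0 (`|w t| - `|z|); rewrite sqrrB; lra.
  by lra.
rewrite RintegralD// lerD//.
  have mab : fine (lebesgue_measure (`[a, b]%classic : set R)) = b - a.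
    rewrite lebesgue_measure_itv /= lte_fin; case: ltP => // ba.
    by apply/eqP; rewrite eq_sym subr_eq0 eq_le ab ba.
  have := Rintegral_cst lebesgue_measure mI (3 : R).
  by rewrite mab => ->.
rewrite RintegralZl// ler_wpM2l ?sqr_ge0//.
rewrite -lee_fin /Rintegral fineK; last exact: integrable_fin_num.
apply: le_trans hK; apply: ge0_subset_integral => //.
  exact/measurable_EFinP.
by move=> t _; rewrite lee_fin ldefect_ge0// ltW.
Qed.

(** At a zero t0 the logarithm equals ln (s phi(t0)^2). The oscillation bound, uniform in s, forces
    w(t1)^2 <= e^c phi(t0)^2 s at any other point, and s = 1 / (j + 1) tends to 0. *)
Lemma line_alternative (W : R) (w p : R -> R) (K : R) : 0 < W ->
  primitive p w -> measurable_fun (@setT (measurableTypeR R)) p ->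
  (forall j : nat, (\int[mu1]_t (ldefect W w p j.+1%:R^-1 t)%:E <= K%:E)%E) ->
  (forall t, w t = 0) \/ (forall t, w t != 0).
Proof.
move=> W0 pw mp hK.
have [[t0 wt0]|H] := pselect (exists t, w t = 0); last first.
  by right => t; apply/eqP => wt; apply: H; exists t.
left => t1; apply: contrapT => /eqP wt1.
pose c := 3 * `|t1 - t0| + ((1 + t0 ^+ 2 + t1 ^+ 2) / W) ^+ 2 * K.
have key (j : nat) : w t1 ^+ 2 <= expR c * (decay t0 * W) ^+ 2 * j.+1%:R^-1.
  have s0 : 0 < j.+1%:R^-1 :> R by rewrite invr_gt0.
  set s := j.+1%:R^-1 in s0 *.
  have hs := hK j; rewrite -/s in hs.
  have phi0 t : 0 < s * (decay t * W) ^+ 2.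
    by rewrite mulr_gt0// exprn_gt0// mulr_gt0// decay_gt0.
  have D0 t : 0 < w t ^+ 2 + s * (decay t * W) ^+ 2 by rewrite ltr_wpDl ?sqr_ge0.
  have osc : ln (w t1 ^+ 2 + s * (decay t1 * W) ^+ 2) -
      ln (w t0 ^+ 2 + s * (decay t0 * W) ^+ 2) <= c.
    have [t01|/ltW t10] := leP t0 t1.
      apply: le_trans (ler_norm _) _; apply: le_trans (ln_oscillation W0 s0 t01 pw mp hs) _.
      by rewrite /c ger0_norm// subr_ge0.
    apply: le_trans (ler_norm _) _; rewrite distrC.
    apply: le_trans (ln_oscillation W0 s0 t10 pw mp hs) _.
    by rewrite /c distrC ger0_norm ?subr_ge0// -!addrA [t1 ^+ 2 + _]addrC.
  have : ln (w t1 ^+ 2 + s * (decay t1 * W) ^+ 2) <= ln (expR c * (s * (decay t0 * W) ^+ 2)).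
    rewrite lnM ?posrE ?expR_gt0// expRK.
    by move: osc; rewrite wt0 expr0n add0r; lra.
  rewrite ler_ln ?posrE//; last by apply: mulr_gt0; [exact: expR_gt0|exact: phi0].
  move=> h; rewrite -mulrA [_ * s]mulrC; apply: le_trans h.
  by rewrite lerDl ltW.
have h : expR c * (decay t0 * W) ^+ 2 * j.+1%:R^-1 @[j --> \oo] --> (0 : R).
  have : expR c * (decay t0 * W) ^+ 2 * j.+1%:R^-1 @[j --> \oo] --> expR c * (decay t0 * W) ^+ 2 * 0.
    by apply: cvgM; [exact: cvg_cst|exact: cvg_harmonic].
  by rewrite mulr0.
have w0 : 0 < w t1 ^+ 2 by rewrite exprn_even_gt0//= wt1.
have [N _ hN] := cvgr_lt _ h _ w0.
by have := hN N (leqnn N); rewrite /= ltNge key.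
Qed.

End line_alternative.

(** * Sets that are null or full on almost every line *)

Section zero_one.
Context {R : realType} {n : nat}.
Local Notation mu := (@lebesgue_rV R n).
Local Notation mu' := (@lebesgue_rV R n.+1).
Local Notation mu1 := (@lebesgue_measure R).
Implicit Types (k : 'I_n.+1) (y : 'rV[R]_n) (a b : 'I_n.+1 -> R).

Variable E : set 'rV[R]_n.+1.
Hypothesis mE : measurable E.
Hypothesis alternative : forall k, {ae mu, forall y,
  {ae mu1, forall t, ~ E (ins k t y)} \/ {ae mu1, forall t, E (ins k t y)}}.

(** [e] is 0 or 1 according to the alternative on the line. It is independent of the box, so boxes
    that differ only in their side [k] can be compared. *)
Lemma slice_obox k y :
  {ae mu1, forall t, ~ E (ins k t y)} \/ {ae mu1, forall t, E (ins k t y)} ->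
  exists2 e : \bar R, (0 <= e)%E & forall a b,
    (\int[mu1]_t (\1_(obox a b `&` E) (ins k t y))%:E =
     mu1 `]a k, b k[%classic * (e * (\1_(obox (a \o lift k) (b \o lift k)) y)%:E))%E.
Proof.
have mi (A : set 'rV[R]_n.+1) : measurable A ->
    measurable_fun (@setT (measurableTypeR R)) (fun t : R => (\1_A (ins k t y) : R)%:E).
  move=> mA; apply/measurable_EFinP.
  have mf : measurable_fun setT (\1_A : 'rV[R]_n.+1 -> R) by exact: measurable_indic.
  exact: (measurableT_comp mf (measurable_ins_l k y)).
have mAE a b : measurable (obox a b `&` E) by apply: measurableI => //; exact: measurable_obox.
move=> [h|h].
  exists 0%E => // a b; rewrite mul0e mule0.
  rewrite (ge0_ae_eq_integral (g := cst 0%E)) ?integral0//.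
  - exact: mi.
  - apply: ae1S h => t Et _; rewrite indicE memNset//= => -[_ ?]; exact: Et.
exists 1%E => // a b; rewrite mul1e.
rewrite (ge0_ae_eq_integral (g := fun t : measurableTypeR R => (\1_(obox a b) (ins k t y) : R)%:E)) //; last 3 first.
- exact: mi.
- by apply: mi; exact: measurable_obox.
- apply: ae1S h => t Et _; congr EFin.
  have [ab|ab] := pselect (obox a b (ins k t y)); first by rewrite !indicE !mem_set.
  by rewrite !indicE !memNset// => -[].
have mI : measurable (`]a k, b k[%classic : set (measurableTypeR R)) by exact: measurable_itv.
rewrite (eq_integral (fun t : measurableTypeR R => (\1_(`]a k, b k[%classic) t)%:E *
    (\1_(obox (a \o lift k) (b \o lift k)) y)%:E)%E); last first.
  move=> t _; rewrite -EFinM; congr EFin; rewrite !indicE -natrM mulnb.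
  congr (_ : bool)%:R; apply/idP/andP => [|[]]; rewrite !inE.
    by move=> /obox_ins[].
  by move=> h1 h2; apply/obox_ins.
rewrite ge0_integralZr//; last by apply/measurable_EFinP; exact: measurable_indic.
by rewrite integral_indic// setIT.
Qed.

(** Line by line, the measure of [E] inside a box is proportional to the side of the box in the
    direction [k]. Normalising the sides one after another will leave the unit cube. *)
Lemma null_obox_step k a b :
  mu' (obox a b `&` E) = (mu1 `]a k, b k[%classic *
   mu' (obox (fun i => if i == k then 0%R else a i) (fun i => if i == k then 1%R else b i) `&` E))%E.
Proof.
have mAE a' b' : measurable (obox a' b' `&` E) by apply: measurableI => //; exact: measurable_obox.
have slice a' b' : mu' (obox a' b' `&` E) =
    (\int[mu]_y \int[mu1]_t (\1_(obox a' b' `&` E) (ins k t y))%:E)%E.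
  rewrite -(ge0_integral_insp k (f := EFin \o \1_(obox a' b' `&` E))).
  - by rewrite integral_indic// setIT.
  - by apply/measurable_EFinP; exact: measurable_indic.
  - by move=> x; rewrite lee_fin.
have ms a' b' : measurable_fun setT (fun y => \int[mu1]_t (\1_(obox a' b' `&` E) (ins k t y))%:E)%E.
  apply: (measurable_ge0_integral_ins k (f := EFin \o \1_(obox a' b' `&` E))).
  - by apply/measurable_EFinP; exact: measurable_indic.
  - by move=> x; rewrite lee_fin.
have s0 a' b' y : (0 <= \int[mu1]_t (\1_(obox a' b' `&` E) (ins k t y))%:E)%E.
  by apply: integral_ge0 => t _; rewrite lee_fin.
rewrite !slice -ge0_integralZl//.
apply: ge0_ae_eq_integral => //.
- exact: emeasurable_funM.
- by move=> y _; exact: mule_ge0.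
apply: filterS (alternative k) => y /slice_obox[e e0 he] _.
rewrite !he /= eqxx.
rewrite (_ : mu1 `]0, 1[%classic = 1%E); last by rewrite lebesgue_measure_itv/= lte_fin ltr01 sube0.
rewrite mul1e; congr (_ * (_ * (\1_(obox _ _) y)%:E))%E; apply/funext => l /=;
  by rewrite eq_sym (negbTE (neq_lift _ _)).
Qed.

Lemma null_obox_prod (s : seq 'I_n.+1) a b : uniq s ->
  mu' (obox a b `&` E) = (\prod_(k <- s) mu1 `]a k, b k[%classic *
   mu' (obox (fun i => if i \in s then 0%R else a i) (fun i => if i \in s then 1%R else b i) `&` E))%E.
Proof.
elim: s => [|k s IH]; first by rewrite big_nil mul1e.
move=> /= /andP[ks us]; rewrite big_cons (IH us) (null_obox_step k) (negbTE ks).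
have upd_in (c : R) (f : 'I_n.+1 -> R) : (fun i => if i == k then c else if i \in s then c else f i) =
    (fun i => if i \in k :: s then c else f i).
  by apply/funext => i; rewrite inE; case: (i == k).
by rewrite !upd_in muleCA muleA.
Qed.

(** With c the measure of [E] in the unit cube, restriction to [E] and c times Lebesgue measure
    agree on boxes, hence everywhere. The complement of [E] then gives 0 = c times its measure, and
    if c = 0 the whole space shows that [E] is null. *)
Lemma zero_one_law : mu' E = 0%E \/ mu' (~` E) = 0%E.
Proof.
have lty a b : (mu' (obox a b `&` E) < +oo)%E.
  apply: le_lt_trans (lebesgue_obox_lty a b).
  apply: le_measure; rewrite ?inE; [|exact: measurable_obox|exact: subIsetl].
  by apply: measurableI => //; exact: measurable_obox.
pose c := mu' (obox (fun=> 0) (fun=> 1) `&` E).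
have cfin : c \is a fin_num.
  rewrite ge0_fin_numE; last exact: measure_ge0.
  exact: lty.
have c0 : 0 <= fine c by rewrite fine_ge0// measure_ge0.
have H A : measurable A -> mrestr mu' mE A = mscale (NngNum c0) mu' A.
  apply: measure_obox_unique => a b.
    rewrite -[LHS]/(mu' (obox a b `&` E)) -[RHS]/((fine c)%:E * mu' (obox a b))%E.
    rewrite (null_obox_prod a b (index_enum_uniq 'I_n.+1)) fineK// muleC lebesgue_obox.
    have all_in (r : R) (f : 'I_n.+1 -> R) :
        (fun i => if i \in index_enum 'I_n.+1 then r else f i) = (fun=> r).
      by apply/funext => i; rewrite mem_index_enum.
    by rewrite !all_in.
  exact: lty.
have /= := H _ (measurableC mE); rewrite /mrestr setICl measure0 /mscale /= fineK//.
move/esym/eqP; rewrite mule_eq0 => /orP[/eqP c00|/eqP]; last by right.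
left; have := H setT measurableT; rewrite /mrestr setTI => ->.
by rewrite /mscale /= c00 mul0e.
Qed.

End zero_one.

Section alternative.
Context {R : realType} {n : nat}.
Local Notation mu := (@lebesgue_rV R n).
Local Notation mu' := (@lebesgue_rV R n.+1).
Local Notation mu1 := (@lebesgue_measure R).
Implicit Types (u : 'rV[R]_n.+1 -> R) (g : 'I_n.+1 -> 'rV[R]_n.+1 -> R) (k : 'I_n.+1).

(** The defect grows as s decreases, so its line integrals for s = 1 / (j + 1) increase with j. By
    monotone convergence their limit has integral at most [K]; it is finite on almost every line,
    where it is the bound uniform in j that [line_alternative] asks for. *)
Lemma lines_alternative u g (K : R) k : isgrad u g ->
  (forall s : R, 0 < s -> (\int[mu']_x (defect u g s x)%:E <= K%:E)%E) ->
  {ae mu, forall y, {ae mu1, forall t, u (ins k t y) = 0} \/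
                    {ae mu1, forall t, u (ins k t y) != 0}}.
Proof.
move=> [su hg] hK; have [sg wg] := hg k.
have mg' l : measurable_fun setT (g l) by have [[]] := hg l.
have mu_u : measurable_fun setT u by case: su.
have j0 (j : nat) : 0 < j.+1%:R^-1 :> R by rewrite invr_gt0.
pose h (j : nat) (x : 'rV[R]_n.+1) : R :=
  (weight x * (g k x - dlog (x ord0 k) * u x)) ^+ 2 / psq u j.+1%:R^-1 x.
have h0 j x : 0 <= h j x by rewrite divr_ge0 ?sqr_ge0// ltW// psq_gt0.
have mh j : measurable_fun setT (fun x => (h j x)%:E).
  by apply/measurable_EFinP; exact: measurable_defect_term.
have hK' j : (\int[mu']_x (h j x)%:E <= K%:E)%E.
  apply: le_trans (hK _ (j0 j)); apply: ge0_le_integral => //.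
  - by move=> x _; rewrite lee_fin.
  - by apply/measurable_EFinP; exact: measurable_defect.
  move=> x _; rewrite lee_fin defectE (bigD1 k)//= lerDl; apply: sumr_ge0 => l _.
  by rewrite divr_ge0 ?sqr_ge0// ltW// psq_gt0.
have hmono x j l : (j <= l)%N -> h j x <= h l x.
  move=> jl; rewrite /h ler_wpM2l ?sqr_ge0// lef_pV2 ?posrE ?psq_gt0// /psq lerD2l.
  by rewrite ler_wpM2r ?sqr_ge0// lef_pV2 ?posrE// ler_nat.
pose a (j : nat) (y : 'rV[R]_n) : \bar R := (\int[mu1]_t (h j (ins k t y))%:E)%E.
have ma j : measurable_fun setT (a j).
  by apply: (measurable_ge0_integral_ins k (mh j)) => x; rewrite lee_fin.
have mhl j y : measurable_fun (@setT (measurableTypeR R)) (fun t : R => (h j (ins k t y))%:E).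
  exact: (measurableT_comp (mh j) (measurable_ins_l k y)).
have a0 j y : (0 <= a j y)%E by apply: integral_ge0 => t _; rewrite lee_fin.
have amono y : {homo a ^~ y : j l / (j <= l)%N >-> (j <= l)%E}.
  move=> j l jl; apply: ge0_le_integral => //.
  - by move=> t _; rewrite lee_fin.
  - by move=> t _; rewrite lee_fin; exact: hmono.
pose b y := limn (a ^~ y).
have aleb j y : (a j y <= b y)%E.
  rewrite /b (cvg_lim (@ereal_hausdorff R) (ereal_nondecreasing_cvgn (amono y))).
  by apply: ereal_sup_ubound; exists j.
have acvg y : a j y @[j --> \oo] --> b y.
  by rewrite /b; exact: (ereal_nondecreasing_is_cvgn (amono y)).
have mb : measurable_fun setT b.
  by apply: (emeasurable_fun_cvg _ b ma) => y _; exact: acvg.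
have ib : (\int[mu]_y b y <= K%:E)%E.
  have mc := @cvg_monotone_convergence _ _ R mu setT measurableT a ma
    (fun j y _ => a0 j y) (fun y _ => amono y).
  rewrite -(cvg_lim (@ereal_hausdorff R) mc); apply: lime_le.
    by apply/cvg_ex; eexists; exact: mc.
  apply: nearW => j; apply: le_trans (hK' j).
  by rewrite (ge0_integral_insp k (mh j))// => x; rewrite lee_fin.
have iby : mu.-integrable setT b.
  apply/integrableP; split => //.
  under eq_integral do rewrite gee0_abs ?(le_trans (a0 0%N _) (aleb 0%N _))//.
  by apply: le_lt_trans ib _; rewrite ltry.
have hb := integrable_ae measurableT iby.
have hl := weak_partial_lines (iffRL (L2P u) su) (iffRL (L2P (g k)) sg) wg.
apply: filterS2 hb hl => y /(_ I) by_fin [w pw uw].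
have mgl : measurable_fun (@setT (measurableTypeR R)) (fun t : R => g k (ins k t y)).
  exact: measurable_line.
have cw : continuous w by exact: primitive_continuous pw.
have mw : measurable_fun (@setT (measurableTypeR R)) w by exact: continuous_measurable_fun.
have key (j : nat) : (\int[mu1]_t (ldefect (weight y) w (fun t => g k (ins k t y)) j.+1%:R^-1 t)%:E
    <= (fine (b y))%:E)%E.
  rewrite fineK//; apply: le_trans (aleb j y); rewrite le_eqVlt; apply/orP; left; apply/eqP.
  apply: ge0_ae_eq_integral => //.
  - by apply/measurable_EFinP; apply: measurable_ldefect => //; exact: weight_gt0.
  - by move=> t _; rewrite lee_fin ldefect_ge0// ltW.
  - by move=> t _; rewrite lee_fin.
  apply: ae1S uw => t ut _; congr EFin.
  by rewrite /ldefect /h /psq ins_at weight_ins ut.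
have [w0|w0] := line_alternative (weight_gt0 y) pw mgl key.
  by left; apply: ae1S uw => t ->.
by right; apply: ae1S uw => t ->.
Qed.

Lemma ae_zero_or_nonzero u g (K : R) : isgrad u g ->
  (forall s : R, 0 < s -> (\int[mu']_x (defect u g s x)%:E <= K%:E)%E) ->
  {ae mu', forall x, u x = 0} \/ {ae mu', forall x, u x != 0}.
Proof.
move=> hug hK; have mu_u : measurable_fun setT u by case: hug => -[].
pose E : set 'rV[R]_n.+1 := [set x | u x != 0].
have mE : measurable E.
  rewrite (_ : E = u @^-1` (~` [set 0])).
    by rewrite -[X in measurable X]setTI; apply: mu_u => //; exact: measurableC.
  by apply/seteqP; split => x /eqP.
have alt k : {ae mu, forall y, {ae mu1, forall t, ~ E (ins k t y)} \/ {ae mu1, forall t, E (ins k t y)}}.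
  apply: filterS (lines_alternative k hug hK) => y [h|h]; [left|right] => //.
  by apply: ae1S h => t ut; rewrite /E /= ut eqxx.
have [E0|E0] := zero_one_law mE alt.
  by left; exists E; split => // x /eqP.
right; exists (~` E); split => //; first exact: measurableC.
Qed.

End alternative.

(** * Minimizers *)

Section minimizer.
Context {R : realType} {n d m : nat}.
Variables (lam : 'I_d -> R) (beta : 'I_d -> 'I_d -> R).
Hypothesis lam0 : forall i, 0 < lam i.
Hypothesis beta_diag : forall i, 0 < beta i i.
Hypothesis beta_sym : forall i j, i != j -> beta i j = beta j i.
Variables (a : m.+1.-tuple nat) (b : 'I_d -> 'I_m).
Hypothesis ab : forall h i, (i \in block a h) = (b i == h).
Hypothesis beta_ge0 : forall i j, b i = b j -> 0 <= beta i j.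
Hypothesis beta_le0 : forall i j, b i != b j -> beta i j <= 0.
Local Notation mu := (@lebesgue_rV R n.+1).
Variable u : 'I_d -> 'rV[R]_n.+1 -> R.
Hypothesis Mu : Nehari lam beta a u.
Hypothesis u_min : forall z : 'I_d -> 'rV[R]_n.+1 -> R,
  Nehari lam beta a z -> J lam beta u <= J lam beta z.
Variable g : 'I_d -> 'I_n.+1 -> 'rV[R]_n.+1 -> R.
Hypothesis hug : forall i, isgrad (u i) (g i).

Let Hu i : H1 (u i). Proof. by case: Mu. Qed.

Let mu_u i : measurable_fun setT (u i).
Proof. exact: H1_measurable. Qed.

Let A h := block_energy lam b u g h.

Let A_gt0 h : 0 < A h.
Proof. by have /(NehariP lam0 beta_sym ab Hu)/(_ h)[] := Mu; rewrite (block_energy_nrg lam0 b h hug). Qed.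

Let JA : J lam beta u = 4^-1 * \sum_h A h.
Proof.
rewrite (J_Nehari lam0 beta_sym ab Mu); congr (_ * _).
by apply: eq_bigr => h _; exact: block_energy_nrg.
Qed.

Let cross h := \sum_(i | b i == h) \sum_(j | b j != h) beta i j * overlap (u i) (u j).

Let inner h := \sum_i \sum_j blockc beta b h i j * overlap (u i) (u j).

Let cross_term_le0 i j : b j != b i -> beta i j * overlap (u i) (u j) <= 0.
Proof.
by move=> ij; apply: mulr_le0_ge0; [apply: beta_le0; rewrite eq_sym|exact: overlap_ge0].
Qed.

Let cross_le0 h : cross h <= 0.
Proof.
apply: sumr_le0 => i /eqP bi; apply: sumr_le0 => j bj.
by apply: cross_term_le0; rewrite bi.
Qed.

Let A_split h : A h = inner h + cross h.
Proof.
have /(NehariP lam0 beta_sym ab Hu)/(_ h)[_] := Mu.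
rewrite (block_energy_nrg lam0 b h hug) -/(A h) => ->.
rewrite /inner blockc_sum /cross -big_split; apply: eq_bigr => i _.
by rewrite (bigID (fun j => b j == h)).
Qed.

(** Only an inequality: a divergent overlap counts as 0 on the left, while the right side is a sum
    of nonnegative extended terms. *)
Let inner_le h : ((inner h)%:E <= \int[mu]_x (quartic beta b h u x)%:E)%E.
Proof.
rewrite integral_quartic// /inner -sumEFin; apply: lee_sum => i _.
rewrite -sumEFin; apply: lee_sum => j _; rewrite EFinM; apply: lee_wpmul2l.
  by rewrite lee_fin blockc_ge0.
have I0 : (0 <= \int[mu]_x (u i x ^+ 2 * u j x ^+ 2)%:E)%E.
  by apply: integral_ge0 => x _; rewrite lee_fin; apply: mulr_ge0; exact: sqr_ge0.
rewrite /overlap /Rintegral; case: (\int[mu]_x _)%E I0 => [r|//|] //=.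
Qed.

Lemma block_energy_le_quartic h : ((A h)%:E <= \int[mu]_x (quartic beta b h u x)%:E)%E.
Proof. by apply: le_trans (inner_le h); rewrite lee_fin A_split gerDl. Qed.

(** Otherwise some c > A_h lies below the quartic integral of the block. With A_k kept for the other
    blocks, the competitor bound would be strictly below J(u), since A_h^2 / c < A_h. *)
Lemma integral_quartic_minimizer h : (\int[mu]_x (quartic beta b h u x)%:E = (A h)%:E)%E.
Proof.
apply/eqP; rewrite eq_le block_energy_le_quartic andbT leNgt; apply/negP => lt.
(* A real number is needed even when the integral is infinite; A_h + 1 serves in that case. *)
have [c [c1 c2]] : exists c, A h < c /\ (c%:E <= \int[mu]_x (quartic beta b h u x)%:E)%E.
  move: lt; case: (\int[mu]_x _)%E => [r|_|//]; first by rewrite lte_fin => lt; exists r.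
  by exists (A h + 1); rewrite ltrDl ltr01 leey.
pose e k := if k == h then c else A k.
have e0 k : 0 < e k by rewrite /e; case: eqP => _ //; exact: lt_trans c1.
have he k : ((e k)%:E <= \int[mu]_x (quartic beta b k u x)%:E)%E.
  by rewrite /e; case: eqP => [->//|_]; exact: block_energy_le_quartic.
have := competitor_bound lam0 beta_sym ab beta_ge0 u_min hug e0 he.
rewrite JA ler_pM2l ?invr_gt0// leNgt => /negP; apply.
rewrite (bigD1 h)//= [ltRHS](bigD1 h)//= ltr_leD//.
  by rewrite /e eqxx -/(A h) ltr_pdivrMr ?(lt_trans _ c1)// expr2 ltr_pM2l.
apply: ler_sum => k kh; rewrite /e (negbTE kh) -/(A k) expr2 mulfK// gt_eqF//.
Qed.

Let cross_eq0 h : cross h = 0.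
Proof.
apply/eqP; rewrite eq_le cross_le0 /=.
have := inner_le h; rewrite integral_quartic_minimizer lee_fin A_split.
by rewrite lerDl.
Qed.

(** The diagonal term with its positive coefficient [beta i i] is dominated by the quartic integral
    of the block, now known to be finite. *)
Let quartic_finite i : (\int[mu]_x (u i x ^+ 2 * u i x ^+ 2)%:E < +oo)%E.
Proof.
have : (\int[mu]_x (quartic beta b (b i) u x)%:E < +oo)%E.
  by rewrite integral_quartic_minimizer ltry.
apply: contraTT; rewrite -leNgt leye_eq => /eqP ioo.
rewrite -leNgt leye_eq integral_quartic//; apply/eqP.
pose T k l := ((blockc beta b (b i) k l)%:E * \int[mu]_x (u k x ^+ 2 * u l x ^+ 2)%:E)%E.
have T0 k l : (0 <= T k l)%E.
  apply: mule_ge0; first by rewrite lee_fin blockc_ge0.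
  by apply: integral_ge0 => x _; rewrite lee_fin; apply: mulr_ge0; exact: sqr_ge0.
have Tii : T i i = +oo%E by rewrite /T ioo /blockc eqxx mulr1n gt0_muley ?lte_fin ?beta_diag.
apply/eqP; rewrite -leye_eq -{1}Tii -/T.
apply: (@le_trans _ _ (\sum_l T i l)%E).
  by rewrite (bigD1 i)//=; apply: leeDl; exact: sume_ge0.
rewrite [leRHS](bigD1 i)//=; apply: leeDl; apply: sume_ge0 => k _.
by apply: sume_ge0 => l _; exact: (T0 k l).
Qed.

(** The interactions of a block with the others have one sign and sum to 0, so each vanishes. A zero
    [overlap] means a zero integral only if that integral is finite, which follows from the two
    diagonal quartic integrals. *)
Lemma ae_disjoint i j : b i != b j -> beta i j < 0 ->
  {ae mu, forall x, u i x = 0 \/ u j x = 0}.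
Proof.
move=> bij bneg.
have q0 k l x : 0 <= u k x ^+ 2 * u l x ^+ 2 by apply: mulr_ge0; exact: sqr_ge0.
have i4 k : mu.-integrable setT (EFin \o (fun x => u k x ^+ 2 * u k x ^+ 2)).
  apply/integrableP; split; first by apply/measurable_EFinP; exact: measurable_overlap.
  under eq_integral do rewrite /= ger0_norm ?q0//.
  exact: quartic_finite.
have iij : mu.-integrable setT (EFin \o (fun x => u i x ^+ 2 * u j x ^+ 2)).
  apply: (le_integrable _ _ _ (integrableD measurableT (i4 i) (i4 j))) => //.
    by apply/measurable_EFinP; exact: measurable_overlap.
  move=> x _ /=; rewrite lee_fin ler_norml; apply/andP.
  rewrite !ger0_norm; last by apply: addr_ge0; apply: mulr_ge0; exact: sqr_ge0.
  set p := u i x ^+ 2; set q := u j x ^+ 2.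
  have p0 : 0 <= p by exact: sqr_ge0.
  have r0 : 0 <= q by exact: sqr_ge0.
  have := mulr_ge0 p0 r0; have := mulr_ge0 p0 p0; have := mulr_ge0 r0 r0.
  by have := sqr_ge0 (p - q); rewrite sqrrB !expr2 => *; split; lra.
have ov0 : overlap (u i) (u j) = 0.
  have bji : b j != b i by rewrite eq_sym.
  have := cross_eq0 (b i); rewrite /cross (bigD1 i)//= => /eqP.
  rewrite naddr_eq0; last 2 first.
  - by apply: sumr_le0 => k bk; exact: cross_term_le0.
  - by apply: sumr_le0 => k /andP[/eqP bk _]; apply: sumr_le0 => l bl; apply: cross_term_le0; rewrite bk.
  move=> /andP[/eqP + _]; rewrite (bigD1 j)//= => /eqP; rewrite naddr_eq0; last 2 first.
  - exact: cross_term_le0.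
  - by apply: sumr_le0 => k /andP[bk _]; exact: cross_term_le0.
  by move=> /andP[]; rewrite mulf_eq0 lt_eqF//= => /eqP.
have I0 : (\int[mu]_x `|(u i x ^+ 2 * u j x ^+ 2)%:E| = 0)%E.
  under eq_integral do rewrite gee0_abs ?lee_fin ?q0//.
  rewrite -[LHS]fineK; last exact: (integrable_fin_num measurableT iij).
  by have := ov0; rewrite /overlap /Rintegral => ->.
have := (ae_eq_integral_abs mu measurableT (measurable_int mu iij)).1 I0.
apply: filterS => x /(_ I)/= [] /eqP; rewrite mulf_eq0 !sqrf_eq0.
by move=> /orP[/eqP|/eqP]; [left|right].
Qed.

(** The numbers A_h remain lower bounds for the larger quartic integrals, so the sum of A_h is at
    most the sum of A_h(v)^2 / A_h. Only the block of [i], and in it only component [i], has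
    changed, so its energy cannot have decreased. *)
Lemma energy_le_perturb i s : 0 < s ->
  energy (lam i) (u i) (g i) <= energy (lam i) (perturb (u i) s) (dperturb (u i) (g i) s).
Proof.
move=> s0.
pose v j := if j == i then perturb (u j) s else u j.
pose dv j := if j == i then dperturb (u j) (g j) s else g j.
have hv j : isgrad (v j) (dv j).
  by rewrite /v /dv; case: eqP => _; [exact: isgrad_perturb|exact: hug].
have uv j x : u j x ^+ 2 <= v j x ^+ 2.
  rewrite /v; case: eqP => _ //; rewrite perturb_sqr// /psq lerDl.
  by apply: mulr_ge0; [exact: ltW|exact: sqr_ge0].
have mv j : measurable_fun setT (v j) by case: (hv j) => -[].
have Av h : ((A h)%:E <= \int[mu]_x (quartic beta b h v x)%:E)%E.
  apply: le_trans (block_energy_le_quartic h) _; apply: ge0_le_integral => //.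
  - by move=> x _; rewrite lee_fin quartic_ge0.
  - by apply/measurable_EFinP; exact: measurable_quartic.
  - by apply/measurable_EFinP; exact: measurable_quartic.
  move=> x _; rewrite lee_fin; apply: ler_sum => j _; apply: ler_sum => k _.
  apply: ler_wpM2l; first exact: blockc_ge0.
  by apply: ler_pM => //; exact: sqr_ge0.
have := competitor_bound lam0 beta_sym ab beta_ge0 u_min hv A_gt0 Av.
rewrite JA ler_pM2l ?invr_gt0// (bigD1 (b i))//= [leRHS](bigD1 (b i))//=.
rewrite [X in _ <= _ + X](eq_bigr A); last first.
  move=> h hi; rewrite (_ : block_energy lam b v dv h = A h).
    by rewrite expr2 mulfK// gt_eqF.
  apply: eq_bigr => j /eqP bj; rewrite /v /dv; case: eqP => // ji.
  by move: hi; rewrite -bj ji eqxx.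
rewrite lerD2r ler_pdivlMr// -expr2 ler_sqr ?nnegrE ?(ltW (A_gt0 _))//; last first.
  by apply: sumr_ge0 => j _; apply: energy_ge0; exact: ltW.
rewrite /A /block_energy (bigD1 i)//= [leRHS](bigD1 i)//= {1}/v {1}/dv eqxx.
rewrite [X in _ <= _ + X](eq_bigr (fun j => energy (lam j) (u j) (g j))); last first.
  by move=> j /andP[_ ji]; rewrite /v /dv (negbTE ji).
by rewrite lerD2r.
Qed.

Lemma component_zero_or_nonzero i :
  {ae mu, forall x, u i x = 0} \/ {ae mu, forall x, u i x != 0}.
Proof.
apply: (ae_zero_or_nonzero (hug i)) => s s0.
by apply: (defect_le s0 (lam0 i) (hug i)); exact: energy_le_perturb.
Qed.

(** A vanishing block would have quartic integral 0, whereas this integral equals the positive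
    energy of the block. *)
Lemma block_nonzero h : exists2 i, b i = h & ~ {ae mu, forall x, u i x = 0}.
Proof.
apply: contrapT => H.
have z i : b i = h -> {ae mu, forall x, u i x = 0}.
  by move=> bi; apply: contrapT => ui; apply: H; exists i.
have zall : {ae mu, forall x, forall i, b i = h -> u i x = 0}.
  apply: filter_forall => i; have [bi|bi] := eqVneq (b i) h.
    by apply: filterS (z i bi) => x.
  by apply: aeW => x /eqP; rewrite (negbTE bi).
have : (\int[mu]_x (quartic beta b h u x)%:E = 0)%E.
  rewrite (ge0_ae_eq_integral (g := cst 0%E)) ?integral0//.
  - by apply/measurable_EFinP; exact: measurable_quartic.
  - by move=> x _; rewrite lee_fin quartic_ge0.
  apply: filterS zall => x ux _; congr EFin; rewrite /quartic blockc_sum.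
  apply: big1 => i /eqP bi; apply: big1 => j _.
  by rewrite ux// expr0n mul0r mulr0.
rewrite integral_quartic_minimizer => -[] /eqP.
by rewrite gt_eqF.
Qed.

Lemma no_minimizer h1 h2 : h1 != h2 ->
  (forall i j, b i = h1 -> b j = h2 -> beta i j < 0) -> False.
Proof.
move=> h12 neg; have [i bi ui] := block_nonzero h1; have [j bj uj] := block_nonzero h2.
have bij : b i != b j by rewrite bi bj.
have dis := ae_disjoint bij (neg i j bi bj).
have [//|ui'] := component_zero_or_nonzero i.
by apply: uj; apply: filterS2 dis ui' => x [->|//]; rewrite eqxx.
Qed.

End minimizer.

Theorem theorem1p6 (R : realType) (N d m : nat)
    (lam : 'I_d -> R) (beta : 'I_d -> 'I_d -> R) (a : m.+1.-tuple nat)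
    (hN : N = 2%N \/ N = 3%N) (hd : (2 <= d)%N) (hm : (1 <= m <= d)%N)
    (hlam : forall i, 0 < lam i) (hbeta : forall i, 0 < beta i i)
    (hsym : forall i j, i != j -> beta i j = beta j i)
    (ha : is_decomposition d a)
    (hK1 : forall i j, (i, j) \in K1 a -> 0 <= beta i j)
    (hK2 : forall i j, (i, j) \in K2 a -> beta i j <= 0)
    (hneg : exists h1 h2 : 'I_m, h1 != h2 /\
      forall i j, i \in block a h1 -> j \in block a h2 -> beta i j < 0) :
  let M := @Nehari R N d lam beta m a in
  let l := ereal_inf [set (J lam beta u)%:E | u in M] in
  ~ exists2 u, M u & (J lam beta u)%:E = l.
Proof.
move=> M l [u Mu ul].
have [b ab] := block_index ha.
have beta_ge0 i j : b i = b j -> 0 <= beta i j.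
  (* [K1] leaves out the diagonal, where the sign comes from [hbeta]. *)
  have [->|ij bij] := eqVneq i j; first by move=> _; exact: ltW.
  apply: hK1; rewrite inE /= ij /=; apply/existsP; exists (b i).
  by rewrite !ab bij eqxx.
have beta_le0 i j : b i != b j -> beta i j <= 0.
  move=> bij; apply: hK2; rewrite inE; apply/existsP; exists (b i).
  by apply/existsP; exists (b j); rewrite bij !ab !eqxx.
have u_min z : M z -> J lam beta u <= J lam beta z.
  by move=> Mz; rewrite -lee_fin ul; apply: ereal_inf_lbound; exists z.
(* Lines parallel to an axis split off one coordinate, hence the form n + 1 of the dimension. *)
have [n Nn] : exists n, N = n.+1 by case: hN => ->; [exists 1%N|exists 2%N].
subst N; have [h1 [h2 [h12 neg]]] := hneg.
have ex i : exists g, isgrad (u i) g by apply/H1P; case: Mu.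
have [g hug] := choice ex.
apply: (no_minimizer hlam hbeta hsym ab beta_ge0 beta_le0 Mu u_min hug h12) => i j bi bj.
by apply: neg; rewrite ab ?bi ?bj eqxx.
Qed.
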